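(* Let $0<q<1$, let $z$ be a nonzero complex number, let $\tau,\theta\in\mathbb{R}$, and put $$s=\frac{1+\tau}{2}+i\frac{\theta\pi}{\log q},\qquad \sinh\xi_n=\frac{q^{-ns}z-q^{ns}z^{-1}}{2}\quad(n\in\mathbb{N}).$$ Let $h_n(x|q)$ be the Ismail-Masson polynomials, and let $A_q$, $B_q$, $\Theta(\cdot|q)$, $\chi$, $\mathbb{S}(\cdot)$ and the generalized irrationality measure $\omega$ be as defined in the context. Then the following hold. (1) If $\tau>0$, then for every positive integer $n$ $$\frac{h_n(\sinh\xi_n|q)}{z^nq^{-n^2s}}=1+r_{im}(n|1),\qquad |r_{im}(n|1)|\le\frac{qB_q(q^2|z|^{-2})}{(1-q)|z|^2}\,q^{n\tau}.$$ (2) Suppose $\tau=0$ and $\theta$ is rational. For any $\lambda\in\mathbb{S}(\theta)$ there are infinitely many pairs of integers $n,m$ with $n>0$ such that $n\theta=m+\lambda$, $\lambda=\{n\theta\}$. For each such $n$, $$\frac{h_n(\sinh\xi_n|q)}{z^nq^{-n^2/2}e^{-n^2\theta\pi i}}=A_q\left(\frac{e^{2\lambda\pi i}}{z^2}\right)+r_{im}(n|2),$$ where, for $n$ sufficiently large, $$|r_{im}(n|2)|\le\frac{3(-q^3;q)_\infty B_q(|z|^{-2})}{(1-q)(q;q)_\infty}\left\{q^{n/2}+\frac{q^{n^2/4}}{|z|^{2\lfloor n/2\rfloor}}\right\}.$$ (3) Suppose $\tau=0$ and $\theta$ is irrational. Given any real number $\beta$ and any real $\rho$ with $0<\rho<\omega(\theta|\beta)-1$,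 there are infinitely many pairs of integers $n,m$ with $n>0$ such that $n\theta=m+\beta+\gamma_n$ with $|\gamma_n|\le n^{-\rho}$. For each such $n$, $$\frac{h_n(\sinh\xi_n|q)}{z^nq^{-n^2/2}e^{-n^2\theta\pi i}}=A_q\left(\frac{e^{2\pi i\beta}}{z^2}\right)+e_{im}(n|3),$$ where, for $n$ sufficiently large, $$|e_{im}(n|3)|\le\frac{48(-q^3;q)_\infty B_q(|z|^{-2})}{(1-q)(q;q)_\infty}\left\{\frac{\log^2n}{n^\rho}+\frac{q^{\nu_n^2}}{|z|^{2\nu_n}}\right\},\qquad \nu_n=\left\lfloor\frac{q^4\log^2n}{1+\log q^{-1}}\right\rfloor.$$ (4) Suppose $-1<\tau<0$ and both $\tau$ and $\theta$ are rational. Assume that for some $\lambda\in\mathbb{S}(-\tau)$ and some $\lambda_1\in\mathbb{S}(\theta)$ there are infinitely many positive integers $n$ such that $-n\tau=m+\lambda$ with $m=\lfloor-\tau n\rfloor$, $\lambda=\{-\tau n\}$, and $n\theta=m_1+\lambda_1$ with $m_1\in\mathbb{Z}$, $\lambda_1=\{n\theta\}$. Then for each such $n$, $m$, $m_1$, $$h_n(\sinh\xi_n|q)=\frac{z^nq^{-n^2s+\lfloor m/2\rfloor(\tau n+\lfloor m/2\rfloor)}}{(q;q)_\infty(-z^2e^{-2\pi i\lambda_1})^{\lfloor m/2\rfloor}}\left\{\Theta\left(-z^2q^{\chi(m)+\lambda}e^{-2\pi i\lambda_1}\mid q\right)+r_{im}(n|4)\right\},$$ where, for $n$ sufficiently large,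 $$|r_{im}(n|4)|\le\frac{14(-q^3;q)_\infty^2\,\Theta(|z|^2\mid\sqrt q)}{(1-q)^2(q;q)_\infty}\left\{q^{\nu_n}+q^{\nu_n^2}|z|^{2\nu_n}+\frac{q^{\nu_n^2/2}}{|z|^{2\nu_n}}\right\},\qquad \nu_n=\min\left\{\left\lfloor\frac{(1+\tau)n}{4}\right\rfloor,\left\lfloor\frac{-\tau n}{4}\right\rfloor\right\}.$$ (5) Suppose $-1<\tau<0$, $\tau$ is rational and $\theta$ is irrational. Given a real number $\beta\in[0,1)$ and $0<\rho<\omega(\theta|\beta)-1$, there are some $\lambda\in\mathbb{S}(-\tau)$ and infinitely many positive integers $n$ such that $n\theta=m_1+\beta+b_n$ with $m_1\in\mathbb{Z}$, $|b_n|\le n^{-\rho}$, and $-n\tau=m+\lambda$ with $m=\lfloor-n\tau\rfloor$. For each such $\lambda,\beta,n,m$, $$h_n(\sinh\xi_n|q)=\frac{z^nq^{-n^2s+\lfloor m/2\rfloor(\tau n+\lfloor m/2\rfloor)}}{(-z^2e^{-2n\theta\pi i})^{\lfloor m/2\rfloor}(q;q)_\infty}\left\{\Theta\left(-z^2q^{\chi(m)+\lambda}e^{-2\beta\pi i}\mid q\right)+r_{im}(n|5)\right\},$$ where, for $n$ sufficiently large, $$|r_{im}(n|5)|\le\frac{62(-q^3;q)_\infty^2\,\Theta(|z|^2\mid\sqrt q)}{(1-q)^2(q;q)_\infty}\left\{|z|^{2\nu_n}q^{\nu_n^2}+\frac{q^{\nu_n^2/2}}{|z|^{2\nu_n}}+\frac{\log^2n}{n^\rho}\right\},\qquad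 \nu_n=\left\lfloor\frac{q^4\log^2n}{1+\log q^{-1}}\right\rfloor.$$ (6) Suppose $-1<\tau<0$, $\tau$ is irrational and $\theta$ is rational. Given a real number $\beta\in[0,1)$ and $0<\rho<\omega(-\tau|\beta)-1$, there are some $\lambda\in\mathbb{S}(\theta)$ and infinitely many positive integers $n$ such that $-n\tau=m+\beta+a_n$ with $m\in\mathbb{Z}$, $|a_n|\le n^{-\rho}$, and $n\theta=m_1+\lambda$ with $m_1\in\mathbb{Z}$, $\lambda=\{n\theta\}$. For each such $\lambda,\beta,n,m$, $$h_n(\sinh\xi_n|q)=\frac{z^nq^{-n^2s+\lfloor m/2\rfloor(\tau n+\lfloor m/2\rfloor)}}{(-z^2e^{-2n\theta\pi i})^{\lfloor m/2\rfloor}(q;q)_\infty}\left\{\Theta\left(-z^2q^{\chi(m)+\beta}e^{-2\lambda\pi i}\mid q\right)+r_{im}(n|6)\right\},$$ where, for $n$ sufficiently large, $$|r_{im}(n|6)|\le\frac{62(-q^3;q)_\infty^2\,\Theta(|z|^2\mid\sqrt q)}{(1-q)^2(q;q)_\infty}\left\{|z|^{2\nu_n}q^{\nu_n^2}+\frac{q^{\nu_n^2/2}}{|z|^{2\nu_n}}+\frac{\log^2n}{n^\rho}\right\},\qquad \nu_n=\left\lfloor\frac{q^4\log^2n}{1+\log q^{-1}}\right\rfloor.$$ (7) Suppose $-1<\tau<0$ and both $\tau$ and $\theta$ are irrational. Assume that there exist two real numbers $\beta_1,\beta_2\in[0,1)$ with $\omega(-\tau,\theta|\beta_1,\beta_2)>1$.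 Then for any $0<\rho<\omega(-\tau,\theta|\beta_1,\beta_2)-1$ there are infinitely many positive integers $n$ such that $-\tau n=m+\beta_1+a_n$ with $m\in\mathbb{Z}$, $|a_n|<n^{-\rho}$, and $n\theta=m_1+\beta_2+b_n$ with $m_1\in\mathbb{Z}$, $|b_n|<n^{-\rho}$. For each such $\beta_1,\beta_2,n,m$, $$h_n(\sinh\xi_n|q)=\frac{z^nq^{-n^2s+\lfloor m/2\rfloor(\tau n+\lfloor m/2\rfloor)}}{(-z^2e^{-2n\theta\pi i})^{\lfloor m/2\rfloor}(q;q)_\infty}\left\{\Theta\left(-z^2q^{\chi(m)+\beta_1}e^{-2\beta_2\pi i}\mid q\right)+r_{im}(n|7)\right\},$$ where, for $n$ sufficiently large, $$|r_{im}(n|7)|\le\frac{62(-q^3;q)_\infty^2\,\Theta(|z|^2\mid\sqrt q)}{(1-q)^2(q;q)_\infty}\left\{|z|^{2\nu_n}q^{\nu_n^2}+\frac{q^{\nu_n^2/2}}{|z|^{2\nu_n}}+\frac{\log^2n}{n^\rho}\right\},\qquad \nu_n=\left\lfloor\frac{q^4\log^2n}{1+\log q^{-1}}\right\rfloor.$$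
   Context: Throughout $0<q<1$, and $q^{w}=e^{w\log q}$ for $w\in\mathbb{C}$ with $\log q$ real. $q$-notation: $(a;q)_0=1$, $(a;q)_n=\prod_{k=0}^{n-1}(1-aq^k)$, $(a;q)_\infty=\prod_{k=0}^{\infty}(1-aq^k)$, and $\left[\begin{smallmatrix}n\\k\end{smallmatrix}\right]_q=\frac{(q;q)_n}{(q;q)_k(q;q)_{n-k}}$. Ismail-Masson polynomials: $h_n(x|q)$ is the polynomial of degree $n$ in $x$ determined by $$h_n(\sinh\xi|q)=\sum_{k=0}^n\left[\begin{matrix}n\\k\end{matrix}\right]_q q^{k(k-n)}(-1)^ke^{(n-2k)\xi}.$$ (With $\sinh\xi_n$ as in the claim one may take $e^{\xi_n}=q^{-ns}z$.) Ramanujan function and companion: $A_q(w)=\sum_{k=0}^\infty\frac{q^{k^2}}{(q;q)_k}(-w)^k$ and $B_q(w)=\sum_{k=0}^\infty\frac{q^{k^2}}{(q;q)_k}w^k$. Theta function: $\Theta(w|q)=\sum_{n=-\infty}^{\infty}q^{n^2}w^n$ for $w\in\mathbb{C}\setminus\{0\}$; $\Theta(w\mid\sqrt q)$ is the same with $q$ replaced by $\sqrt q$. For real $x$, $\lfloor x\rfloor$ is the greatest integer $\le x$ and $\{x\}=x-\lfloor x\rfloor\in[0,1)$. For an integer $n$, $\chi(n)=n-2\lfloor n/2\rfloor$ (so $\chi(n)=1$ if $n$ is odd and $0$ if $n$ is even). For real $\theta$, $\mathbb{S}(\theta)=\{\{n\theta\}:n\in\mathbb{N}\}$. Generalized irrationality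 measure: for real numbers $\theta_1,\dots,\theta_N$ and $\beta_1,\dots,\beta_N$, $\omega(\theta_1,\dots,\theta_N|\beta_1,\dots,\beta_N)$ is the least upper bound (possibly $+\infty$) of the set of real numbers $r$ such that there exist infinitely many integers $n$ and $m_1,\dots,m_N$ with $n>0$ such that $|n\theta_j-\beta_j-m_j|<\frac{1}{n^{r-1}}$ for $j=1,\dots,N$. ''For $n$ sufficiently large'' means: for all $n$ of the indicated kind exceeding some threshold, which may depend on the fixed data ($q,z,\tau,\theta$ and, where present, $\lambda,\lambda_1,\beta,\beta_1,\beta_2,\rho$) but not on $n$. *)

(* Defs.v *)
From Stdlib Require Import Reals ZArith List Lia Lra QArith Qreals ClassicalEpsilon.
From Coquelicot Require Import Coquelicot.
Open Scope R_scope.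

Definition Cexp (w : C) : C :=
  (exp (Re w) * cos (Im w), exp (Re w) * sin (Im w)).

Definition csinh (xi : C) : C := ((Cexp xi - Cexp (- xi)) / 2)%C.

Definition CpowZ (w : C) (k : Z) : C :=
  match k with
  | Z0 => 1%C
  | Zpos p => Cpow w (Pos.to_nat p)
  | Zneg p => Cinv (Cpow w (Pos.to_nat p))
  end.

(* q^w = e^{w log q} with the real logarithm of q > 0. *)
Definition qpow (q : R) (w : C) : C := Cexp (w * RtoC (ln q)).

(* Sum of a convergent complex series, computed componentwise. *)
Definition CSeries (a : nat -> C) : C :=
  (Series (fun k => Re (a k)), Series (fun k => Im (a k))).

Fixpoint qpoch (a q : R) (n : nat) : R :=
  match n with
  | O => 1
  | S k => qpoch a q k * (1 - a * q ^ k)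
  end.

Definition qpoch_inf (a q : R) : R := real (Lim_seq (qpoch a q)).

Definition qbinom (q : R) (n k : nat) : R :=
  qpoch q q n / (qpoch q q k * qpoch q q (n - k)).

Definition Aq (q : R) (w : C) : C :=
  CSeries (fun k => (RtoC (q ^ (k * k) / qpoch q q k) * Cpow (- w) k)%C).

Definition Bq (q : R) (w : C) : C :=
  CSeries (fun k => (RtoC (q ^ (k * k) / qpoch q q k) * Cpow w k)%C).

(* The bilateral series, split into the indices n >= 0 and n <= -1. *)
Definition Theta (q : R) (w : C) : C :=
  (CSeries (fun k => RtoC (q ^ (k * k)) * Cpow w k)
   + CSeries (fun k => RtoC (q ^ (S k * S k)) * Cpow (/ w) (S k)))%C.

Definition is_poly_of_degree (n : nat) (f : C -> C) : Prop :=
  exists a : nat -> C,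
    a n <> RtoC 0 /\ forall x : C, f x = sum_n (fun k => a k * Cpow x k)%C n.

Definition ismail_masson_sum (q : R) (n : nat) (xi : C) : C :=
  sum_n (fun k =>
    RtoC (qbinom q n k
          * powerRZ q (Z.of_nat k * (Z.of_nat k - Z.of_nat n))
          * (-1) ^ k)
    * Cexp (RtoC (IZR (Z.of_nat n - 2 * Z.of_nat k)) * xi))%C n.

Definition is_ismail_masson (q : R) (n : nat) (f : C -> C) : Prop :=
  is_poly_of_degree n f /\
  forall xi : C, f (csinh xi) = ismail_masson_sum q n xi.

(* The identity prescribes h_n on the range of sinh, which is all of C; the
   lemma [ismail_masson_spec] below shows that such an h_n exists for
   0 < q < 1. *)
Definition ismail_masson (q : R) (n : nat) : C -> C :=
  epsilon (inhabits (fun _ : C => RtoC 0)) (is_ismail_masson q n).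

Definition infinitely_many {T : Type} (P : T -> Prop) : Prop :=
  forall l : list T, exists x : T, ~ In x l /\ P x.

Definition rational (x : R) : Prop := exists r : Q, x = Q2R r.
Definition irrational (x : R) : Prop := ~ rational x.

(* Stdlib's [Int_part] and [frac_part] are the floor and the fractional part. *)
Definition Sfrac (theta x : R) : Prop :=
  exists n : nat, x = frac_part (INR n * theta).

Definition chi (n : Z) : Z := (n - 2 * (n / 2))%Z.

(* The real r is admissible when infinitely many tuples (n, m_1, ..., m_N) of
   integers with n > 0 satisfy the N inequalities; N is the common length of
   [theta] and [beta]. *)
Definition omega_admissible (theta beta : list R) (r : R) : Prop :=
  infinitely_many (fun p : nat * list Z =>
    let (n, m) := p in
    (0 < n)%nat /\ length m = length theta /\
    forall j : nat, (j < length theta)%nat ->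
      Rabs (INR n * nth j theta 0 - nth j beta 0 - IZR (nth j m 0%Z))
      < 1 / Rpower (INR n) (r - 1)).

Definition omega (theta beta : list R) : Rbar :=
  Lub_Rbar (omega_admissible theta beta).

Definition im_s (q tau theta : R) : C :=
  (RtoC ((1 + tau) / 2) + Ci * RtoC (theta * PI / ln q))%C.

(* sinh xi_n, where e^{xi_n} = q^{-ns} z. *)
Definition sinh_xi (q : R) (z : C) (tau theta : R) (n : nat) : C :=
  let ns := (RtoC (INR n) * im_s q tau theta)%C in
  ((qpow q (- ns) * z - qpow q ns * / z) / 2)%C.

Definition h_at (q : R) (z : C) (tau theta : R) (n : nat) : C :=
  ismail_masson q n (sinh_xi q z tau theta n).

(* z^n q^{-n^2/2} e^{-n^2 theta pi i} *)
Definition norm0 (q : R) (z : C) (theta : R) (n : nat) : C :=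
  (Cpow z n * RtoC (Rpower q (- (INR n ^ 2 / 2)))
   * Cexp (- (RtoC (INR n ^ 2 * theta * PI) * Ci)))%C.

(* z^n q^{-n^2 s + M (tau n + M)} / ((-z^2 e^{-2 pi i phi})^M (q;q)_oo),
   where M = floor(m/2). *)
Definition theta_prefactor (q : R) (z : C) (tau theta : R)
    (n : nat) (m : Z) (phi : R) : C :=
  let M := (m / 2)%Z in
  (Cpow z n
   * qpow q (- (RtoC (INR n ^ 2) * im_s q tau theta)
             + RtoC (IZR M * (tau * INR n + IZR M)))
   / (CpowZ (- (Cpow z 2 * Cexp (- (RtoC (2 * PI * phi) * Ci)))) M
      * RtoC (qpoch_inf q q)))%C.

(* -z^2 q^a e^{-2 pi i phi} *)
Definition theta_arg (q : R) (z : C) (a phi : R) : C :=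
  (- (Cpow z 2 * RtoC (Rpower q a) * Cexp (- (RtoC (2 * PI * phi) * Ci))))%C.

Definition nu_log (q : R) (n : nat) : Z :=
  Int_part (q ^ 4 * ln (INR n) ^ 2 / (1 + ln (/ q))).

Definition nu_min (tau : R) (n : nat) : Z :=
  Z.min (Int_part ((1 + tau) * INR n / 4)) (Int_part (- tau * INR n / 4)).

(* x = m + beta + g with |g| <= eps, resp. |g| < eps *)
Definition approx_le (x beta eps : R) (m : Z) : Prop :=
  exists g : R, x = IZR m + beta + g /\ Rabs g <= eps.

Definition approx_lt (x beta eps : R) (m : Z) : Prop :=
  exists g : R, x = IZR m + beta + g /\ Rabs g < eps.

(* x = m + lambda with m = floor(x) and lambda = {x} *)
Definition floor_split (x lambda : R) (m : Z) : Prop :=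
  x = IZR m + lambda /\ m = Int_part x /\ lambda = frac_part x.

(* The conditions on n, m, m_1 in the cases -1 < tau < 0: tau and theta
   rational; tau rational and theta irrational; tau irrational and theta
   rational; both irrational. *)
Definition cond_rr (tau theta lambda lambda1 : R) (n : nat) (m m1 : Z) : Prop :=
  (0 < n)%nat /\
  floor_split (- INR n * tau) lambda m /\
  INR n * theta = IZR m1 + lambda1 /\ lambda1 = frac_part (INR n * theta).

Definition cond_ri (tau theta lambda beta rho : R) (n : nat) (m m1 : Z) : Prop :=
  (0 < n)%nat /\
  approx_le (INR n * theta) beta (Rpower (INR n) (- rho)) m1 /\
  - INR n * tau = IZR m + lambda /\ m = Int_part (- INR n * tau).

Definition cond_ir (tau theta beta lambda rho : R) (n : nat) (m m1 : Z) : Prop :=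
  (0 < n)%nat /\
  approx_le (- INR n * tau) beta (Rpower (INR n) (- rho)) m /\
  INR n * theta = IZR m1 + lambda /\ lambda = frac_part (INR n * theta).

Definition cond_ii (tau theta beta1 beta2 rho : R) (n : nat) (m m1 : Z) : Prop :=
  (0 < n)%nat /\
  approx_lt (- tau * INR n) beta1 (Rpower (INR n) (- rho)) m /\
  approx_lt (INR n * theta) beta2 (Rpower (INR n) (- rho)) m1.

(* At a positive real argument Theta and B_q take real values; [Re] extracts
   the underlying real number. *)
Definition bound62 (q : R) (z : C) (rho : R) (n : nat) : R :=
  let nu := nu_log q n in
  62 * qpoch_inf (- q ^ 3) q ^ 2 * Re (Theta (sqrt q) (RtoC (Cmod z ^ 2)))
  / ((1 - q) ^ 2 * qpoch_inf q q)
  * (powerRZ (Cmod z) (2 * nu) * powerRZ q (nu * nu)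
     + Rpower q (IZR (nu * nu) / 2) / powerRZ (Cmod z) (2 * nu)
     + ln (INR n) ^ 2 / Rpower (INR n) rho).

Lemma Cexp_plus (u v : C) : Cexp (u + v) = (Cexp u * Cexp v)%C.
Proof.
destruct u as [a b], v as [c d].
unfold Cexp, Cplus, Cmult, Re, Im; cbn [fst snd].
rewrite exp_plus, cos_plus, sin_plus; f_equal; ring.
Qed.

Lemma Cexp_0 : Cexp 0 = RtoC 1.
Proof.
unfold Cexp, Re, Im, RtoC; cbn [fst snd].
rewrite exp_0, cos_0, sin_0; f_equal; ring.
Qed.

Lemma Cexp_nat (n : nat) (u : C) : Cexp (RtoC (INR n) * u) = Cpow (Cexp u) n.
Proof.
induction n as [|n IH].
- simpl INR; rewrite Cmult_0_l; apply Cexp_0.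
- rewrite S_INR, RtoC_plus, Cmult_plus_distr_r, Cmult_1_l, Cexp_plus, IH, Cpow_S.
  ring.
Qed.

Lemma qpoch_qq_pos (q : R) (n : nat) : 0 < q < 1 -> 0 < qpoch q q n.
Proof.
intros Hq; induction n as [|n IH]; simpl; [lra|].
apply Rmult_lt_0_compat; [exact IH|].
assert (H : q ^ S n < 1) by (apply pow_lt_1_compat; [lra|lia]).
simpl in H; lra.
Qed.

Definition im_coef (q : R) (n k : nat) : R :=
  qbinom q n k * powerRZ q (Z.of_nat k * (Z.of_nat k - Z.of_nat n)).

Lemma im_coef_split (q : R) (k j : nat) : 0 < q < 1 ->
  im_coef q (k + j) k
  = qpoch q q (k + j) / (qpoch q q k * qpoch q q j) / q ^ (k * j).
Proof.
intros Hq; unfold im_coef, qbinom.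
replace (k + j - k)%nat with j by lia.
replace (Z.of_nat k * (Z.of_nat k - Z.of_nat (k + j)))%Z
  with (- Z.of_nat (k * j))%Z by lia.
rewrite powerRZ_neg', <- pow_powerRZ; unfold Rdiv; ring.
Qed.

Lemma im_coef_0 (q : R) (n : nat) : 0 < q < 1 -> im_coef q n 0 = 1.
Proof.
intros Hq; change (im_coef q n 0) with (im_coef q (0 + n) 0).
rewrite (im_coef_split q 0 n Hq); simpl.
pose proof (qpoch_qq_pos q n Hq); field; lra.
Qed.

Lemma im_coef_diag (q : R) (n : nat) : 0 < q < 1 -> im_coef q n n = 1.
Proof.
intros Hq; replace (im_coef q n n) with (im_coef q (n + 0) n)
  by (f_equal; lia).
rewrite (im_coef_split q n 0 Hq), Nat.add_0_r, Nat.mul_0_r; simpl.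
pose proof (qpoch_qq_pos q n Hq); field; lra.
Qed.

Lemma im_coef_rec (q : R) (n k : nat) : 0 < q < 1 -> (k <= n)%nat ->
  im_coef q (S (S n)) (S k)
  = im_coef q (S n) (S k) + im_coef q (S n) k
    + (1 - q ^ S n) / q ^ S n * im_coef q n k.
Proof.
intros Hq Hk.
destruct (Nat.le_exists_sub k n Hk) as [j [-> _]].
replace (S (S (j + k))) with (S k + S j)%nat by lia.
replace (im_coef q (S (j + k)) (S k)) with (im_coef q (S k + j) (S k))
  by (f_equal; lia).
replace (im_coef q (S (j + k)) k) with (im_coef q (k + S j) k)
  by (f_equal; lia).
rewrite (Nat.add_comm j k), !im_coef_split by exact Hq.
replace (S k + S j)%nat with (S (S (k + j))) by lia.
replace (S k + j)%nat with (S (k + j)) by lia.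
replace (k + S j)%nat with (S (k + j)) by lia.
replace (S k * S j)%nat with (k * j + k + j + 1)%nat by lia.
replace (S k * j)%nat with (k * j + j)%nat by lia.
replace (k * S j)%nat with (k * j + k)%nat by lia.
pose proof (qpoch_qq_pos q (S k) Hq) as H1.
pose proof (qpoch_qq_pos q (S j) Hq) as H2.
pose proof (qpoch_qq_pos q k Hq) as H3.
pose proof (qpoch_qq_pos q j Hq) as H4.
cbn [qpoch] in *; rewrite !pow_add; simpl pow; rewrite !pow_add, Rmult_1_r.
assert (0 < q ^ k) by (apply pow_lt; lra).
assert (0 < q ^ j) by (apply pow_lt; lra).
assert (0 < q ^ (k * j)) by (apply pow_lt; lra).
assert (1 - q * q ^ k <> 0) by (intro E; rewrite E in H1; lra).
assert (1 - q * q ^ j <> 0) by (intro E; rewrite E in H2; lra).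
field; repeat split; lra.
Qed.

Lemma im_exponent (n k : nat) (xi : C) : (k <= n)%nat ->
  Cexp (RtoC (IZR (Z.of_nat n - 2 * Z.of_nat k)) * xi)
  = (Cpow (Cexp xi) (n - k) * Cpow (Cexp (- xi)) k)%C.
Proof.
intros Hk; rewrite <- !Cexp_nat, <- Cexp_plus; f_equal.
replace (Z.of_nat n - 2 * Z.of_nat k)%Z
  with (Z.of_nat (n - k) - Z.of_nat k)%Z by lia.
rewrite minus_IZR, <- !INR_IZR_INZ, RtoC_minus; ring.
Qed.

Local Ltac cring :=
  match goal with |- @eq _ ?a ?b => change (@eq C a b) end;
  first [ring | symmetry; ring].

Lemma ismail_masson_sum_eq (q : R) (n : nat) (xi : C) :
  ismail_masson_sum q n xi
  = sum_n (fun k => RtoC (im_coef q n k)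
      * (Cpow (Cexp xi) (n - k) * Cpow (- Cexp (- xi)) k))%C n.
Proof.
unfold ismail_masson_sum; apply sum_n_ext_loc; intros k Hk.
rewrite (im_exponent n k xi Hk); fold (im_coef q n k).
assert (Hm : RtoC (-1) = (- (1))%C) by (rewrite <- RtoC_opp; reflexivity).
replace (- Cexp (- xi))%C with (RtoC (-1) * Cexp (- xi))%C
  by (rewrite Hm; cring).
rewrite Cpow_mult_l, <- RtoC_pow, RtoC_mult; cring.
Qed.

Lemma im_sum_rec (q : R) (n : nat) (E F : C) : 0 < q < 1 -> (E * F)%C = RtoC (-1) ->
  let S_ m := sum_n (fun k => RtoC (im_coef q m k)
                * (Cpow E (m - k) * Cpow F k))%C m in
  S_ (S (S n)) = ((E + F) * S_ (S n) - RtoC ((1 - q ^ S n) / q ^ S n) * S_ n)%C.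
Proof.
intros Hq HEF S_.
set (d := (1 - q ^ S n) / q ^ S n).
pose (u := fun k => (Cpow E (S n - k) * Cpow F (S k))%C).
assert (Hm : RtoC (-1) = (- (1))%C) by (rewrite <- RtoC_opp; reflexivity).
assert (H2 : S_ (S (S n)) = (Cpow E (S (S n))
   + sum_n (fun k => RtoC (im_coef q (S (S n)) (S k)) * u k)%C n
   + Cpow F (S (S n)))%C).
{ unfold S_, sum_n; rewrite sum_n_Sm by lia; rewrite sum_Sn_m by lia.
  rewrite <- sum_n_m_S.
  rewrite im_coef_0, im_coef_diag, Nat.sub_diag, Nat.sub_0_r by exact Hq.
  unfold plus, u; simpl (AbelianMonoid.sort _); cbn -[Cpow sum_n_m im_coef Nat.sub].
  f_equal; [f_equal|]; cbn [Cpow]; try cring. }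
assert (H1E : (E * S_ (S n))%C = (Cpow E (S (S n))
   + sum_n (fun k => RtoC (im_coef q (S n) (S k)) * u k)%C n)%C).
{ unfold S_, sum_n; rewrite sum_Sn_m by lia; rewrite <- sum_n_m_S.
  rewrite im_coef_0, Nat.sub_0_r by exact Hq.
  change (@plus (AbelianGroup.AbelianMonoid C_AbelianGroup)) with Cplus.
  change (@plus C_AbelianMonoid) with Cplus.
  rewrite Cmult_plus_distr_l.
  f_equal; [cbn [Cpow]; cring|].
  rewrite <- (sum_n_m_mult_l (K := C_Ring) E).
  apply (sum_n_ext_loc (G := C_AbelianMonoid)); intros k Hk; unfold u.
  change (@mult C_Ring) with Cmult.
  replace (S n - k)%nat with (S (S n - S k)) by lia.
  cbn [Cpow]; cring. }
assert (H1F : (F * S_ (S n))%C = (Cpow F (S (S n))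
   + sum_n (fun k => RtoC (im_coef q (S n) k) * u k)%C n)%C).
{ unfold S_; rewrite sum_Sn, im_coef_diag, Nat.sub_diag by exact Hq.
  change (@plus C_AbelianMonoid) with Cplus.
  rewrite Cmult_plus_distr_l, Cplus_comm.
  f_equal; [cbn [Cpow]; cring|].
  rewrite <- (sum_n_mult_l (K := C_Ring) F).
  apply sum_n_ext_loc; intros k Hk; unfold u.
  change (@mult C_Ring) with Cmult; cbn [Cpow]; cring. }
assert (H0 : (- (RtoC d * S_ n))%C
   = sum_n (fun k => RtoC (d * im_coef q n k) * u k)%C n).
{ replace (- (RtoC d * S_ n))%C with ((RtoC d * (E * F)) * S_ n)%C
    by (rewrite HEF, Hm; cring).
  unfold S_; rewrite <- (sum_n_mult_l (K := C_Ring)).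
  apply sum_n_ext_loc; intros k Hk; unfold u.
  change (@mult C_Ring) with Cmult.
  replace (S n - k)%nat with (S (n - k)) by lia.
  rewrite RtoC_mult; cbn [Cpow]; cring. }
transitivity (E * S_ (S n) + F * S_ (S n) + - (RtoC d * S_ n))%C; [|cring].
rewrite H2, H1E, H1F, H0.
assert (HS : sum_n (fun k => RtoC (im_coef q (S (S n)) (S k)) * u k)%C n
  = (sum_n (fun k => RtoC (im_coef q (S n) (S k)) * u k)%C n
     + sum_n (fun k => RtoC (im_coef q (S n) k) * u k)%C n
     + sum_n (fun k => RtoC (d * im_coef q n k) * u k)%C n)%C).
{ change Cplus with (@plus C_AbelianMonoid).
  rewrite <- !(sum_n_plus (G := C_AbelianMonoid)).
  apply sum_n_ext_loc; intros k Hk.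
  rewrite (im_coef_rec q n k Hq Hk); fold d.
  change (@plus C_AbelianMonoid) with Cplus.
  rewrite !RtoC_plus; cring. }
rewrite HS; cring.
Qed.

Fixpoint im_rec (q : R) (n : nat) (x : C) : C * C :=
  match n with
  | O => (RtoC 1, 2 * x)%C
  | S m => let (f, g) := im_rec q m x in
      (g, 2 * x * g - RtoC ((1 - q ^ S m) / q ^ S m) * f)%C
  end.

Lemma im_rec_sum (q : R) (n : nat) (xi : C) : 0 < q < 1 ->
  im_rec q n (csinh xi)
  = (ismail_masson_sum q n xi, ismail_masson_sum q (S n) xi).
Proof.
intros Hq.
assert (HEF : (Cexp xi * - Cexp (- xi))%C = RtoC (-1)).
{ replace (Cexp xi * - Cexp (- xi))%C with (- (Cexp xi * Cexp (- xi)))%C by cring.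
  rewrite <- Cexp_plus, Cplus_opp_r, Cexp_0, <- RtoC_opp; reflexivity. }
assert (H2 : (2 * csinh xi)%C = (Cexp xi + - Cexp (- xi))%C).
{ unfold csinh; field; intro H; apply (RtoC_inj 2 0) in H; lra. }
induction n as [|n IH].
- cbn [im_rec]; rewrite !ismail_masson_sum_eq, H2, sum_Sn, !sum_O.
  change (@plus C_AbelianMonoid) with Cplus.
  rewrite !im_coef_0, im_coef_diag by exact Hq; cbn [Cpow Nat.sub].
  f_equal; cring.
- cbn [im_rec]; rewrite IH; f_equal.
  rewrite !ismail_masson_sum_eq, (im_sum_rec q n _ _ Hq HEF), H2; reflexivity.
Qed.

Definition poly_lead (n : nat) (f : C -> C) : Prop :=
  exists a : nat -> C,
    a n <> RtoC 0 /\ (forall k, (n < k)%nat -> a k = RtoC 0) /\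
    forall x : C, f x = sum_n (fun k => a k * Cpow x k)%C n.

Lemma im_rec_poly (q : R) (n : nat) :
  poly_lead n (fun x => fst (im_rec q n x)) /\
  poly_lead (S n) (fun x => snd (im_rec q n x)).
Proof.
assert (N2 : RtoC 2 <> RtoC 0) by (intro H; apply RtoC_inj in H; lra).
induction n as [|n [IHf IHg]].
- split.
  + exists (fun k => match k with O => RtoC 1 | _ => RtoC 0 end).
    split; [intro H; apply RtoC_inj in H; lra|].
    split; [intros [|k] Hk; [lia|reflexivity]|].
    intro x; rewrite sum_O; cbn [im_rec fst Cpow]; cring.
  + exists (fun k => match k with 1%nat => RtoC 2 | _ => RtoC 0 end).
    split; [exact N2|].
    split; [intros [|[|k]] Hk; try lia; reflexivity|].
    intro x; rewrite sum_Sn, sum_O; cbn [im_rec snd Cpow].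
    change (@plus C_AbelianMonoid) with Cplus; cring.
- assert (E1 : forall x, fst (im_rec q (S n) x) = snd (im_rec q n x))
    by (intro x; cbn [im_rec]; destruct (im_rec q n x); reflexivity).
  set (d := RtoC ((1 - q ^ S n) / q ^ S n)).
  assert (E2 : forall x, snd (im_rec q (S n) x)
            = (2 * x * snd (im_rec q n x) - d * fst (im_rec q n x))%C)
    by (intro x; cbn [im_rec]; destruct (im_rec q n x); reflexivity).
  split.
  + destruct IHg as [a [Ha [Ha0 Hf]]]; exists a; split; [exact Ha|].
    split; [exact Ha0|]; intro x; rewrite E1; apply Hf.
  + destruct IHf as [a [Ha [Ha0 Hf]]], IHg as [b [Hb [Hb0 Hg]]].
    exists (fun k => match k with
                     | O => - (d * a O)
                     | S j => 2 * b j - d * a (S j) end)%C.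
    split; [|split].
    * rewrite (Ha0 (S (S n))) by lia.
      replace (2 * b (S n) - d * 0)%C with (2 * b (S n))%C by cring.
      apply Cmult_neq_0; assumption.
    * intros [|k] Hk; [lia|].
      rewrite (Ha0 (S k)), (Hb0 k) by lia; cring.
    * intro x; rewrite E2, Hf, Hg.
      assert (Hext : sum_n (fun k => a k * Cpow x k)%C n
                     = sum_n (fun k => a k * Cpow x k)%C (S (S n))).
      { rewrite !sum_Sn, (Ha0 (S n)), (Ha0 (S (S n))) by lia.
        change (@plus C_AbelianMonoid) with Cplus; cring. }
      rewrite Hext.
      unfold sum_n at 2 3; rewrite !(sum_Sn_m _ 0) by lia.
      rewrite <- !sum_n_m_S.
      change (@plus (AbelianGroup.AbelianMonoid C_AbelianGroup)) with Cplus.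
      change (@plus C_AbelianMonoid) with Cplus.
      assert (Hs : sum_n_m (fun k => (2 * b k - d * a (S k)) * Cpow x (S k))%C 0 (S n)
        = (2 * x * sum_n (fun k => b k * Cpow x k) (S n)
           - d * sum_n_m (fun k => a (S k) * Cpow x (S k)) 0 (S n))%C).
      { replace (2 * x * sum_n (fun k => b k * Cpow x k) (S n)
           - d * sum_n_m (fun k => a (S k) * Cpow x (S k)) 0 (S n))%C
        with (2 * x * sum_n (fun k => b k * Cpow x k) (S n)
           + (- d) * sum_n_m (fun k => a (S k) * Cpow x (S k)) 0 (S n))%C by cring.
        unfold sum_n.
        rewrite <- !(sum_n_m_mult_l (K := C_Ring)).
        change Cplus with (@plus C_AbelianMonoid).
        rewrite <- (sum_n_m_plus (G := C_AbelianMonoid)).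
        apply (sum_n_m_ext (G := C_AbelianMonoid)); intro k.
        change (@plus C_AbelianMonoid) with Cplus.
        change (@mult C_Ring) with Cmult; cbn [Cpow]; cring. }
      cbv beta in Hs |- *; rewrite Hs; cbn [Cpow]; cring.
Qed.

Lemma ismail_masson_spec (q : R) (n : nat) : 0 < q < 1 ->
  is_ismail_masson q n (ismail_masson q n).
Proof.
intros Hq; unfold ismail_masson; apply epsilon_spec.
exists (fun x => fst (im_rec q n x)); split.
- destruct (im_rec_poly q n) as [[a [Ha [_ Hf]]] _]; exists a; split; assumption.
- intro xi; rewrite (im_rec_sum q n xi Hq); reflexivity.
Qed.

(* Main.v *)
(** With [e^(xi_n) = q^(-n s) z] the defining sum becomes
    [h_n(sinh xi_n) = z^n q^(-n^2 s) sum_k [n k]_q q^(k^2) X^k], where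
    [X = - z^(-2) q^(n tau) e^(2 pi i n theta)].  For [tau >= 0] this is compared
    termwise with [1] or with the series of [A_q].  For [-1 < tau < 0] the summand
    peaks near [k = M = floor(m / 2)], and completing the square there turns the sum
    into a truncated theta series in [W = q^(-2 M) / X], with coefficients
    [(q;q)_oo [n M-j]_q] close to [1] for small [j].  In every case the terms with
    index at most [nu] are estimated by [1 - (q;q)_n / (q;q)_b <= q^(b+1) / (1 - q)]
    and by [|e^u - 1| = O(|u|)] for the Diophantine error, while the Gaussian factor
    makes the remaining terms negligible. *)

Require Import Defs.
From Stdlib Require Import Reals ZArith List Lia Lra QArith Qreals Classical.
From Coquelicot Require Import Coquelicot.
Open Scope R_scope.

(** * q-shifted factorials *)

(** The remainder for theta must be a multiple of [Theta (sqrt q)] at [|z|^2], although the actual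
    argument has modulus [|z|^2 q^c] with [c] up to 2. Half of the Gaussian exponent pays for this:
    [j^2 + c j >= j^2 / 2 - 2], at the price of a factor [q^(-2)]. The factor [q^4] in [nu_log]
    repays it. The denominator [1 + log (1/q)] there covers both perturbations at once: [a log q] in
    the modulus and [2 pi b] in the phase. A cut-off of order [log^2 n] makes [q^nu] smaller than
    [n^(-rho)] for every [rho], while [nu n^(-rho)] still tends to 0 and [nu] stays below any fixed
    fraction of [n].

    A relative error [10 k] for powers up to [nu] arises as [2 k] from the modulus plus [8 k] from
    the phase, since [2 pi <= 8]. With the coefficient error added, the totals on the logarithmic
    term are 11 for [A_q] and 12 for theta, below the stated 48 and 62. The thresholds obtained do
    not depend on the shifts [beta], [lambda] or on the integers [m], [m1]. *)

Lemma qpoch_qq_S (q : R) (n : nat) :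
  qpoch q q (S n) = qpoch q q n * (1 - q ^ S n).
Proof. reflexivity. Qed.

Lemma pow_q_le1 (q : R) (n : nat) : 0 < q < 1 -> 0 < q ^ n <= 1.
Proof.
intros Hq; split; [apply pow_lt; lra|].
rewrite <- (pow1 n); apply pow_incr; lra.
Qed.

Lemma pow_q_antitone (q : R) (m n : nat) :
  0 < q < 1 -> (m <= n)%nat -> q ^ n <= q ^ m.
Proof.
intros Hq H; replace n with (m + (n - m))%nat by lia; rewrite pow_add.
pose proof (pow_q_le1 q m Hq); pose proof (pow_q_le1 q (n - m) Hq); nra.
Qed.

Lemma qpoch_qq_antitone (q : R) (b n : nat) :
  0 < q < 1 -> (b <= n)%nat -> qpoch q q n <= qpoch q q b.
Proof.
intros Hq H; induction H as [|n H IH]; [lra|].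
rewrite qpoch_qq_S; pose proof (qpoch_qq_pos q n Hq).
pose proof (pow_q_le1 q (S n) Hq); nra.
Qed.

Lemma qpoch_qq_le1 (q : R) (n : nat) : 0 < q < 1 -> qpoch q q n <= 1.
Proof. intros Hq; apply (qpoch_qq_antitone q 0 n Hq); lia. Qed.

(** The product of the factors [1 - q^i] over [b < i <= n] is at least one minus the sum of the
    [q^i], a geometric sum below [q^(b+1) / (1 - q)]. Every coefficient error below comes from this
    estimate. *)
Lemma qpoch_qq_lower (q : R) (b n : nat) : 0 < q < 1 -> (b <= n)%nat ->
  qpoch q q b * (1 - q ^ S b / (1 - q)) <= qpoch q q n.
Proof.
intros Hq H.
(* The induction carries the exact partial geometric sum; the bound by the full tail would not
   reproduce itself. *)
assert (Hs : qpoch q q b * (1 - (q ^ S b - q ^ S n) / (1 - q)) <= qpoch q q n).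
{ induction H as [|n H IH].
  - unfold Rminus at 2; rewrite Rplus_opp_r; unfold Rdiv; lra.
  - rewrite qpoch_qq_S.
    pose proof (qpoch_qq_antitone q b n Hq H).
    pose proof (pow_q_le1 q (S n) Hq).
    replace ((q ^ S b - q ^ S (S n)) / (1 - q))
      with ((q ^ S b - q ^ S n) / (1 - q) + q ^ S n) by (simpl; field; lra).
    nra. }
eapply Rle_trans; [|exact Hs].
apply Rmult_le_compat_l; [left; apply qpoch_qq_pos; exact Hq|].
pose proof (pow_q_le1 q (S n) Hq).
unfold Rdiv; assert (0 < / (1 - q)) by (apply Rinv_0_lt_compat; lra); nra.
Qed.

(* [1 / (1 - x) = 1 + x / (1 - x) <= exp (x / (1 - x))] *)
Lemma qpoch_qq_exp_lower (q : R) (n : nat) : 0 < q < 1 ->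
  exp (- / (1 - q) ^ 2) <= qpoch q q n.
Proof.
intros Hq.
assert (Hi : 0 < / (1 - q)) by (apply Rinv_0_lt_compat; lra).
assert (Hs : exp (- ((1 - q ^ n) * / (1 - q) * / (1 - q))) <= qpoch q q n).
{ induction n as [|n IH].
  - simpl; rewrite Rminus_diag, !Rmult_0_l, Ropp_0, exp_0; lra.
  - rewrite qpoch_qq_S.
    replace (- ((1 - q ^ S n) * / (1 - q) * / (1 - q)))
      with (- ((1 - q ^ n) * / (1 - q) * / (1 - q)) + - (q ^ n * / (1 - q)))
      by (simpl; field; lra).
    rewrite exp_plus; apply Rmult_le_compat; try (left; apply exp_pos).
    + exact IH.
    + rewrite exp_Ropp.
      set (x := q ^ S n).
      assert (Hx : 0 < x <= q).
      { split; [apply pow_lt; lra|].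
        unfold x; simpl; pose proof (pow_q_le1 q n Hq); nra. }
      replace (1 - x) with (/ / (1 - x)) by (field; lra).
      apply Rinv_le_contravar; [apply Rinv_0_lt_compat; lra|].
      eapply Rle_trans; [|apply exp_ineq1_le].
      replace (/ (1 - x)) with (1 + x * / (1 - x)) by (field; lra).
      apply Rplus_le_compat_l.
      pose proof (pow_q_le1 q n Hq).
      apply Rmult_le_compat; try lra.
      * left; apply Rinv_0_lt_compat; lra.
      * unfold x; simpl; nra.
      * apply Rinv_le_contravar; lra. }
eapply Rle_trans; [|exact Hs].
assert (Hm : forall x y, x <= y -> exp x <= exp y).
{ intros x y [H|H]; [left; apply exp_increasing; exact H|subst; lra]. }
apply Hm, Ropp_le_contravar.
replace (/ (1 - q) ^ 2) with (1 * (/ (1 - q) * / (1 - q))) by (field; lra).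
rewrite Rmult_assoc; apply Rmult_le_compat_r; [nra|].
pose proof (pow_q_le1 q n Hq); lra.
Qed.

Lemma qpoch_inf_qq_lim (q : R) : 0 < q < 1 ->
  is_lim_seq (qpoch q q) (qpoch_inf q q).
Proof.
intros Hq; apply Lim_seq_correct'.
apply (ex_finite_lim_seq_decr _ 0).
- intro n; apply qpoch_qq_antitone; [exact Hq|lia].
- intro n; left; apply qpoch_qq_pos; exact Hq.
Qed.

(** A decreasing positive sequence may tend to 0; the exponential lower bound, uniform in [n],
    excludes it. *)
Lemma qpoch_inf_qq_pos (q : R) : 0 < q < 1 -> 0 < qpoch_inf q q.
Proof.
intros Hq; apply Rlt_le_trans with (exp (- / (1 - q) ^ 2)); [apply exp_pos|].
apply (is_lim_seq_le (fun _ => exp (- / (1 - q) ^ 2)) (qpoch q q)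
  (exp (- / (1 - q) ^ 2)) (qpoch_inf q q)).
- intro n; apply qpoch_qq_exp_lower; exact Hq.
- apply is_lim_seq_const.
- apply qpoch_inf_qq_lim; exact Hq.
Qed.

Lemma qpoch_inf_qq_le (q : R) (n : nat) : 0 < q < 1 ->
  qpoch_inf q q <= qpoch q q n.
Proof.
intros Hq.
apply (is_lim_seq_le (fun k => qpoch q q (k + n)) (fun _ => qpoch q q n)
  (qpoch_inf q q) (qpoch q q n)).
- intro k; apply qpoch_qq_antitone; [exact Hq|lia].
- apply is_lim_seq_incr_n, qpoch_inf_qq_lim; exact Hq.
- apply is_lim_seq_const.
Qed.

Lemma qpoch_inf_qq_lower (q : R) (b : nat) : 0 < q < 1 ->
  qpoch q q b * (1 - q ^ S b / (1 - q)) <= qpoch_inf q q.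
Proof.
intros Hq.
apply (is_lim_seq_le (fun _ => qpoch q q b * (1 - q ^ S b / (1 - q)))
  (fun k => qpoch q q (k + b))
  (qpoch q q b * (1 - q ^ S b / (1 - q))) (qpoch_inf q q)).
- intro k; apply qpoch_qq_lower; [exact Hq|lia].
- apply is_lim_seq_const.
- apply is_lim_seq_incr_n, qpoch_inf_qq_lim; exact Hq.
Qed.

(** The partial products increase from 1, but [qpoch_inf] takes the real part of an extended limit,
    which would be 0 at infinity. Hence the upper bound [exp (1 / (1 - q))], from [1 + x <= exp x],
    is proved as well to make the limit finite. *)
Lemma qpoch_neg_ge1 (q : R) : 0 < q < 1 -> 1 <= qpoch_inf (- q ^ 3) q.
Proof.
intros Hq.
assert (Hp : forall n, 1 <= qpoch (- q ^ 3) q n).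
{ induction n as [|n IH]; cbn [qpoch]; [lra|].
  assert (0 < q ^ 3 * q ^ n) by (apply Rmult_lt_0_compat; apply pow_lt; lra); nra. }
assert (Hi : forall n, qpoch (- q ^ 3) q n <= qpoch (- q ^ 3) q (S n)).
{ intro n; cbn [qpoch]; specialize (Hp n).
  assert (0 < q ^ 3 * q ^ n) by (apply Rmult_lt_0_compat; apply pow_lt; lra); nra. }
assert (Hb : forall n, qpoch (- q ^ 3) q n <= exp ((1 - q ^ n) * / (1 - q))).
{ induction n as [|n IH]; cbn [qpoch].
  - simpl; rewrite Rminus_diag, Rmult_0_l, exp_0; lra.
  - replace ((1 - q ^ S n) * / (1 - q)) with ((1 - q ^ n) * / (1 - q) + q ^ n)
      by (simpl; field; lra).
    rewrite exp_plus.
    pose proof (pow_q_le1 q n Hq); pose proof (pow_q_le1 q 3 Hq).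
    specialize (Hp n).
    apply Rmult_le_compat; [lra|nra|exact IH|].
    eapply Rle_trans; [|apply exp_ineq1_le]; nra. }
assert (Hl : is_lim_seq (qpoch (- q ^ 3) q) (qpoch_inf (- q ^ 3) q)).
{ apply Lim_seq_correct', (ex_finite_lim_seq_incr _ (exp (/ (1 - q))) Hi).
  intro n; eapply Rle_trans; [apply Hb|].
  assert (0 < / (1 - q)) by (apply Rinv_0_lt_compat; lra).
  pose proof (pow_q_le1 q n Hq).
  destruct (Rle_lt_or_eq_dec ((1 - q ^ n) * / (1 - q)) (/ (1 - q))) as [H1|H1];
    [nra|left; apply exp_increasing; exact H1|rewrite H1; lra]. }
apply (is_lim_seq_le (fun _ => 1) (qpoch (- q ^ 3) q) 1 (qpoch_inf (- q ^ 3) q)).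
- exact Hp.
- apply is_lim_seq_const.
- exact Hl.
Qed.

(** * Bounds for q-binomial coefficients and Gaussian series *)

Lemma qbinom_le (q : R) (n k : nat) : 0 < q < 1 -> (k <= n)%nat ->
  0 < qbinom q n k <= / qpoch q q k.
Proof.
intros Hq Hk; unfold qbinom.
pose proof (qpoch_qq_pos q n Hq); pose proof (qpoch_qq_pos q k Hq).
pose proof (qpoch_qq_pos q (n - k) Hq).
pose proof (qpoch_qq_antitone q (n - k) n Hq ltac:(lia)).
split; [apply Rdiv_lt_0_compat; [lra|apply Rmult_lt_0_compat; lra]|].
apply Rmult_le_reg_r with (qpoch q q k * qpoch q q (n - k));
  [apply Rmult_lt_0_compat; lra|].
field_simplify; lra.
Qed.

Lemma qbinom_ge (q : R) (n k : nat) : 0 < q < 1 -> (k <= n)%nat ->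
  / qpoch q q k * (1 - q ^ S (n - k) / (1 - q)) <= qbinom q n k.
Proof.
intros Hq Hk; unfold qbinom.
pose proof (qpoch_qq_pos q n Hq); pose proof (qpoch_qq_pos q k Hq).
pose proof (qpoch_qq_pos q (n - k) Hq).
pose proof (qpoch_qq_lower q (n - k) n Hq ltac:(lia)) as Hl.
unfold Rdiv at 2; rewrite Rinv_mult.
replace (qpoch q q n * (/ qpoch q q k * / qpoch q q (n - k)))
  with (/ qpoch q q k * (qpoch q q n / qpoch q q (n - k))) by (field; lra).
apply Rmult_le_compat_l; [left; apply Rinv_0_lt_compat; lra|].
apply Rmult_le_reg_l with (qpoch q q (n - k)); [lra|].
eapply Rle_trans; [exact Hl|].
right; field; lra.
Qed.

(** The scaled coefficient is [u v] with [u = (q;q)_oo / (q;q)_k] and [v = (q;q)_n / (q;q)_(n-k)],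
    both in [(0, 1]]. Then [1 - u v <= (1 - u) + (1 - v)], and each defect is a tail of the
    q-factorial. *)
Lemma qbinom_scaled_bounds (q : R) (n k : nat) : 0 < q < 1 -> (k <= n)%nat ->
  0 <= qpoch_inf q q * qbinom q n k <= 1 /\
  1 - qpoch_inf q q * qbinom q n k <= (q ^ S k + q ^ S (n - k)) / (1 - q).
Proof.
intros Hq Hk.
pose proof (qpoch_inf_qq_pos q Hq) as Hi.
pose proof (qpoch_qq_pos q k Hq) as Hpk.
pose proof (qpoch_inf_qq_le q k Hq) as Hle.
pose proof (qbinom_le q n k Hq Hk) as Hb.
pose proof (qpoch_inf_qq_lower q k Hq) as Hlow.
assert (Hr : 0 < qpoch_inf q q * / qpoch q q k <= 1).
{ split; [apply Rdiv_lt_0_compat; lra|].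
  apply Rmult_le_reg_r with (qpoch q q k); [lra|field_simplify; lra]. }
split; [split; nra|].
assert (Hbn : qbinom q n k = / qpoch q q k * (qpoch q q n / qpoch q q (n - k))).
{ unfold qbinom; pose proof (qpoch_qq_pos q (n - k) Hq); field; lra. }
pose proof (qpoch_qq_pos q (n - k) Hq) as Hnk.
pose proof (qpoch_qq_pos q n Hq) as Hn.
pose proof (qpoch_qq_antitone q (n - k) n Hq ltac:(lia)).
set (u := qpoch_inf q q * / qpoch q q k) in *.
set (v := qpoch q q n / qpoch q q (n - k)).
assert (Hv : 0 < v <= 1).
{ split; [apply Rdiv_lt_0_compat; lra|].
  apply Rmult_le_reg_r with (qpoch q q (n - k)); [lra|unfold v; field_simplify; lra]. }
assert (Hu1 : 1 - q ^ S k / (1 - q) <= u).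
{ apply Rmult_le_reg_l with (qpoch q q k); [lra|].
  eapply Rle_trans; [exact Hlow|unfold u; right; field; lra]. }
assert (Hv1 : 1 - q ^ S (n - k) / (1 - q) <= v).
{ apply Rmult_le_reg_l with (qpoch q q (n - k)); [lra|].
  eapply Rle_trans; [apply (qpoch_qq_lower q (n - k) n Hq); lia|unfold v; right; field; lra]. }
replace (qpoch_inf q q * qbinom q n k) with (u * v)
  by (unfold u, v; rewrite Hbn; unfold u, v; ring).
unfold Rdiv in *; rewrite Rmult_plus_distr_r; nra.
Qed.

(** The ratio of consecutive terms is [q r q^(2 k)], which tends to 0 whatever the size of [r]. *)
Lemma ex_series_gauss (q r : R) : 0 < q < 1 -> 0 < r ->
  ex_series (fun k => q ^ (k * k) * r ^ k).
Proof.
intros Hq Hr.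
assert (Hp : forall k, 0 < q ^ (k * k) * r ^ k)
  by (intro k; apply Rmult_lt_0_compat; apply pow_lt; lra).
apply (ex_series_ext (fun k => Rabs (q ^ (k * k) * r ^ k))).
{ intro k; apply Rabs_pos_eq; left; apply Hp. }
apply ex_series_DAlembert with 0; [lra| |].
- intro k; specialize (Hp k); lra.
- apply is_lim_seq_ext with (fun k => (q * r) * (q * q) ^ k).
  + intro k.
    assert (Ha : q ^ k <> 0) by (apply pow_nonzero; lra).
    assert (Hb : r ^ k <> 0) by (apply pow_nonzero; lra).
    assert (Hc : q ^ (k * k) <> 0) by (apply pow_nonzero; lra).
    assert (E : q ^ (S k * S k) * r ^ S k / (q ^ (k * k) * r ^ k)
                = q * r * (q * q) ^ k).
    { replace (S k * S k)%nat with (k * k + k + k + 1)%nat by lia.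
      rewrite !pow_add, Rpow_mult_distr; simpl; field; split; assumption. }
    rewrite E, Rabs_pos_eq; [reflexivity|].
    apply Rmult_le_pos; [nra|apply pow_le; nra].
  + replace (Finite 0) with (Rbar_mult (q * r) 0)
      by (simpl; f_equal; ring).
    apply is_lim_seq_scal_l, is_lim_seq_geom.
    rewrite Rabs_pos_eq; nra.
Qed.

Lemma ln_q_neg (q : R) : 0 < q < 1 -> ln q < 0.
Proof. intro Hq; rewrite <- ln_1; apply ln_increasing; lra. Qed.

(** * Complex exponentials and series *)

Lemma C_eq (u v : C) : Re u = Re v -> Im u = Im v -> u = v.
Proof. destruct u, v; simpl; intros -> ->; reflexivity. Qed.

Lemma Cmod_Cexp (u : C) : Cmod (Cexp u) = exp (Re u).
Proof.
unfold Cmod, Cexp; cbn [fst snd].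
replace ((exp (Re u) * cos (Im u)) ^ 2 + (exp (Re u) * sin (Im u)) ^ 2)
  with (exp (Re u) ^ 2).
- apply sqrt_pow2; left; apply exp_pos.
- pose proof (sin2_cos2 (Im u)) as H; unfold Rsqr in H.
  replace (exp (Re u) ^ 2)
    with (exp (Re u) ^ 2 * (sin (Im u) * sin (Im u) + cos (Im u) * cos (Im u)))
    by (rewrite H; ring).
  ring.
Qed.

Lemma Cexp_neq_0 (u : C) : Cexp u <> 0.
Proof. apply Cmod_gt_0; rewrite Cmod_Cexp; apply exp_pos. Qed.

Lemma Cexp_opp (u : C) : Cexp (- u) = (/ Cexp u)%C.
Proof.
assert (H : (Cexp u * Cexp (- u))%C = RtoC 1)
  by (rewrite <- Cexp_plus, Cplus_opp_r; apply Cexp_0).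
pose proof (Cexp_neq_0 u) as Hn.
replace (Cexp (- u)) with (/ Cexp u * (Cexp u * Cexp (- u)))%C
  by (field; exact Hn).
rewrite H; ring.
Qed.

Lemma Cexp_RtoC (x : R) : Cexp (RtoC x) = RtoC (exp x).
Proof.
unfold Cexp, RtoC; cbn [Re Im fst snd]; rewrite cos_0, sin_0; f_equal; ring.
Qed.

Lemma qpow_RtoC (q x : R) : qpow q (RtoC x) = RtoC (Rpower q x).
Proof. unfold qpow, Rpower; rewrite <- RtoC_mult; apply Cexp_RtoC. Qed.

Lemma qpow_plus (q : R) (u v : C) : qpow q (u + v) = (qpow q u * qpow q v)%C.
Proof. unfold qpow; rewrite Cmult_plus_distr_r; apply Cexp_plus. Qed.

Lemma Cexp_period (t : R) (k : Z) :
  Cexp (RtoC (2 * PI * (IZR k + t)) * Ci) = Cexp (RtoC (2 * PI * t) * Ci).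
Proof.
assert (H1 : forall j x, cos (x + 2 * PI * IZR (Z.of_nat j)) = cos x /\
                        sin (x + 2 * PI * IZR (Z.of_nat j)) = sin x).
{ intros j x; rewrite <- INR_IZR_INZ.
  replace (x + 2 * PI * INR j) with (x + 2 * INR j * PI) by ring.
  split; [apply cos_period|apply sin_period]. }
assert (H2 : forall x, cos (x + 2 * PI * IZR k) = cos x /\
                      sin (x + 2 * PI * IZR k) = sin x).
{ intro x; destruct (Z_le_gt_dec 0 k) as [Hk|Hk].
  - rewrite <- (Z2Nat.id k Hk); apply H1.
  - destruct (H1 (Z.to_nat (- k)) (x + 2 * PI * IZR k)) as [Hc Hs].
    rewrite Z2Nat.id, opp_IZR in Hc, Hs by lia.
    replace (x + 2 * PI * IZR k + 2 * PI * - IZR k) with x in Hc, Hs by ring.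
    split; symmetry; assumption. }
assert (E : forall y, Cexp (RtoC y * Ci) = (cos y, sin y)).
{ intro y; unfold Cexp; simpl.
  replace (y * 0 - 0 * 1) with 0 by ring; replace (y * 1 + 0 * 0) with y by ring.
  rewrite exp_0; f_equal; ring. }
rewrite !E; replace (2 * PI * (IZR k + t)) with (2 * PI * t + 2 * PI * IZR k) by ring.
destruct (H2 (2 * PI * t)) as [-> ->]; reflexivity.
Qed.

(** The defining identity of [h_n] is available only at points [csinh xi]; this supplies a [xi] with
    [e^xi = q^(-n s) z]. The argument of [w] is [acos] of the normalised real part, with the sign of
    the imaginary part. *)
Lemma Cexp_surj (w : C) : w <> 0 -> exists u : C, Cexp u = w.
Proof.
intro Hw; apply Cmod_gt_0 in Hw.
assert (Hs : (Re w / Cmod w) ^ 2 + (Im w / Cmod w) ^ 2 = 1).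
{ transitivity ((Re w ^ 2 + Im w ^ 2) / Cmod w ^ 2); [field; lra|].
  rewrite <- Cmod2_alt; field; lra. }
set (x := Re w / Cmod w) in *; set (y := Im w / Cmod w) in *.
assert (Hx : -1 <= x <= 1) by nra.
assert (Ht : exists t, cos t = x /\ sin t = y).
{ assert (Ha : sin (acos x) = Rabs y).
  { rewrite sin_acos by exact Hx.
    replace (1 - Rsqr x) with (Rsqr y) by (unfold Rsqr; lra).
    apply sqrt_Rsqr_abs. }
  destruct (Rle_dec 0 y) as [Hy|Hy].
  - exists (acos x); rewrite cos_acos, Ha by exact Hx.
    rewrite Rabs_pos_eq by exact Hy; split; reflexivity.
  - exists (- acos x); rewrite cos_neg, sin_neg, cos_acos, Ha by exact Hx.
    rewrite Rabs_left by lra; split; ring. }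
destruct Ht as [t [Hc Hsn]].
exists (ln (Cmod w), t); unfold Cexp; cbn [Re Im fst snd].
rewrite exp_ln, Hc, Hsn by exact Hw.
apply C_eq; cbn [Re Im fst snd]; unfold x, y, Re, Im; field; lra.
Qed.

(** From below [1 + x <= exp x]; from above [exp x <= 1 / (1 - x)], where [1 - x >= 1/2]. *)
Lemma Rabs_exp_sub1 (x : R) : Rabs x <= / 2 -> Rabs (exp x - 1) <= 2 * Rabs x.
Proof.
intro Hx; pose proof (exp_ineq1_le x) as H1; pose proof (exp_ineq1_le (- x)) as H2.
rewrite exp_Ropp in H2; pose proof (exp_pos x) as H3.
assert (H4 : exp x * / exp x = 1) by (apply Rinv_r; lra).
assert (H5 : 0 < / exp x) by (apply Rinv_0_lt_compat; exact H3).
unfold Rabs in *; destruct (Rcase_abs x); destruct (Rcase_abs (exp x - 1)); nra.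
Qed.

(** With [u = x + i y], split [e^u - 1 = (e^x - 1) e^(i y) + (e^(i y) - 1)]; the last term has
    modulus [2 |sin (y/2)| <= |y|], which is checked on squares. *)
Lemma Cmod_Cexp_sub1 (u : C) :
  Cmod (Cexp u - 1) <= Rabs (exp (Re u) - 1) + Rabs (Im u).
Proof.
destruct u as [x y]; cbn [Re Im fst snd].
replace (Cexp (x, y) - 1)%C
  with (RtoC (exp x - 1) * Cexp (0, y) + (Cexp (0, y) - 1))%C.
2:{ unfold Cexp; apply C_eq; simpl; rewrite exp_0; ring. }
eapply Rle_trans; [apply Cmod_triangle|]; apply Rplus_le_compat.
- rewrite Cmod_mult, Cmod_R, Cmod_Cexp; simpl; rewrite exp_0; lra.
- rewrite <- (Rabs_pos_eq (Cmod _)) by apply Cmod_ge_0.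
  apply Rsqr_le_abs_0; rewrite !Rsqr_pow2, Cmod2_alt.
  unfold Cexp; simpl; rewrite exp_0.
  assert (Hc : cos y = 1 - 2 * sin (y / 2) * sin (y / 2)).
  { rewrite <- cos_2a_sin; f_equal; field. }
  assert (Hs : sin (y / 2) * sin (y / 2) <= (y / 2) * (y / 2)).
  { assert (Hp : forall t, 0 <= t -> sin t <= t).
    { intros t [Ht|<-]; [left; apply sin_lt_x; exact Ht|rewrite sin_0; lra]. }
    assert (Hm : forall t, 0 <= t -> - t <= sin t).
    { intros t Ht; destruct (Rle_dec t 1) as [H1|H1].
      - assert (0 <= sin t) by (apply sin_ge_0; pose proof PI2_1; lra); lra.
      - pose proof (SIN_bound t); lra. }
    destruct (Rle_dec 0 (y / 2)) as [H|H].
    - specialize (Hp _ H); specialize (Hm _ H); nra.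
    - assert (H' : 0 <= - (y / 2)) by lra.
      specialize (Hp _ H'); specialize (Hm _ H'); rewrite sin_neg in Hp, Hm; nra. }
  pose proof (sin2_cos2 y) as H; unfold Rsqr in H.
  replace ((1 * cos y + - (1)) * ((1 * cos y + - (1)) * 1)
     + (1 * sin y + - 0) * ((1 * sin y + - 0) * 1))
    with (2 - 2 * cos y) by nra.
  rewrite Hc; nra.
Qed.

Lemma ex_series_mult_l (c : R) (b : nat -> R) :
  ex_series b -> ex_series (fun k => c * b k).
Proof. apply (ex_series_scal_l (K := R_AbsRing) (V := R_NormedModule)). Qed.

Definition ex_CSeries (a : nat -> C) : Prop :=
  ex_series (fun k => Re (a k)) /\ ex_series (fun k => Im (a k)).

Lemma im_le_Cmod (c : C) : Rabs (Im c) <= Cmod c.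
Proof. eapply Rle_trans; [apply Rmax_r|apply Rmax_Cmod]. Qed.

Lemma ex_CSeries_le (a : nat -> C) (b : nat -> R) :
  (forall k, Cmod (a k) <= b k) -> ex_series b -> ex_CSeries a.
Proof.
intros H Hb; split;
  apply (ex_series_le (K := R_AbsRing) (V := R_CompleteNormedModule) _ b);
  try exact Hb; intro k; (eapply Rle_trans; [|apply (H k)]).
- apply re_le_Cmod.
- apply im_le_Cmod.
Qed.

Lemma CSeries_ext (a b : nat -> C) : (forall k, a k = b k) -> CSeries a = CSeries b.
Proof. intro H; unfold CSeries; f_equal; apply Series_ext; intro k; rewrite H; reflexivity. Qed.

Lemma CSeries_minus (a b : nat -> C) : ex_CSeries a -> ex_CSeries b ->
  CSeries (fun k => (a k - b k)%C) = (CSeries a - CSeries b)%C.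
Proof.
intros [H1 H2] [H3 H4]; unfold CSeries; apply C_eq; simpl.
- exact (Series_minus _ _ H1 H3).
- exact (Series_minus _ _ H2 H4).
Qed.

Lemma Series_nonneg (b : nat -> R) :
  (forall k, 0 <= b k) -> ex_series b -> 0 <= Series b.
Proof.
intros H Hb; apply Rle_trans with (Series (fun k => 0 * b k)); [rewrite Series_scal_l; lra|].
apply Series_le; [|exact Hb]; intro k; specialize (H k); lra.
Qed.

(* With [S = CSeries a], [|S|^2 = Re (conj S * S)] is the sum of the real series
   [Re (conj S * a k)], whose terms are at most [|S| * b k]. *)
Lemma Cmod_CSeries_le (a : nat -> C) (b : nat -> R) :
  (forall k, Cmod (a k) <= b k) -> ex_series b -> Cmod (CSeries a) <= Series b.
Proof.
intros H Hb; destruct (ex_CSeries_le a b H Hb) as [Hr Hi].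
set (S := CSeries a).
assert (H0 : forall k, 0 <= b k)
  by (intro k; eapply Rle_trans; [apply Cmod_ge_0|apply H]).
assert (Hs : Cmod S ^ 2 <= Cmod S * Series b).
{ assert (E : Cmod S ^ 2 = Series (fun k => Re S * Re (a k) + Im S * Im (a k))).
  { rewrite Series_plus by (apply ex_series_mult_l; assumption).
    rewrite !Series_scal_l, Cmod2_alt; unfold S, CSeries; simpl; ring. }
  rewrite E, <- Series_scal_l.
  set (f := fun k => Re S * Re (a k) + Im S * Im (a k)).
  assert (Hf : forall k, Rabs (f k) <= Cmod S * b k).
  { intro k; apply Rle_trans with (Cmod S * Cmod (a k));
      [|apply Rmult_le_compat_l; [apply Cmod_ge_0|apply H]].
    rewrite <- (Cmod_conj S), <- Cmod_mult.
    replace (f k) with (Re (Cconj S * a k)%C) by (unfold f; destruct S, (a k); simpl; ring).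
    apply re_le_Cmod. }
  assert (Hsb : ex_series (fun k => Cmod S * b k)) by (apply ex_series_mult_l; exact Hb).
  assert (Ha : ex_series (fun k => Rabs (f k))).
  { apply (ex_series_le (K := R_AbsRing) (V := R_CompleteNormedModule)
      _ (fun k => Cmod S * b k)); [|exact Hsb].
    intro k; change (Rabs (Rabs (f k)) <= Cmod S * b k); rewrite Rabs_Rabsolu; apply Hf. }
  apply Rle_trans with (Series (fun k => Rabs (f k))).
  - eapply Rle_trans; [apply Rle_abs|apply Series_Rabs, Ha].
  - apply Series_le; [intro k; split; [apply Rabs_pos|apply Hf]|exact Hsb]. }
pose proof (Series_nonneg b H0 Hb).
pose proof (Cmod_ge_0 S); nra.
Qed.

Lemma Series_shift_le (b : nat -> R) :
  (forall k, 0 <= b k) -> ex_series b -> Series (fun k => b (S k)) <= Series b.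
Proof. intros H Hb; rewrite (Series_incr_1 b Hb); specialize (H O); lra. Qed.

(** The common shape of the estimates for [A_q] and theta: a small relative error [E1] before the
    cut-off, a small absolute factor [E2] after it. The tail is compared with a series restarted at
    index 0, so the auxiliary [d] is [E2 * c] delayed by [N] places, and [E1 * b + d] is one
    majorant for all indices. *)
Lemma CSeries_split_bound (a : nat -> C) (b c : nat -> R) (N : nat) (E1 E2 : R) :
  0 <= E1 -> 0 <= E2 -> (forall k, 0 <= b k) -> (forall k, 0 <= c k) ->
  ex_series b -> ex_series c ->
  (forall k, (k < N)%nat -> Cmod (a k) <= E1 * b k) ->
  (forall k, Cmod (a (N + k)%nat) <= E2 * c k) ->
  ex_CSeries a /\ Cmod (CSeries a) <= E1 * Series b + E2 * Series c.
Proof.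
intros HE1 HE2 Hb0 Hc0 Hb Hc H1 H2.
set (d := fun k => if (k <? N)%nat then 0 else E2 * c (k - N)%nat).
assert (Hd : ex_series d /\ Series d = E2 * Series c).
{ assert (Hs : forall k, d (N + k)%nat = E2 * c k).
  { intro k; unfold d; destruct (Nat.ltb_spec (N + k) N); [lia|].
    do 2 f_equal; lia. }
  split.
  - apply (ex_series_incr_n d N), ex_series_ext with (fun k => E2 * c k).
    + intro k; rewrite Hs; reflexivity.
    + apply ex_series_mult_l; exact Hc.
  - rewrite (Series_incr_n_aux d N), (Series_ext _ _ Hs), Series_scal_l; [reflexivity|].
    intros k Hk; unfold d; destruct (Nat.ltb_spec k N); [reflexivity|lia]. }
destruct Hd as [Hd1 Hd2].
assert (Hm : forall k, Cmod (a k) <= E1 * b k + d k).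
{ intro k; unfold d; destruct (Nat.ltb_spec k N) as [Hk|Hk].
  - specialize (H1 k Hk); lra.
  - specialize (H2 (k - N)%nat); replace (N + (k - N))%nat with k in H2 by lia.
    specialize (Hb0 k); nra. }
assert (Hex : ex_series (fun k => E1 * b k + d k)).
{ apply (ex_series_plus (V := R_NormedModule)); [|exact Hd1].
  apply ex_series_mult_l; exact Hb. }
split; [apply (ex_CSeries_le _ _ Hm Hex)|].
rewrite <- Hd2, <- Series_scal_l, <- Series_plus by
  first [exact Hd1|apply ex_series_mult_l; exact Hb].
apply Cmod_CSeries_le; assumption.
Qed.

Lemma Series_finite (f : nat -> R) (n : nat) :
  is_series (fun k => if (k <=? n)%nat then f k else 0) (sum_n f n).
Proof.
set (g := fun k => if (k <=? n)%nat then f k else 0).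
change (is_lim_seq (sum_n g) (sum_n f n)).
apply (is_lim_seq_ext_loc (fun _ => sum_n f n)); [|apply is_lim_seq_const].
exists n; intros m Hm; induction Hm as [|m Hm IH].
- apply sum_n_ext_loc; intros k Hk; unfold g.
  destruct (Nat.leb_spec k n); [reflexivity|lia].
- rewrite sum_Sn, <- IH; unfold g; destruct (Nat.leb_spec (S m) n); [lia|].
  symmetry; apply Rplus_0_r.
Qed.

Lemma Re_sum_n (f : nat -> C) (n : nat) :
  Re (sum_n f n) = sum_n (fun k => Re (f k)) n.
Proof. induction n as [|n IH]; [rewrite !sum_O; reflexivity|rewrite !sum_Sn, <- IH; reflexivity]. Qed.

Lemma Im_sum_n (f : nat -> C) (n : nat) :
  Im (sum_n f n) = sum_n (fun k => Im (f k)) n.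
Proof. induction n as [|n IH]; [rewrite !sum_O; reflexivity|rewrite !sum_Sn, <- IH; reflexivity]. Qed.

(** Rewriting the finite sum for [h_n] as a series padded with zeros allows termwise subtraction of
    the infinite limit series. *)
Lemma CSeries_finite (f : nat -> C) (n : nat) :
  CSeries (fun k => if (k <=? n)%nat then f k else RtoC 0) = sum_n f n.
Proof.
apply C_eq.
- rewrite Re_sum_n.
  apply (is_series_unique (fun k => Re (if (k <=? n)%nat then f k else RtoC 0))).
  eapply is_series_ext; [|apply (Series_finite (fun k => Re (f k)) n)].
  intro k; simpl; destruct (k <=? n)%nat; reflexivity.
- rewrite Im_sum_n.
  apply (is_series_unique (fun k => Im (if (k <=? n)%nat then f k else RtoC 0))).
  eapply is_series_ext; [|apply (Series_finite (fun k => Im (f k)) n)].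
  intro k; simpl; destruct (k <=? n)%nat; reflexivity.
Qed.

Lemma sum_n_rev (f : nat -> C) (M : nat) :
  sum_n (fun j => f (M - j)%nat) M = sum_n f M.
Proof.
induction M as [|M IH]; [rewrite !sum_O; reflexivity|].
rewrite (sum_Sn f), <- IH; unfold sum_n.
rewrite sum_Sn_m, <- sum_n_m_S by lia; rewrite Nat.sub_0_r.
rewrite plus_comm; reflexivity.
Qed.

(** Recentring at the peak index [M]: the first sum runs downwards from [M], the second upwards from
    [M + 1], matching the two halves of [Theta]. *)
Lemma sum_n_split (f : nat -> C) (M N : nat) :
  sum_n f (M + S N) = (sum_n (fun j => f (M - j)%nat) M
                       + sum_n (fun i => f (M + S i)%nat) N)%C.
Proof.
rewrite sum_n_rev; induction N as [|N IH].
- rewrite sum_O, Nat.add_1_r, sum_Sn; reflexivity.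
- replace (M + S (S N))%nat with (S (M + S N)) by lia.
  rewrite !sum_Sn, IH; change (@plus C_AbelianMonoid) with Cplus.
  replace (M + S (S N))%nat with (S (M + S N)) by lia.
  apply C_eq; simpl; ring.
Qed.

(** * The expansion of h_n(sinh xi_n) *)

(* [h_n(sinh xi_n) = z^n q^(-n^2 s) * sum_k [n k] q^(k^2) X^k] with [X = im_arg]. *)
Definition im_arg (q : R) (z : C) (tau theta : R) (n : nat) : C :=
  (- (RtoC (Rpower q (INR n * tau)) * Cexp (RtoC (2 * PI * (INR n * theta)) * Ci)
      / Cpow z 2))%C.

(** Here [E = e^(xi_n)]. In the defining sum the [k]-th term is [E^n [n k]_q q^(k^2) (- q^(-n)
    E^(-2))^k], so the natural variable is [- q^(-n) E^(-2)], and this identifies it with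
    [im_arg]. *)
Lemma im_arg_sq (q : R) (z : C) (tau theta : R) (n : nat) :
  0 < q < 1 -> z <> 0 ->
  let E := (qpow q (- (RtoC (INR n) * im_s q tau theta)) * z)%C in
  (im_arg q z tau theta n * RtoC (q ^ n))%C = (- (/ (E * E)))%C.
Proof.
intros Hq Hz E; unfold E, im_arg.
set (w := (RtoC (INR n) * im_s q tau theta)%C).
assert (Hl : ln q <> 0) by (intro H; pose proof (ln_q_neg q Hq); lra).
(* In [2 n s log q] the imaginary part [theta pi / log q] of [s] loses its denominator: [q^(2 n s) =
   q^n q^(n tau) e^(2 pi i n theta)]. *)
assert (Hw : (qpow q w * qpow q w)%C
  = (RtoC (q ^ n) * (RtoC (Rpower q (INR n * tau)) * Cexp (RtoC (2 * PI * (INR n * theta)) * Ci)))%C).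
{ rewrite <- Rpower_pow by lra; unfold qpow, Rpower.
  rewrite <- !Cexp_RtoC, <- !Cexp_plus; f_equal.
  unfold w, im_s; apply C_eq; simpl; field; exact Hl. }
assert (Hi : qpow q (- w) = (/ qpow q w)%C).
{ unfold qpow; rewrite <- Cexp_opp; f_equal; ring. }
assert (Hn : qpow q w <> 0) by apply Cexp_neq_0.
rewrite Hi.
transitivity (- ((RtoC (q ^ n) * (RtoC (Rpower q (INR n * tau))
   * Cexp (RtoC (2 * PI * (INR n * theta)) * Ci))) / Cpow z 2))%C.
{ field; exact Hz. }
rewrite <- Hw; field; split; assumption.
Qed.

Lemma h_at_expand (q : R) (z : C) (tau theta : R) (n : nat) :
  0 < q < 1 -> z <> 0 ->
  h_at q z tau theta n
  = (Cpow z n * qpow q (- (RtoC (INR n ^ 2) * im_s q tau theta))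
     * sum_n (fun k => RtoC (qbinom q n k * q ^ (k * k))
                       * Cpow (im_arg q z tau theta n) k) n)%C.
Proof.
intros Hq Hz.
pose proof (im_arg_sq q z tau theta n Hq Hz) as HX; cbv zeta in HX.
set (w := (RtoC (INR n) * im_s q tau theta)%C) in *.
set (E := (qpow q (- w) * z)%C) in *.
set (X := im_arg q z tau theta n) in *.
assert (HE : E <> 0) by (apply Cmult_neq_0; [apply Cexp_neq_0|exact Hz]).
destruct (Cexp_surj E HE) as [xi Hxi].
assert (Hxi' : Cexp (- xi) = (/ E)%C) by (rewrite Cexp_opp, Hxi; reflexivity).
assert (Hs : sinh_xi q z tau theta n = csinh xi).
{ unfold sinh_xi, csinh; fold w; rewrite Hxi, Hxi'; unfold E.
  assert (Hi : qpow q (- w) = (/ qpow q w)%C)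
    by (unfold qpow; rewrite <- Cexp_opp; f_equal; ring).
  assert (Hn : qpow q w <> 0) by apply Cexp_neq_0.
  rewrite Hi; f_equal; field; split; assumption. }
unfold h_at; rewrite Hs.
destruct (ismail_masson_spec q n Hq) as [_ ->].
rewrite ismail_masson_sum_eq, Hxi, Hxi'.
assert (HEn : (Cpow z n * qpow q (- (RtoC (INR n ^ 2) * im_s q tau theta)))%C = Cpow E n).
{ unfold E; rewrite Cpow_mult_l, Cmult_comm; f_equal.
  unfold qpow; rewrite <- Cexp_nat; f_equal; unfold w; simpl.
  rewrite !RtoC_mult; ring. }
rewrite HEn, <- (sum_n_mult_l (K := C_Ring)).
apply sum_n_ext_loc; intros k Hk; change (@mult C_Ring) with Cmult.
replace n with (n - k + k)%nat at 3 by lia.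
assert (Hqk : q ^ (n * k) <> 0) by (apply pow_nonzero; lra).
assert (Hc : im_coef q n k = qbinom q n k * q ^ (k * k) * / q ^ (n * k)).
{ unfold im_coef.
  replace (Z.of_nat k * (Z.of_nat k - Z.of_nat n))%Z
    with (Z.of_nat (k * k) + - Z.of_nat (n * k))%Z by lia.
  rewrite powerRZ_add, powerRZ_neg', <- !pow_powerRZ by lra; ring. }
assert (Hqn : RtoC (q ^ n) <> 0)
  by (intro H; apply RtoC_inj in H; revert H; apply pow_nonzero; lra).
assert (HXk : Cpow X k = (RtoC (/ q ^ (n * k)) * (Cpow (/ E) k * Cpow (- / E) k))%C).
{ replace X with (X * RtoC (q ^ n) * / RtoC (q ^ n))%C by (field; exact Hqn).
  rewrite HX, <- Cpow_mult_l, Cpow_mult_l, Cpow_inv by exact Hqn.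
  rewrite pow_mult, RtoC_inv, <- RtoC_pow by (apply pow_nonzero, pow_nonzero; lra).
  replace (- / (E * E))%C with (/ E * - / E)%C by (field; exact HE); ring. }
rewrite HXk, Hc, Cpow_add_r, Cpow_inv, !RtoC_mult by exact HE.
assert (Cpow E k <> 0) by (apply Cpow_nz; exact HE).
change (@eq (AbelianMonoid.sort C_AbelianMonoid)) with (@eq C).
field; assumption.
Qed.

Lemma Cmod_im_arg (q : R) (z : C) (tau theta : R) (n : nat) : z <> 0 ->
  Cmod (im_arg q z tau theta n) = Rpower q (INR n * tau) / Cmod z ^ 2.
Proof.
intro Hz; unfold im_arg.
rewrite Cmod_opp, Cmod_div, Cmod_mult, Cmod_R, Cmod_Cexp, Cmod_pow
  by (apply Cpow_nz; exact Hz).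
replace (Re (RtoC (2 * PI * (INR n * theta)) * Ci)%C) with 0 by (simpl; ring).
rewrite exp_0, Rmult_1_r, Rabs_pos_eq by (left; apply exp_pos); reflexivity.
Qed.

Lemma Re_CSeries_RtoC (a : nat -> C) (b : nat -> R) :
  (forall k, a k = RtoC (b k)) -> Re (CSeries a) = Series b.
Proof.
intro H; unfold CSeries; simpl; apply Series_ext; intro k; rewrite H; reflexivity.
Qed.

Lemma Re_Bq (q x : R) :
  Re (Bq q (RtoC x)) = Series (fun k => q ^ (k * k) / qpoch q q k * x ^ k).
Proof.
apply Re_CSeries_RtoC; intro k; rewrite <- RtoC_pow, <- RtoC_mult; reflexivity.
Qed.

Lemma ex_series_Bq (q x : R) : 0 < q < 1 -> 0 < x ->
  ex_series (fun k => q ^ (k * k) / qpoch q q k * x ^ k).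
Proof.
intros Hq Hx.
apply (ex_series_le (K := R_AbsRing) (V := R_CompleteNormedModule) _
  (fun k => / qpoch_inf q q * (q ^ (k * k) * x ^ k))).
- intro k; change (Rabs (q ^ (k * k) / qpoch q q k * x ^ k)
    <= / qpoch_inf q q * (q ^ (k * k) * x ^ k)).
  pose proof (qpoch_qq_pos q k Hq).
  assert (0 < q ^ (k * k)) by (apply pow_lt; lra).
  assert (0 < x ^ k) by (apply pow_lt; lra).
  assert (0 < / qpoch q q k) by (apply Rinv_0_lt_compat; lra).
  assert (/ qpoch q q k <= / qpoch_inf q q)
    by (apply Rinv_le_contravar; [apply qpoch_inf_qq_pos|apply qpoch_inf_qq_le]; exact Hq).
  unfold Rdiv; rewrite Rabs_pos_eq by (left; repeat apply Rmult_lt_0_compat; lra).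
  replace (q ^ (k * k) * / qpoch q q k * x ^ k)
    with (/ qpoch q q k * (q ^ (k * k) * x ^ k)) by ring.
  apply Rmult_le_compat_r; [apply Rmult_le_pos; lra|assumption].
- apply ex_series_mult_l, ex_series_gauss; assumption.
Qed.

Lemma Bq_term_pos (q x : R) (k : nat) : 0 < q < 1 -> 0 < x ->
  0 < q ^ (k * k) / qpoch q q k * x ^ k.
Proof.
intros Hq Hx; pose proof (qpoch_qq_pos q k Hq).
apply Rmult_lt_0_compat; [apply Rdiv_lt_0_compat; [apply pow_lt; lra|lra]|apply pow_lt; lra].
Qed.

(** * Approximation by 1 and by A_q *)

(** Up to [nu] two errors occur, [[n k]_q] against [1 / (q;q)_k] and [X^k] against [(-w)^k]; beyond
    [nu] both terms are bounded separately, whence the factor 2. All of them are multiples of the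
    terms of [B_q] at [x]. *)
Lemma Aq_approx (q : R) (n nu : nat) (x eta : R) (X w : C) :
  0 < q < 1 -> 0 < x -> 0 <= eta -> (nu <= n)%nat ->
  Cmod X = x -> Cmod w = x ->
  (forall k, (k <= nu)%nat -> Cmod (Cpow X k - Cpow (- w) k) <= eta * x ^ k) ->
  Cmod (sum_n (fun k => RtoC (qbinom q n k * q ^ (k * k)) * Cpow X k)%C n - Aq q w)
  <= (q ^ (n - nu) / (1 - q) + eta
      + 2 * (q ^ (S nu * S nu) * x ^ S nu) / qpoch_inf q q) * Re (Bq q (RtoC x)).
Proof.
intros Hq Hx Heta Hnu HX Hw Hk.
rewrite Re_Bq; unfold Aq; rewrite <- CSeries_finite.
set (b := fun k => q ^ (k * k) / qpoch q q k * x ^ k).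
pose proof (ex_series_Bq q x Hq Hx) as Hb; fold b in Hb.
assert (Hb0 : forall k, 0 < b k) by (intro k; apply Bq_term_pos; assumption).
set (f := fun k => if (k <=? n)%nat
   then (RtoC (qbinom q n k * q ^ (k * k)) * Cpow X k)%C else RtoC 0).
set (g := fun k => (RtoC (q ^ (k * k) / qpoch q q k) * Cpow (- w) k)%C).
assert (Hg : forall k, Cmod (g k) = b k).
{ intro k; unfold g, b; rewrite Cmod_mult, Cmod_R, Cmod_pow, Cmod_opp, Hw.
  rewrite Rabs_pos_eq; [reflexivity|].
  left; apply Rdiv_lt_0_compat; [apply pow_lt; lra|apply qpoch_qq_pos; exact Hq]. }
assert (Hqk : forall k, 0 < q ^ (k * k)) by (intro k; apply pow_lt; lra).
assert (Hxk : forall k, 0 < x ^ k) by (intro k; apply pow_lt; lra).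
assert (Hf : forall k, Cmod (f k) <= b k).
{ intro k; unfold f; destruct (Nat.leb_spec k n) as [H|H].
  - rewrite Cmod_mult, Cmod_R, Cmod_pow, HX; unfold b.
    destruct (qbinom_le q n k Hq H) as [H1 H2]; specialize (Hqk k).
    rewrite Rabs_pos_eq by (apply Rmult_le_pos; lra).
    apply Rmult_le_compat_r; [left; apply Hxk|].
    unfold Rdiv; rewrite Rmult_comm; apply Rmult_le_compat_l; lra.
  - rewrite Cmod_0; left; apply Hb0. }
rewrite <- (CSeries_minus f g).
2:{ apply (ex_CSeries_le _ b); assumption. }
2:{ apply (ex_CSeries_le _ b); [intro k; rewrite Hg; lra|exact Hb]. }
assert (Hinf : 0 < qpoch_inf q q) by (apply qpoch_inf_qq_pos; exact Hq).
rewrite (Rmult_plus_distr_r (_ + eta)).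
apply (CSeries_split_bound _ b b (S nu)).
- apply Rplus_le_le_0_compat; [|exact Heta].
  left; apply Rdiv_lt_0_compat; [apply pow_lt; lra|lra].
- left; apply Rdiv_lt_0_compat; [|exact Hinf].
  apply Rmult_lt_0_compat; [lra|apply Rmult_lt_0_compat; [apply Hqk|apply Hxk]].
- intro k; left; apply Hb0.
- intro k; left; apply Hb0.
- exact Hb.
- exact Hb.
- intros k Hlt; unfold f, g; destruct (Nat.leb_spec k n) as [H|H]; [|lia].
  destruct (qbinom_le q n k Hq H) as [H1 H2]; specialize (Hk k ltac:(lia)).
  pose proof (qbinom_ge q n k Hq H) as H3; pose proof (qpoch_qq_pos q k Hq) as H4.
  assert (H5 : q ^ S (n - k) <= q ^ (n - nu)) by (apply pow_q_antitone; [exact Hq|lia]).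
  assert (Hp : 0 < / qpoch q q k) by (apply Rinv_0_lt_compat; exact H4).
  set (p := / qpoch q q k) in *; set (c := qbinom q n k) in *.
  replace (RtoC (c * q ^ (k * k)) * Cpow X k
           - RtoC (q ^ (k * k) / qpoch q q k) * Cpow (- w) k)%C
    with (RtoC (q ^ (k * k) * c) * (Cpow X k - Cpow (- w) k)
          - RtoC (q ^ (k * k) * (p - c)) * Cpow (- w) k)%C
    by (unfold Rdiv; fold p; rewrite !RtoC_mult, RtoC_minus; ring).
  unfold Cminus at 1; eapply Rle_trans; [apply Cmod_triangle|].
  rewrite Cmod_opp, !Cmod_mult, !Cmod_R, Cmod_pow, Cmod_opp, Hw.
  assert (H6 : p - c <= p * (q ^ (n - nu) / (1 - q))).
  { assert (p * (q ^ S (n - k) / (1 - q)) <= p * (q ^ (n - nu) / (1 - q))).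
    { apply Rmult_le_compat_l; [lra|]; apply Rmult_le_compat_r; [|exact H5].
      left; apply Rinv_0_lt_compat; lra. }
    lra. }
  specialize (Hqk k); specialize (Hxk k).
  rewrite !Rabs_pos_eq by (apply Rmult_le_pos; lra).
  set (d := q ^ (n - nu) / (1 - q)) in *.
  apply Rle_trans with (q ^ (k * k) * p * (eta * x ^ k) + q ^ (k * k) * (p * d) * x ^ k);
    [|unfold b, Rdiv; fold p; right; ring].
  apply Rplus_le_compat.
  + apply Rmult_le_compat; [apply Rmult_le_pos; lra|apply Cmod_ge_0| |exact Hk].
    apply Rmult_le_compat_l; lra.
  + apply Rmult_le_compat_r; [lra|]; apply Rmult_le_compat_l; lra.
- intro i; unfold Cminus; eapply Rle_trans; [apply Cmod_triangle|].
  rewrite Cmod_opp, Hg.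
  (* The tail is turned back into a multiple of the [B_q] series from index 0: the exponent
     satisfies [(nu + 1 + i)^2 >= (nu + 1)^2 + i^2], and the factor [1 / (q;q)_i >= 1] is inserted
     once the actual denominator has been bounded by [(q;q)_oo]. *)
  apply Rle_trans with (2 * b (S nu + i)%nat); [specialize (Hf (S nu + i)%nat); lra|].
  unfold b.
  pose proof (qpoch_qq_pos q i Hq) as Hpi.
  pose proof (qpoch_qq_le1 q i Hq) as Hpi1.
  assert (Hip : 1 <= / qpoch q q i) by (rewrite <- Rinv_1; apply Rinv_le_contravar; lra).
  assert (Hpn : / qpoch q q (S nu + i) <= / qpoch_inf q q)
    by (apply Rinv_le_contravar; [exact Hinf|apply qpoch_inf_qq_le; exact Hq]).
  assert (Hqq : q ^ ((S nu + i) * (S nu + i)) <= q ^ (S nu * S nu) * q ^ (i * i)).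
  { rewrite <- pow_add; apply pow_q_antitone; [exact Hq|lia]. }
  rewrite (pow_add x).
  unfold Rdiv.
  assert (0 < / qpoch q q (S nu + i)) by (apply Rinv_0_lt_compat, qpoch_qq_pos, Hq).
  pose proof (Hqk (S nu + i)%nat); pose proof (Hqk i); pose proof (Hqk (S nu)).
  pose proof (Hxk i); pose proof (Hxk (S nu)).
  replace (2 * (q ^ (S nu * S nu) * x ^ S nu) * / qpoch_inf q q
     * (q ^ (i * i) * / qpoch q q i * x ^ i))
    with (2 * ((q ^ (S nu * S nu) * q ^ (i * i)) * (/ qpoch_inf q q * / qpoch q q i)
               * (x ^ S nu * x ^ i))) by ring.
  apply Rmult_le_compat_l; [lra|].
  apply Rmult_le_compat_r; [apply Rmult_le_pos; lra|].
  apply Rmult_le_compat; try lra.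
  rewrite <- (Rmult_1_r (/ qpoch q q (S nu + i))).
  apply Rmult_le_compat; lra.
Qed.

(** After removing the term [k = 0] the index is shifted: [q^((k+1)^2) = q q^(2 k) q^(k^2)] produces
    the argument [q^2 x], and [(q;q)_(k+1) >= (1 - q) (q;q)_k] the denominator. One factor of [X] is
    kept exactly, since it carries the decay [q^(n tau)]; the others are bounded by [x]. *)
Lemma im_sum_tail (q x : R) (n : nat) (X : C) :
  0 < q < 1 -> 0 < x -> Cmod X <= x ->
  Cmod (sum_n (fun k => RtoC (qbinom q n k * q ^ (k * k)) * Cpow X k)%C n - 1)
  <= q * Cmod X / (1 - q) * Series (fun k => q ^ (k * k) / qpoch q q k * (q ^ 2 * x) ^ k).
Proof.
intros Hq Hx HX.
set (F := fun k => (RtoC (qbinom q n k * q ^ (k * k)) * Cpow X k)%C).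
assert (HF0 : F O = RtoC 1).
{ unfold F, qbinom; simpl; rewrite Nat.sub_0_r.
  pose proof (qpoch_qq_pos q n Hq).
  replace (qpoch q q n / (1 * qpoch q q n) * 1) with 1 by (field; lra); ring. }
set (b := fun k => q ^ (k * k) / qpoch q q k * (q ^ 2 * x) ^ k).
assert (Hq2x : 0 < q ^ 2 * x) by (apply Rmult_lt_0_compat; [apply pow_lt; lra|exact Hx]).
assert (Hb : ex_series b) by (apply ex_series_Bq; assumption).
assert (HE : 0 <= q * Cmod X / (1 - q)).
{ pose proof (Cmod_ge_0 X).
  apply Rmult_le_pos; [nra|left; apply Rinv_0_lt_compat; lra]. }
assert (Hb0 : forall k, 0 < b k) by (intro k; apply Bq_term_pos; assumption).
destruct n as [|n].
{ rewrite sum_O, HF0; replace (1 - 1)%C with (RtoC 0) by ring; rewrite Cmod_0.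
  apply Rmult_le_pos; [exact HE|apply Series_nonneg; [intro k; left; apply Hb0|exact Hb]]. }
unfold sum_n; rewrite sum_Sn_m, <- sum_n_m_S, HF0 by lia.
change (@plus (AbelianGroup.AbelianMonoid C_AbelianGroup)) with Cplus.
change (@plus C_AbelianMonoid) with Cplus.
fold (sum_n (fun k => F (S k)) n).
replace (1 + sum_n (fun k => F (S k)) n - 1)%C with (sum_n (fun k => F (S k)) n)
  by (apply C_eq; simpl; ring).
rewrite <- CSeries_finite, <- Series_scal_l.
apply Cmod_CSeries_le; [|apply ex_series_mult_l; exact Hb].
intro k; destruct (Nat.leb_spec k n) as [Hk|Hk];
  [|rewrite Cmod_0; apply Rmult_le_pos; [exact HE|left; apply Hb0]].
unfold F, b; rewrite Cmod_mult, Cmod_R, Cmod_pow.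
destruct (qbinom_le q (S n) (S k) Hq ltac:(lia)) as [H1 H2].
assert (Hqk : forall k, 0 < q ^ k) by (intro j; apply pow_lt; lra).
rewrite Rabs_pos_eq by (apply Rmult_le_pos; [lra|left; apply Hqk]).
pose proof (qpoch_qq_pos q k Hq) as Hp.
assert (Hpk : / qpoch q q (S k) <= / (1 - q) * / qpoch q q k).
{ rewrite <- Rinv_mult; apply Rinv_le_contravar; [apply Rmult_lt_0_compat; lra|].
  rewrite qpoch_qq_S; pose proof (pow_q_le1 q k Hq); simpl.
  assert (q * q ^ k <= q) by nra.
  rewrite Rmult_comm; apply Rmult_le_compat_l; lra. }
pose proof (Cmod_ge_0 X) as H0.
assert (HXk : Cmod X ^ k <= x ^ k) by (apply pow_incr; lra).
assert (HXk0 : 0 <= Cmod X ^ k) by (apply pow_le; exact H0).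
rewrite Rpow_mult_distr, <- pow_mult.
replace (S k * S k)%nat with (1 + (2 * k + k * k))%nat by lia.
rewrite !pow_add, pow_1; simpl (Cmod X ^ S k).
unfold Rdiv.
replace (q * Cmod X * / (1 - q) * (q ^ (k * k) * / qpoch q q k * (q ^ (2 * k) * x ^ k)))
  with (/ (1 - q) * / qpoch q q k * (q * (q ^ (2 * k) * q ^ (k * k))) * (Cmod X * x ^ k))
  by ring.
pose proof (Hqk (k * k)%nat); pose proof (Hqk (2 * k)%nat).
assert (0 < q ^ (2 * k) * q ^ (k * k)) by (apply Rmult_lt_0_compat; lra).
apply Rmult_le_compat.
- apply Rmult_le_pos; [lra|]; apply Rmult_le_pos; lra.
- apply Rmult_le_pos; lra.
- apply Rmult_le_compat_r; [apply Rmult_le_pos; lra|lra].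
- apply Rmult_le_compat_l; lra.
Qed.

(** * Approximation by the theta function *)

Lemma Rpower_pos (x y : R) : 0 < Rpower x y.
Proof. apply exp_pos. Qed.

Lemma Rpower_antitone (q x y : R) : 0 < q < 1 -> x <= y -> Rpower q y <= Rpower q x.
Proof.
intros Hq [H|<-]; [|lra]; left; apply exp_increasing.
pose proof (ln_q_neg q Hq); nra.
Qed.

Lemma sqrt_q_bounds (q : R) : 0 < q < 1 -> 0 < sqrt q < 1.
Proof.
intro Hq; split; [apply sqrt_lt_R0; lra|].
rewrite <- sqrt_1; apply sqrt_lt_1_alt; lra.
Qed.

Lemma pow_sqrt_Rpower (q : R) (j : nat) : 0 < q < 1 ->
  sqrt q ^ (j * j) = Rpower q (INR j ^ 2 / 2).
Proof.
intro Hq; rewrite <- Rpower_pow by (apply sqrt_lt_R0; lra).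
rewrite <- Rpower_sqrt, Rpower_mult, mult_INR by lra; f_equal; field.
Qed.

Lemma Rpower_mul_pow (q r c : R) (j : nat) : 0 < q ->
  q ^ (j * j) * (r * Rpower q c) ^ j = Rpower q (INR j ^ 2 + c * INR j) * r ^ j.
Proof.
intro Hq; rewrite Rpow_mult_distr, Rpower_plus.
rewrite <- (Rpower_pow (j * j) q Hq), <- (Rpower_pow j (Rpower q c)) by apply Rpower_pos.
rewrite Rpower_mult, mult_INR; replace (INR j ^ 2) with (INR j * INR j) by ring; ring.
Qed.

Lemma ex_series_offset (b : nat -> R) (o : nat) :
  ex_series b -> ex_series (fun k => b (o + k)%nat).
Proof. intro H; apply (ex_series_incr_n b o); exact H. Qed.

(* The sums over [j >= 0] and [j <= -1] of the bilateral theta series are both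
   instances, with [o = 0] and [o = 1]. *)
Lemma theta_side (q rho c c' eta T : R) (o nu : nat) (g : nat -> R) (V V' : C) :
  0 < q < 1 -> 0 < rho -> (o <= 1)%nat -> (5 <= nu)%nat -> 0 <= eta ->
  -2 <= c <= 2 ->
  Cmod V = rho * Rpower q c -> Cmod V' = rho * Rpower q c' ->
  (forall j, 0 <= g j <= 1) ->
  (forall j, (j <= nu)%nat -> 1 - g j <= 2 * q ^ (2 * nu - j) / (1 - q)) ->
  (forall j, (j <= nu)%nat -> Cmod (Cpow V' j - Cpow V j) <= eta * Cmod V ^ j) ->
  (forall t, 1 <= t -> T + t ^ 2 / 2 <= (INR nu + t) ^ 2 + c * (INR nu + t)) ->
  (forall t, 1 <= t -> T + t ^ 2 / 2 <= (INR nu + t) ^ 2 + c' * (INR nu + t)) ->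
  Cmod (CSeries (fun k => RtoC (g (o + k)%nat * q ^ ((o + k) * (o + k))) * Cpow V' (o + k))%C
        - CSeries (fun k => RtoC (q ^ ((o + k) * (o + k))) * Cpow V (o + k))%C)
  <= (2 * q ^ nu / (1 - q) + eta / q ^ 2 + 2 * Rpower q T * rho ^ nu)
     * Series (fun k => sqrt q ^ ((o + k) * (o + k)) * rho ^ (o + k)).
Proof.
intros Hq Hrho Ho Hnu Heta Hc HV HV' Hg Hg1 Hp HT HT'.
set (p := fun j => sqrt q ^ (j * j) * rho ^ j).
assert (Hpe : forall j, p j = Rpower q (INR j ^ 2 / 2) * rho ^ j)
  by (intro j; unfold p; rewrite pow_sqrt_Rpower by exact Hq; reflexivity).
assert (Hrk : forall k, 0 < rho ^ k) by (intro k; apply pow_lt; exact Hrho).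
assert (Hp0 : forall j, 0 <= p j).
{ intro j; rewrite Hpe; apply Rmult_le_pos; left; [apply Rpower_pos|apply Hrk]. }
assert (Hpex : ex_series p) by (apply ex_series_gauss; [apply sqrt_q_bounds; exact Hq|exact Hrho]).
set (a := fun j => (RtoC (g j * q ^ (j * j)) * Cpow V' j)%C).
set (b := fun j => (RtoC (q ^ (j * j)) * Cpow V j)%C).
assert (Hqk : forall k, 0 < q ^ k) by (intro k; apply pow_lt; lra).
assert (Hb : forall j, Cmod (b j) = Rpower q (INR j ^ 2 + c * INR j) * rho ^ j).
{ intro j; unfold b; rewrite Cmod_mult, Cmod_R, Cmod_pow, HV.
  rewrite Rabs_pos_eq by (left; apply Hqk); apply Rpower_mul_pow; lra. }
assert (Ha : forall j, Cmod (a j) <= Rpower q (INR j ^ 2 + c' * INR j) * rho ^ j).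
{ intro j; unfold a; rewrite Cmod_mult, Cmod_R, Cmod_pow, HV'.
  rewrite <- Rpower_mul_pow by lra.
  specialize (Hg j); specialize (Hqk (j * j)%nat).
  rewrite Rabs_pos_eq by (apply Rmult_le_pos; lra).
  apply Rmult_le_compat_r; [|nra].
  apply pow_le, Rmult_le_pos; [lra|left; apply Rpower_pos]. }
assert (Hgs : forall d, ex_series (fun j => Rpower q (INR j ^ 2 + d * INR j) * rho ^ j)).
{ intro d; apply ex_series_ext with (fun j => q ^ (j * j) * (rho * Rpower q d) ^ j).
  - intro j; apply Rpower_mul_pow; lra.
  - apply ex_series_gauss; [exact Hq|apply Rmult_lt_0_compat; [exact Hrho|apply Rpower_pos]]. }
change (Cmod (CSeries (fun k => a (o + k)%nat) - CSeries (fun k => b (o + k)%nat))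
  <= (2 * q ^ nu / (1 - q) + eta / q ^ 2 + 2 * Rpower q T * rho ^ nu)
     * Series (fun k => p (o + k)%nat)).
rewrite <- CSeries_minus.
2:{ eapply ex_CSeries_le; [intro k; apply Ha|].
    apply (ex_series_offset (fun j => Rpower q (INR j ^ 2 + c' * INR j) * rho ^ j)), Hgs. }
2:{ eapply ex_CSeries_le; [intro k; right; apply Hb|].
    apply (ex_series_offset (fun j => Rpower q (INR j ^ 2 + c * INR j) * rho ^ j)), Hgs. }
assert (HP : Series (fun k => p (S k)) <= Series (fun k => p (o + k)%nat)).
{ destruct o as [|[|o]]; [|right; apply Series_ext; reflexivity|lia].
  apply Series_shift_le; [exact Hp0|exact Hpex]. }
assert (HE2 : 0 <= 2 * Rpower q T * rho ^ nu).
{ apply Rmult_le_pos; [|left; apply Hrk]; pose proof (Rpower_pos q T); lra. }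
assert (Hn5 : 5 <= INR nu) by (apply (le_INR 5) in Hnu; simpl in Hnu; lra).
(* The tail naturally compares with [p] from index 1 on, which is at most the series from [o]
   because [o] is 0 or 1. *)
apply Rle_trans with ((2 * q ^ nu / (1 - q) + eta / q ^ 2) * Series (fun k => p (o + k)%nat)
  + 2 * Rpower q T * rho ^ nu * Series (fun k => p (S k))).
2:{ rewrite (Rmult_plus_distr_r (_ + _)); apply Rplus_le_compat_l.
    apply Rmult_le_compat_l; assumption. }
apply (CSeries_split_bound _ _ _ (S nu - o)).
- apply Rplus_le_le_0_compat.
  + apply Rmult_le_pos; [specialize (Hqk nu); lra|left; apply Rinv_0_lt_compat; lra].
  + apply Rmult_le_pos; [exact Heta|left; apply Rinv_0_lt_compat, Hqk].
- exact HE2.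
- intro k; apply Hp0.
- intro k; apply Hp0.
- apply (ex_series_offset p); exact Hpex.
- apply (ex_series_offset p 1); exact Hpex.
- intros k Hk; set (j := (o + k)%nat) in *; assert (Hj : (j <= nu)%nat) by lia.
  unfold a, b.
  replace (RtoC (g j * q ^ (j * j)) * Cpow V' j - RtoC (q ^ (j * j)) * Cpow V j)%C
    with (RtoC (g j * q ^ (j * j)) * (Cpow V' j - Cpow V j)
          - RtoC ((1 - g j) * q ^ (j * j)) * Cpow V j)%C
    by (rewrite !RtoC_mult, RtoC_minus; ring).
  unfold Cminus at 1; eapply Rle_trans; [apply Cmod_triangle|].
  rewrite Cmod_opp, !Cmod_mult, !Cmod_R, Cmod_pow.
  specialize (Hg j); specialize (Hg1 j Hj); specialize (Hp j Hj).
  pose proof (Hqk (j * j)%nat) as Hqj.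
  rewrite !Rabs_pos_eq by (apply Rmult_le_pos; lra).
  pose proof (Hb j) as Hbj; unfold b in Hbj.
  rewrite Cmod_mult, Cmod_R, Cmod_pow, Rabs_pos_eq in Hbj by lra.
  set (v := Cmod V ^ j) in *.
  assert (Hv : 0 <= v) by (apply pow_le, Cmod_ge_0).
  set (e := 2 * q ^ (2 * nu - j) / (1 - q)) in *.
  apply Rle_trans with (eta * (q ^ (j * j) * v) + e * (q ^ (j * j) * v)).
  + apply Rplus_le_compat.
    * replace (eta * (q ^ (j * j) * v)) with (q ^ (j * j) * (eta * v)) by ring.
      apply Rmult_le_compat; [apply Rmult_le_pos; lra|apply Cmod_ge_0| |exact Hp].
      rewrite <- (Rmult_1_l (q ^ (j * j))) at 2; apply Rmult_le_compat_r; lra.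
    * rewrite <- Rmult_assoc; apply Rmult_le_compat_r; [exact Hv|].
      apply Rmult_le_compat_r; lra.
  + rewrite Hbj, Hpe.
    assert (Hjn : INR j <= INR nu) by (apply le_INR; exact Hj).
    pose proof (pos_INR j) as Hj0.
    (* Since [(j + c)^2 >= 0], the exponent exceeds [j^2 / 2] by at least [- c^2 / 2 >= -2]. *)
    assert (H1 : Rpower q (INR j ^ 2 + c * INR j) <= / q ^ 2 * Rpower q (INR j ^ 2 / 2)).
    { rewrite <- (Rpower_pow 2 q), <- Rpower_Ropp, <- Rpower_plus by lra.
      apply Rpower_antitone; [exact Hq|]; simpl (INR 2).
      assert (0 <= (INR j + c) ^ 2) by apply pow2_ge_0.
      assert (c ^ 2 <= 4) by nra; lra. }
    (* No [q^(-2)] is lost here: with [c >= -2] the surplus in the exponent is at least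
       [nu - 3 j + j^2 / 2 >= nu - 9/2], and this is where [nu >= 5] enters. *)
    assert (H2 : q ^ (2 * nu - j) * Rpower q (INR j ^ 2 + c * INR j)
                 <= q ^ nu * Rpower q (INR j ^ 2 / 2)).
    { rewrite <- (Rpower_pow (2 * nu - j) q), <- (Rpower_pow nu q), <- !Rpower_plus by lra.
      apply Rpower_antitone; [exact Hq|].
      rewrite minus_INR, mult_INR by lia; simpl (INR 2).
      assert (0 <= (INR j - 3) ^ 2) by apply pow2_ge_0; nra. }
    assert (Hi : 0 < / (1 - q)) by (apply Rinv_0_lt_compat; lra).
    specialize (Hrk j).
    replace ((2 * q ^ nu / (1 - q) + eta / q ^ 2) * (Rpower q (INR j ^ 2 / 2) * rho ^ j))
      with (eta * ((/ q ^ 2 * Rpower q (INR j ^ 2 / 2)) * rho ^ j)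
            + 2 * / (1 - q) * ((q ^ nu * Rpower q (INR j ^ 2 / 2)) * rho ^ j))
      by (unfold Rdiv; ring).
    apply Rplus_le_compat.
    * apply Rmult_le_compat_l; [exact Heta|]; apply Rmult_le_compat_r; lra.
    * replace (e * (Rpower q (INR j ^ 2 + c * INR j) * rho ^ j))
        with (2 * / (1 - q) * ((q ^ (2 * nu - j) * Rpower q (INR j ^ 2 + c * INR j)) * rho ^ j))
        by (unfold e, Rdiv; ring).
      apply Rmult_le_compat_l; [lra|]; apply Rmult_le_compat_r; lra.
(* For either value of [o] the tail index is [nu + t] with [t = i + 1 >= 1]; the hypotheses on [T]
   split its exponent into a constant part and [t^2 / 2]. *)
- intro i; set (j := (o + (S nu - o + i))%nat).
  assert (Hj : INR j = INR nu + INR (S i)) by (rewrite <- plus_INR; f_equal; unfold j; lia).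
  assert (Hi1 : 1 <= INR (S i)) by (rewrite S_INR; pose proof (pos_INR i); lra).
  unfold Cminus; eapply Rle_trans; [apply Cmod_triangle|]; rewrite Cmod_opp, Hb.
  specialize (Ha j); specialize (HT _ Hi1); specialize (HT' _ Hi1).
  rewrite Hj in *; rewrite Hpe.
  assert (Hr : rho ^ j = rho ^ nu * rho ^ S i)
    by (rewrite <- pow_add; f_equal; unfold j; lia).
  assert (H1 : Rpower q ((INR nu + INR (S i)) ^ 2 + c * (INR nu + INR (S i)))
    <= Rpower q T * Rpower q (INR (S i) ^ 2 / 2))
    by (rewrite <- Rpower_plus; apply Rpower_antitone; assumption).
  assert (H2 : Rpower q ((INR nu + INR (S i)) ^ 2 + c' * (INR nu + INR (S i)))
    <= Rpower q T * Rpower q (INR (S i) ^ 2 / 2))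
    by (rewrite <- Rpower_plus; apply Rpower_antitone; assumption).
  pose proof (Hrk j) as Hrj.
  replace (2 * Rpower q T * rho ^ nu * (Rpower q (INR (S i) ^ 2 / 2) * rho ^ S i))
    with (2 * (Rpower q T * Rpower q (INR (S i) ^ 2 / 2)) * rho ^ j) by (rewrite Hr; ring).
  nra.
Qed.

Lemma Re_Theta (q x : R) : 0 < x ->
  Re (Theta q (RtoC x)) = Series (fun k => q ^ (k * k) * x ^ k)
                          + Series (fun k => q ^ (S k * S k) * (/ x) ^ S k).
Proof.
intro Hx; unfold Theta.
transitivity (Re (CSeries (fun k => RtoC (q ^ (k * k)) * Cpow (RtoC x) k)%C)
  + Re (CSeries (fun k => RtoC (q ^ (S k * S k)) * Cpow (/ RtoC x) (S k))%C));
  [reflexivity|].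
f_equal; apply Re_CSeries_RtoC; intro k.
- rewrite <- RtoC_pow, <- RtoC_mult; reflexivity.
- rewrite <- RtoC_inv, <- RtoC_pow, <- RtoC_mult by lra; reflexivity.
Qed.

(** The two tails differ in size because [c] and [c'] are mostly positive. For positive indices the
    linear term helps or is at least harmless, so the full [q^(nu^2)] survives; for negative indices
    it opposes the Gaussian and half of [nu^2] is given up to absorb it. *)
Lemma theta_approx (q rho c c' eta : R) (nu : nat) (gp gm : nat -> R) (W W' : C) :
  0 < q < 1 -> 0 < rho -> (5 <= nu)%nat -> 0 <= eta ->
  0 <= c <= 2 -> - / 2 <= c' <= 5 / 2 ->
  Cmod W = rho * Rpower q c -> Cmod W' = rho * Rpower q c' ->
  (forall j, 0 <= gp j <= 1) -> (forall j, 0 <= gm j <= 1) ->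
  (forall j, (j <= nu)%nat -> 1 - gp j <= 2 * q ^ (2 * nu - j) / (1 - q)) ->
  (forall j, (j <= nu)%nat -> 1 - gm j <= 2 * q ^ (2 * nu - j) / (1 - q)) ->
  (forall j, (j <= nu)%nat -> Cmod (Cpow W' j - Cpow W j) <= eta * Cmod W ^ j) ->
  (forall j, (j <= nu)%nat -> Cmod (Cpow (/ W') j - Cpow (/ W) j) <= eta * Cmod (/ W) ^ j) ->
  Cmod (CSeries (fun k => RtoC (gp k * q ^ (k * k)) * Cpow W' k)%C
        + CSeries (fun k => RtoC (gm (S k) * q ^ (S k * S k)) * Cpow (/ W') (S k))%C
        - Theta q W)
  <= (2 * q ^ nu / (1 - q) + eta / q ^ 2 + 2 * (q ^ (nu * nu) * rho ^ nu)
      + 2 * (Rpower q (INR nu ^ 2 / 2) / rho ^ nu)) * Re (Theta (sqrt q) (RtoC rho)).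
Proof.
intros Hq Hrho Hnu Heta Hc Hc' HW HW' Hgp Hgm Hgp1 Hgm1 Hp Hm.
assert (Hn5 : 5 <= INR nu) by (apply (le_INR 5) in Hnu; simpl in Hnu; lra).
assert (HWi : Cmod (/ W) = / rho * Rpower q (- c)).
{ rewrite Cmod_inv, HW, Rinv_mult, Rpower_Ropp; [reflexivity|].
  apply Cmod_gt_0; rewrite HW; apply Rmult_lt_0_compat; [exact Hrho|apply Rpower_pos]. }
assert (HWi' : Cmod (/ W') = / rho * Rpower q (- c')).
{ rewrite Cmod_inv, HW', Rinv_mult, Rpower_Ropp; [reflexivity|].
  apply Cmod_gt_0; rewrite HW'; apply Rmult_lt_0_compat; [exact Hrho|apply Rpower_pos]. }
assert (Hri : 0 < / rho) by (apply Rinv_0_lt_compat; exact Hrho).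
pose proof (theta_side q rho c c' eta (INR nu ^ 2) 0 nu gp W W' Hq Hrho ltac:(lia)
  Hnu Heta ltac:(lra) HW HW' Hgp Hgp1 Hp) as H1.
specialize (H1 ltac:(intros; nra) ltac:(intros; nra)).
(* Now the linear coefficient can be as low as [-5/2]; [nu^2 / 2 >= 5 nu / 2] and [2 nu t >= 10 t]
   compensate it. *)
pose proof (theta_side q (/ rho) (- c) (- c') eta (INR nu ^ 2 / 2) 1 nu gm (/ W) (/ W')
  Hq Hri ltac:(lia) Hnu Heta ltac:(lra) HWi HWi' Hgm Hgm1 Hm) as H2.
specialize (H2 ltac:(intros; nra) ltac:(intros; nra)).
cbn [Nat.add] in H1, H2.
rewrite Re_Theta by exact Hrho; unfold Theta.
set (A1 := CSeries (fun k => RtoC (gp k * q ^ (k * k)) * Cpow W' k)%C) in *.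
set (A2 := CSeries (fun k => RtoC (q ^ (k * k)) * Cpow W k)%C) in *.
set (B1 := CSeries (fun k => RtoC (gm (S k) * q ^ (S k * S k)) * Cpow (/ W') (S k))%C) in *.
set (B2 := CSeries (fun k => RtoC (q ^ (S k * S k)) * Cpow (/ W) (S k))%C) in *.
replace (A1 + B1 - (A2 + B2))%C with ((A1 - A2) + (B1 - B2))%C by ring.
eapply Rle_trans; [apply Cmod_triangle|].
eapply Rle_trans; [apply Rplus_le_compat; [exact H1|exact H2]|].
assert (E1 : Rpower q (INR nu ^ 2) = q ^ (nu * nu)).
{ rewrite <- (Rpower_pow (nu * nu) q), mult_INR by lra; f_equal; ring. }
rewrite E1, pow_inv.
set (P1 := Series (fun k => sqrt q ^ (k * k) * rho ^ k)).
set (P2 := Series (fun k => sqrt q ^ (S k * S k) * (/ rho) ^ S k)).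
pose proof (sqrt_q_bounds q Hq) as Hs.
assert (HP1 : 0 <= P1).
{ apply Series_nonneg; [|apply ex_series_gauss; assumption].
  intro k; apply Rmult_le_pos; apply pow_le; lra. }
assert (HP2 : 0 <= P2).
{ apply Series_nonneg.
  - intro k; apply Rmult_le_pos; apply pow_le; lra.
  - apply (ex_series_offset (fun k => sqrt q ^ (k * k) * (/ rho) ^ k) 1).
    apply ex_series_gauss; assumption. }
assert (Hu : 0 <= q ^ (nu * nu) * rho ^ nu)
  by (apply Rmult_le_pos; apply pow_le; lra).
assert (Hv : 0 <= Rpower q (INR nu ^ 2 / 2) / rho ^ nu).
{ apply Rmult_le_pos; [left; apply Rpower_pos|].
  left; apply Rinv_0_lt_compat, pow_lt; lra. }
unfold Rdiv in *.
set (e := 2 * q ^ nu * / (1 - q) + eta * / q ^ 2) in *.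
nra.
Qed.

(** * The prefactor and the recentred expansion of h_n *)

Lemma CpowZ_of_nat (w : C) (k : nat) : CpowZ w (Z.of_nat k) = Cpow w k.
Proof. destruct k as [|k]; [reflexivity|]; simpl CpowZ; rewrite SuccNat2Pos.id_succ; reflexivity. Qed.

Lemma RtoC_neq_0 (x : R) : x <> 0 -> RtoC x <> 0.
Proof. intros H E; apply RtoC_inj in E; exact (H E). Qed.

Lemma Cinv_nz (w : C) : w <> 0 -> (/ w)%C <> 0.
Proof.
intro H; apply Cmod_gt_0; rewrite Cmod_inv by exact H.
apply Rinv_0_lt_compat, Cmod_gt_0, H.
Qed.

Lemma Copp_nz (w : C) : w <> 0 -> (- w)%C <> 0.
Proof. intro H; apply Cmod_gt_0; rewrite Cmod_opp; apply Cmod_gt_0, H. Qed.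

Lemma CpowZ_neq_0 (w : C) (k : Z) : w <> 0 -> CpowZ w k <> 0.
Proof.
intro H; destruct k; simpl.
- apply RtoC_neq_0; lra.
- apply Cpow_nz; exact H.
- apply Cinv_nz, Cpow_nz; exact H.
Qed.

Lemma theta_prefactor_neq_0 (q : R) (z : C) (tau theta : R) (n : nat) (m : Z) (phi : R) :
  0 < q < 1 -> z <> 0 -> theta_prefactor q z tau theta n m phi <> 0.
Proof.
intros Hq Hz; unfold theta_prefactor; cbv zeta.
assert (H : (- (Cpow z 2 * Cexp (- (RtoC (2 * PI * phi) * Ci))))%C <> 0).
{ apply Copp_nz, Cmult_neq_0; [apply Cpow_nz; exact Hz|apply Cexp_neq_0]. }
apply Cmult_neq_0; [apply Cmult_neq_0; [apply Cpow_nz; exact Hz|apply Cexp_neq_0]|].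
apply Cinv_nz, Cmult_neq_0; [apply CpowZ_neq_0; exact H|].
apply RtoC_neq_0; pose proof (qpoch_inf_qq_pos q Hq); lra.
Qed.

(** The normalisation by [(q;q)_oo] makes 1 the limiting value of the coefficients. Extension by 0
    outside the range of summation lets the finite sum be compared with the whole theta series;
    [theta_coef_neg] treats the indices above [M] in the same way. *)
Definition theta_coef_pos (q : R) (n M j : nat) : R :=
  if (j <=? M)%nat then qpoch_inf q q * qbinom q n (M - j) else 0.

Definition theta_coef_neg (q : R) (n M i : nat) : R :=
  if (M + i <=? n)%nat then qpoch_inf q q * qbinom q n (M + i) else 0.

Lemma theta_arg_inv (q : R) (z : C) (tau theta : R) (n M : nat) :
  0 < q < 1 -> z <> 0 ->
  (/ theta_arg q z (- INR n * tau - 2 * INR M) (INR n * theta))%C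
  = (RtoC (q ^ (2 * M)) * im_arg q z tau theta n)%C.
Proof.
intros Hq Hz; unfold theta_arg, im_arg.
replace (- INR n * tau - 2 * INR M) with (- (INR n * tau + INR (2 * M)))
  by (rewrite mult_INR; simpl (INR 2); ring).
rewrite Rpower_Ropp, Rpower_plus, Rpower_pow, Cexp_opp, RtoC_inv, RtoC_mult by
  first [lra|apply Rmult_integral_contrapositive_currified; apply Rgt_not_eq;
             first [apply Rpower_pos|apply pow_lt; lra]].
assert (RtoC (q ^ (2 * M)) <> 0) by (apply RtoC_neq_0, pow_nonzero; lra).
assert (RtoC (Rpower q (INR n * tau)) <> 0)
  by (apply RtoC_neq_0, Rgt_not_eq, Rpower_pos).
pose proof (Cexp_neq_0 (RtoC (2 * PI * (INR n * theta)) * Ci)).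
field; repeat split; try assumption.
Qed.

(* Completing the square around [k = M]: with [k = M - j] or [k = M + i],
   [q^(k^2) X^k = q^(M^2) X^M * q^(j^2) W^j] for [W = 1 / (q^(2 M) X)]. *)
Lemma h_at_theta_expand (q : R) (z : C) (tau theta : R) (M N : nat) (m : Z) (phi : R) :
  0 < q < 1 -> z <> 0 -> (m / 2)%Z = Z.of_nat M ->
  let n := (M + S N)%nat in
  Cexp (RtoC (2 * PI * phi) * Ci) = Cexp (RtoC (2 * PI * (INR n * theta)) * Ci) ->
  let W := theta_arg q z (- INR n * tau - 2 * INR M) (INR n * theta) in
  h_at q z tau theta n
  = (theta_prefactor q z tau theta n m phi
     * (CSeries (fun k => RtoC (theta_coef_pos q n M k * q ^ (k * k)) * Cpow W k)
        + CSeries (fun k => RtoC (theta_coef_neg q n M (S k) * q ^ (S k * S k))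
                            * Cpow (/ W) (S k))))%C.
Proof.
intros Hq Hz Hm n Hphi W.
rewrite (h_at_expand q z tau theta n Hq Hz).
set (X := im_arg q z tau theta n).
assert (HU : (/ W)%C = (RtoC (q ^ (2 * M)) * X)%C)
  by (apply theta_arg_inv; assumption).
assert (Hinf : 0 < qpoch_inf q q) by (apply qpoch_inf_qq_pos; exact Hq).
assert (HinfC : RtoC (qpoch_inf q q) <> 0) by (apply RtoC_neq_0; lra).
assert (HX : X <> 0).
{ apply Cmod_gt_0; unfold X; rewrite Cmod_im_arg by exact Hz.
  apply Cmod_gt_0 in Hz.
  apply Rdiv_lt_0_compat; [apply Rpower_pos|apply pow_lt; exact Hz]. }
assert (Hqn : forall k, RtoC (q ^ k) <> 0) by (intro k; apply RtoC_neq_0, pow_nonzero; lra).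
assert (HW : W = (/ (RtoC (q ^ (2 * M)) * X))%C).
{ rewrite <- HU.
  assert (HWn : W <> 0).
  { apply Copp_nz, Cmult_neq_0; [|apply Cexp_neq_0].
    apply Cmult_neq_0; [apply Cpow_nz; exact Hz|apply RtoC_neq_0, Rgt_not_eq, Rpower_pos]. }
  field; exact HWn. }
assert (HP : theta_prefactor q z tau theta n m phi
  = (Cpow z n * qpow q (- (RtoC (INR n ^ 2) * im_s q tau theta))
     * (RtoC (q ^ (M * M)) * Cpow X M) / RtoC (qpoch_inf q q))%C).
{ unfold theta_prefactor; cbv zeta; rewrite Hm, CpowZ_of_nat, <- INR_IZR_INZ.
  rewrite qpow_plus, qpow_RtoC.
  set (F := (- (Cpow z 2 * Cexp (- (RtoC (2 * PI * phi) * Ci))))%C).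
  (* [F] is the base of the power in the denominator of the prefactor. As [F X = q^(n tau)],
     dividing [q^(M (tau n + M))] by [F^M] leaves [q^(M^2) X^M], the peak term. The phase [phi]
     matters only through [e^(2 pi i phi)]. *)
  assert (HF : (F * X)%C = RtoC (Rpower q (INR n * tau))).
  { unfold F, X, im_arg; rewrite Cexp_opp, Hphi.
    pose proof (Cexp_neq_0 (RtoC (2 * PI * (INR n * theta)) * Ci)).
    field; split; assumption. }
  assert (HFn : F <> 0).
  { intro E; rewrite E, Cmult_0_l in HF; symmetry in HF; revert HF.
    apply RtoC_neq_0, Rgt_not_eq, Rpower_pos. }
  assert (HQ : RtoC (Rpower q (INR M * (tau * INR n + INR M)))
    = (Cpow (F * X) M * RtoC (q ^ (M * M)))%C).
  { rewrite HF, <- RtoC_pow, <- RtoC_mult; f_equal.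
    rewrite <- (Rpower_pow (M * M) q), <- (Rpower_pow M (Rpower q _)) by
      first [lra|apply Rpower_pos].
    rewrite Rpower_mult, <- Rpower_plus, mult_INR; f_equal; ring. }
  rewrite HQ, Cpow_mult_l.
  assert (Cpow F M <> 0) by (apply Cpow_nz; exact HFn).
  field; split; assumption. }
rewrite HP.
rewrite (CSeries_ext _ (fun k => if (k <=? M)%nat then
  (RtoC (qpoch_inf q q * qbinom q n (M - k) * q ^ (k * k)) * Cpow W k)%C else RtoC 0)).
2:{ intro k; unfold theta_coef_pos; destruct (k <=? M)%nat; [reflexivity|].
    rewrite Rmult_0_l; ring. }
rewrite (CSeries_ext (fun k => RtoC (theta_coef_neg q n M (S k) * q ^ (S k * S k))
                            * Cpow (/ W) (S k))%C
  (fun k => if (k <=? N)%nat then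
  (RtoC (qpoch_inf q q * qbinom q n (M + S k) * q ^ (S k * S k)) * Cpow (/ W) (S k))%C
  else RtoC 0)).
2:{ intro k; unfold theta_coef_neg, n.
    destruct (Nat.leb_spec k N); destruct (Nat.leb_spec (M + S k) (M + S N)); try lia;
      [reflexivity|rewrite Rmult_0_l; ring]. }
rewrite (CSeries_finite (fun k =>
  (RtoC (qpoch_inf q q * qbinom q n (M - k) * q ^ (k * k)) * Cpow W k)%C)).
rewrite (CSeries_finite (fun k =>
  (RtoC (qpoch_inf q q * qbinom q n (M + S k) * q ^ (S k * S k)) * Cpow (/ W) (S k))%C)).
set (Y := (RtoC (q ^ (M * M)) * Cpow X M / RtoC (qpoch_inf q q))%C).
assert (H1 : (sum_n (fun j => RtoC (qbinom q n (M - j) * q ^ ((M - j) * (M - j)))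
                              * Cpow X (M - j)) M)%C
  = (Y * sum_n (fun k => RtoC (qpoch_inf q q * qbinom q n (M - k) * q ^ (k * k)) * Cpow W k) M)%C).
{ rewrite <- (sum_n_mult_l (K := C_Ring)); change (@mult C_Ring) with Cmult.
  apply sum_n_ext_loc; intros j Hj.
  change (@eq (AbelianMonoid.sort C_AbelianMonoid)) with (@eq C).
  set (i := (M - j)%nat); unfold Y.
  assert (HM : M = (i + j)%nat) by (unfold i; lia).
  rewrite HW, Cpow_inv by (apply Cmult_neq_0; [apply Hqn|exact HX]).
  rewrite Cpow_mult_l, <- RtoC_pow, <- pow_mult, !RtoC_mult.
  replace (Cpow X M) with (Cpow X i * Cpow X j)%C by (rewrite HM; symmetry; apply Cpow_add_r).
  (* The completed square, with [M = i + j]: [M^2 + j^2 = i^2 + 2 M j]. *)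
  assert (Hs : (RtoC (q ^ (M * M)) * RtoC (q ^ (j * j)))%C
               = (RtoC (q ^ (i * i)) * RtoC (q ^ (2 * M * j)))%C).
  { rewrite <- !RtoC_mult, <- !pow_add; do 2 f_equal; rewrite HM; ring. }
  pose proof (Cpow_nz X j HX); pose proof (Hqn (2 * M * j)%nat).
  transitivity (RtoC (qbinom q n i) * (RtoC (q ^ (M * M)) * RtoC (q ^ (j * j)))
    / RtoC (q ^ (2 * M * j)) * Cpow X i)%C;
    [rewrite Hs; field; assumption|field; repeat split; assumption]. }
assert (H2 : (sum_n (fun i => RtoC (qbinom q n (M + S i) * q ^ ((M + S i) * (M + S i)))
                              * Cpow X (M + S i)) N)%C
  = (Y * sum_n (fun k => RtoC (qpoch_inf q q * qbinom q n (M + S k) * q ^ (S k * S k))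
                        * Cpow (/ W) (S k)) N)%C).
{ rewrite <- (sum_n_mult_l (K := C_Ring)); change (@mult C_Ring) with Cmult.
  apply sum_n_ext_loc; intros j Hj.
  change (@eq (AbelianMonoid.sort C_AbelianMonoid)) with (@eq C).
  set (i := S j); unfold Y.
  rewrite HU, Cpow_mult_l, <- RtoC_pow, <- pow_mult, !RtoC_mult, Cpow_add_r.
  replace ((M + i) * (M + i))%nat with (M * M + i * i + 2 * M * i)%nat by ring.
  rewrite !pow_add, !RtoC_mult; field; assumption. }
pose proof (sum_n_split (fun k => RtoC (qbinom q n k * q ^ (k * k)) * Cpow X k)%C M N) as Hsp.
fold n in Hsp; cbv beta in Hsp; rewrite Hsp.
rewrite H1, H2; unfold Y; field; assumption.
Qed.

(** A margin of [2 nu] on both sides of the peak leaves both lower indices of the q-binomial at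
    least [2 nu - j] for [j <= nu]. Keeping the exponent [2 nu - j] instead of [nu] lets the surplus
    offset the linear term in the theta exponent. *)
Lemma theta_coef_bounds (q : R) (n M nu : nat) : 0 < q < 1 ->
  (2 * nu <= M)%nat -> (M + 2 * nu <= n)%nat ->
  (forall j, 0 <= theta_coef_pos q n M j <= 1) /\
  (forall j, 0 <= theta_coef_neg q n M j <= 1) /\
  (forall j, (j <= nu)%nat ->
     1 - theta_coef_pos q n M j <= 2 * q ^ (2 * nu - j) / (1 - q)) /\
  (forall j, (j <= nu)%nat ->
     1 - theta_coef_neg q n M j <= 2 * q ^ (2 * nu - j) / (1 - q)).
Proof.
intros Hq HM Hn.
assert (Hi : 0 < / (1 - q)) by (apply Rinv_0_lt_compat; lra).
unfold theta_coef_pos, theta_coef_neg; repeat split.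
- destruct (Nat.leb_spec j M); [|lra].
  apply (qbinom_scaled_bounds q n (M - j) Hq ltac:(lia)).
- destruct (Nat.leb_spec j M); [|lra].
  apply (qbinom_scaled_bounds q n (M - j) Hq ltac:(lia)).
- destruct (Nat.leb_spec (M + j) n); [|lra].
  apply (qbinom_scaled_bounds q n (M + j) Hq ltac:(lia)).
- destruct (Nat.leb_spec (M + j) n); [|lra].
  apply (qbinom_scaled_bounds q n (M + j) Hq ltac:(lia)).
- intros j Hj; destruct (Nat.leb_spec j M); [|lia].
  eapply Rle_trans; [apply (qbinom_scaled_bounds q n (M - j) Hq ltac:(lia))|].
  apply Rmult_le_compat_r; [lra|].
  pose proof (pow_q_antitone q (2 * nu - j) (S (M - j)) Hq ltac:(lia)).
  pose proof (pow_q_antitone q (2 * nu - j) (S (n - (M - j))) Hq ltac:(lia)); lra.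
- intros j Hj; destruct (Nat.leb_spec (M + j) n); [|lia].
  eapply Rle_trans; [apply (qbinom_scaled_bounds q n (M + j) Hq ltac:(lia))|].
  apply Rmult_le_compat_r; [lra|].
  pose proof (pow_q_antitone q (2 * nu - j) (S (M + j)) Hq ltac:(lia)).
  pose proof (pow_q_antitone q (2 * nu - j) (S (n - (M + j))) Hq ltac:(lia)); lra.
Qed.

(** * Perturbation of the theta argument *)

Lemma Cmod_theta_arg (q : R) (z : C) (a phi : R) :
  Cmod (theta_arg q z a phi) = Cmod z ^ 2 * Rpower q a.
Proof.
unfold theta_arg; rewrite Cmod_opp, !Cmod_mult, Cmod_pow, Cmod_R, Cmod_Cexp.
replace (Re (- (RtoC (2 * PI * phi) * Ci))%C) with 0 by (simpl; ring).
rewrite exp_0, Rabs_pos_eq by (left; apply exp_pos); ring.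
Qed.

Lemma theta_arg_neq_0 (q : R) (z : C) (a phi : R) : z <> 0 -> theta_arg q z a phi <> 0.
Proof.
intro Hz; apply Cmod_gt_0; rewrite Cmod_theta_arg; apply Cmod_gt_0 in Hz.
apply Rmult_lt_0_compat; [apply pow_lt; exact Hz|apply Rpower_pos].
Qed.

(** The exact argument is the limiting one times [e^u]: [a] changes the modulus, [b] the phase, and
    the integer [m] drops out by periodicity. *)
Lemma theta_arg_perturb (q : R) (z : C) (c a phi b : R) (m : Z) :
  theta_arg q z (c + a) (IZR m + phi + b)
  = (theta_arg q z c phi * Cexp (a * ln q, - (2 * PI * b))%R)%C.
Proof.
unfold theta_arg; rewrite !Cexp_opp.
replace (IZR m + phi + b) with (IZR m + (phi + b)) by ring.
rewrite Cexp_period, <- !Cexp_opp, Rpower_plus.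
assert (E : (RtoC (Rpower q a) * Cexp (- (RtoC (2 * PI * (phi + b)) * Ci)))%C
  = (Cexp (- (RtoC (2 * PI * phi) * Ci)) * Cexp (a * ln q, - (2 * PI * b))%R)%C).
{ unfold Rpower at 1; rewrite <- Cexp_RtoC, <- !Cexp_plus; f_equal.
  apply C_eq; simpl; ring. }
rewrite RtoC_mult.
transitivity (- (Cpow z 2 * RtoC (Rpower q c)
  * (RtoC (Rpower q a) * Cexp (- (RtoC (2 * PI * (phi + b)) * Ci)))))%C; [ring|].
rewrite E; ring.
Qed.

Lemma Cmod_Cexp_sub1_le (x y k : R) : Rabs x <= k -> Rabs y <= 8 * k -> k <= / 2 ->
  Cmod (Cexp (x, y) - 1) <= 10 * k.
Proof.
intros Hx Hy Hk; eapply Rle_trans; [apply Cmod_Cexp_sub1|]; simpl.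
pose proof (Rabs_exp_sub1 x ltac:(lra)); lra.
Qed.

Lemma pow_perturb (V u : C) (k : R) (nu : nat) :
  0 <= k <= / 2 -> INR nu * Rabs (Re u) <= k -> INR nu * Rabs (Im u) <= 8 * k ->
  forall j, (j <= nu)%nat ->
  Cmod (Cpow (V * Cexp u) j - Cpow V j) <= 10 * k * Cmod V ^ j.
Proof.
intros Hk Hx Hy j Hj; rewrite Cpow_mult_l, <- Cexp_nat.
replace (Cpow V j * Cexp (RtoC (INR j) * u) - Cpow V j)%C
  with ((Cexp (RtoC (INR j) * u) - 1) * Cpow V j)%C by ring.
rewrite Cmod_mult, Cmod_pow; apply Rmult_le_compat_r; [apply pow_le, Cmod_ge_0|].
replace (RtoC (INR j) * u)%C with (INR j * Re u, INR j * Im u)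
  by (destruct u; apply C_eq; simpl; ring).
apply le_INR in Hj; pose proof (pos_INR j).
apply Cmod_Cexp_sub1_le; [| |lra]; rewrite Rabs_mult, (Rabs_pos_eq (INR j)) by assumption.
- eapply Rle_trans; [|exact Hx]; apply Rmult_le_compat_r; [apply Rabs_pos|lra].
- eapply Rle_trans; [|exact Hy]; apply Rmult_le_compat_r; [apply Rabs_pos|lra].
Qed.

Lemma chi_01 (m : Z) : chi m = 0%Z \/ chi m = 1%Z.
Proof. unfold chi; pose proof (Z.div_mod m 2); pose proof (Z.mod_pos_bound m 2); lia. Qed.

(** Common core of the cases [-1 < tau < 0]; a rational parameter corresponds to [a = 0] or [b = 0].
    The number [k] is a joint budget for both Diophantine errors accumulated over [nu] powers. The
    phase [phi] is free modulo 1 relative to [n theta], so it may be [lambda1] or [n theta]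
    itself. *)
Lemma theta_case (q : R) (z : C) (tau theta : R) (n M nu : nat) (m m1 : Z)
    (beta1 beta2 a b phi k : R) :
  0 < q < 1 -> z <> 0 -> (5 <= nu)%nat -> (m / 2)%Z = Z.of_nat M ->
  (2 * nu <= M)%nat -> (M + 2 * nu < n)%nat ->
  - INR n * tau = IZR m + beta1 + a -> INR n * theta = IZR m1 + beta2 + b ->
  0 <= beta1 < 1 -> Rabs a <= / 2 -> 0 <= k <= / 2 ->
  INR nu * (Rabs a * ln (/ q)) <= k -> INR nu * Rabs b <= k ->
  Cexp (RtoC (2 * PI * phi) * Ci) = Cexp (RtoC (2 * PI * (INR n * theta)) * Ci) ->
  Cmod (h_at q z tau theta n / theta_prefactor q z tau theta n m phi
        - Theta q (theta_arg q z (IZR (chi m) + beta1) beta2))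
  <= (2 * q ^ nu / (1 - q) + 10 * k / q ^ 2 + 2 * (q ^ (nu * nu) * (Cmod z ^ 2) ^ nu)
      + 2 * (Rpower q (INR nu ^ 2 / 2) / (Cmod z ^ 2) ^ nu))
     * Re (Theta (sqrt q) (RtoC (Cmod z ^ 2))).
Proof.
intros Hq Hz Hnu HmM HM Hn Htau Htheta Hb1 Ha Hk Hka Hkb Hphi.
set (c := IZR (chi m) + beta1).
assert (Hc : 0 <= c <= 2) by (unfold c; destruct (chi_01 m) as [-> | ->]; lra).
(* Since [M] is the floor of [m / 2], the parity [chi m] is what remains of [m - 2 M]. *)
assert (Hcm : - INR n * tau - 2 * INR M = c + a).
{ unfold c, chi; rewrite minus_IZR, mult_IZR, HmM, <- INR_IZR_INZ; lra. }
pose proof (ln_q_neg q Hq) as Hlq.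
rewrite ln_Rinv in Hka by lra.
assert (Ha' : - / 2 <= a <= / 2).
{ pose proof (Rle_abs a); pose proof (Rle_abs (- a)) as H'; rewrite Rabs_Ropp in H'; lra. }
set (N := (n - S M)%nat).
assert (HnN : n = (M + S N)%nat) by (unfold N; lia).
pose proof (h_at_theta_expand q z tau theta M N m phi Hq Hz HmM) as He; cbv zeta in He.
rewrite <- HnN in He; specialize (He Hphi).
rewrite Hcm, Htheta, theta_arg_perturb in He.
set (W := theta_arg q z c beta2) in *.
set (u := (a * ln q, - (2 * PI * b))%R) in *.
assert (HW : W <> 0) by (apply theta_arg_neq_0; exact Hz).
assert (HWm : Cmod W = Cmod z ^ 2 * Rpower q c) by apply Cmod_theta_arg.
assert (HWm' : Cmod (W * Cexp u) = Cmod z ^ 2 * Rpower q (c + a)).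
{ rewrite Cmod_mult, Cmod_Cexp, HWm, Rpower_plus; unfold Rpower; simpl; ring. }
pose proof (theta_prefactor_neq_0 q z tau theta n m phi Hq Hz) as Hpf.
match goal with |- Cmod (?h / ?p - ?t) <= _ =>
  replace (h / p - t)%C with
  (CSeries (fun k => RtoC (theta_coef_pos q n M k * q ^ (k * k)) * Cpow (W * Cexp u) k)
        + CSeries (fun k => RtoC (theta_coef_neg q n M (S k) * q ^ (S k * S k))
                            * Cpow (/ (W * Cexp u)) (S k)) - t)%C end.
2:{ rewrite He; field; exact Hpf. }
destruct (theta_coef_bounds q n M nu Hq HM ltac:(lia)) as [H1 [H2 [H3 H4]]].
assert (Hre : INR nu * Rabs (Re u) <= k).
{ simpl; rewrite Rabs_mult, (Rabs_left (ln q)) by lra; exact Hka. }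
assert (Him : INR nu * Rabs (Im u) <= 8 * k).
{ simpl; rewrite Rabs_Ropp, !Rabs_mult, (Rabs_pos_eq 2), (Rabs_pos_eq PI)
    by (pose proof PI_RGT_0; lra).
  pose proof PI_4; pose proof PI_RGT_0.
  assert (0 <= INR nu * Rabs b) by (apply Rmult_le_pos; [apply pos_INR|apply Rabs_pos]).
  nra. }
apply (theta_approx q (Cmod z ^ 2) c (c + a)); try assumption; try lra.
- apply pow_lt, Cmod_gt_0, Hz.
- apply pow_perturb; assumption.
- replace (/ (W * Cexp u))%C with (/ W * Cexp (- u))%C.
  2:{ rewrite Cexp_opp; pose proof (Cexp_neq_0 u); field; split; assumption. }
  apply pow_perturb; [assumption| |].
  + change (Re (- u)%C) with (- Re u)%R; rewrite Rabs_Ropp; exact Hre.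
  + change (Im (- u)%C) with (- Im u)%R; rewrite Rabs_Ropp; exact Him.
Qed.

(** * Growth of the logarithmic cut-off *)

Lemma ln_INR_large (Y : R) : exists N0 : nat, forall n, (N0 < n)%nat -> Y <= ln (INR n).
Proof.
exists (Z.to_nat (up (exp Y))); intros n Hn.
rewrite <- (ln_exp Y); apply ln_le; [apply exp_pos|].
destruct (archimed (exp Y)) as [H _].
assert (IZR (up (exp Y)) <= INR n); [|lra].
rewrite INR_IZR_INZ; apply IZR_le; lia.
Qed.

(* [exp (rho y) = exp (rho y / 3)^3 >= (rho y / 3)^3] *)
Lemma sq_le_exp (rho eps : R) : 0 < rho -> 0 < eps ->
  exists Y, forall y, Y <= y -> y ^ 2 <= eps * exp (rho * y).
Proof.
intros Hr He; exists (Rmax 0 (27 / (eps * rho ^ 3))); intros y Hy.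
assert (H0 : 0 <= y) by (eapply Rle_trans; [apply Rmax_l|exact Hy]).
assert (H1 : 27 / (eps * rho ^ 3) <= y) by (eapply Rle_trans; [apply Rmax_r|exact Hy]).
assert (Hr3 : 0 < rho ^ 3) by (apply pow_lt; exact Hr).
assert (Her : 0 < eps * rho ^ 3) by (apply Rmult_lt_0_compat; assumption).
assert (H2 : 27 <= y * (eps * rho ^ 3)).
{ apply (Rmult_le_compat_r (eps * rho ^ 3)) in H1; [|lra].
  unfold Rdiv in H1; rewrite Rmult_assoc, Rinv_l in H1 by lra; lra. }
assert (H3 : (rho * y / 3) ^ 3 <= exp (rho * y)).
{ replace (rho * y) with (rho * y / 3 + (rho * y / 3 + rho * y / 3)) at 2 by field.
  rewrite !exp_plus; replace (exp (rho * y / 3) * (exp (rho * y / 3) * exp (rho * y / 3)))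
    with (exp (rho * y / 3) ^ 3) by ring.
  apply pow_incr; pose proof (exp_ineq1_le (rho * y / 3)).
  assert (0 <= rho * y) by nra; lra. }
apply Rle_trans with (eps * (rho * y / 3) ^ 3); [|apply Rmult_le_compat_l; lra].
replace (eps * (rho * y / 3) ^ 3) with (y ^ 2 * (y * (eps * rho ^ 3) / 27)) by field.
rewrite <- (Rmult_1_r (y ^ 2)) at 1; apply Rmult_le_compat_l; [apply pow2_ge_0|lra].
Qed.

(** All asymptotic requirements on the cut-off in one threshold. In terms of [y = log n] it is the
    floor of [kap y^2], so each requirement becomes a lower bound on [y]. *)
Lemma nu_log_eventually (q rho delta K : R) : 0 < q < 1 -> 0 < rho -> 0 < delta ->
  exists N0 : nat, forall n, (N0 < n)%nat -> exists nu : nat,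
    nu_log q n = Z.of_nat nu /\ K <= INR nu /\ INR nu <= delta * INR n /\
    INR nu * (1 + ln (/ q)) <= q ^ 4 * ln (INR n) ^ 2 /\
    0 <= ln (INR n) ^ 2 / Rpower (INR n) rho /\
    q ^ nu <= ln (INR n) ^ 2 / Rpower (INR n) rho /\
    q ^ 4 * (ln (INR n) ^ 2 / Rpower (INR n) rho) <= / 2.
Proof.
intros Hq Hrho Hdelta.
pose proof (ln_q_neg q Hq) as Hl.
assert (Hq4 : 0 < q ^ 4 <= 1) by (apply pow_q_le1; exact Hq).
set (L := ln (/ q)); assert (HL : L = - ln q) by (apply ln_Rinv; lra).
assert (HL0 : 0 < L) by lra.
set (kap := q ^ 4 / (1 + L)).
assert (Hkap : 0 < kap) by (apply Rdiv_lt_0_compat; lra).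
assert (Hkap1 : kap * (1 + L) = q ^ 4) by (unfold kap; field; lra).
destruct (sq_le_exp 1 delta ltac:(lra) Hdelta) as [Y1 HY1].
destruct (sq_le_exp rho (/ 2) Hrho ltac:(lra)) as [Y2 HY2].
(* [Y1] gives [y^2 <= delta n] and [Y2] gives [y^2 <= n^rho / 2]; the bound with [K] pays for the
   floor in [K <= nu]; the last one gives [L nu >= rho y], that is [q^nu <= n^(-rho)]. From [y >= 1]
   follow [y <= y^2] and the harmless factor [log^2 n]. *)
destruct (ln_INR_large (Rmax (Rmax Y1 Y2) (Rmax (Rmax 1 ((Rmax K 0 + 1) / kap))
   ((rho + L) / (L * kap))))) as [N0 HN0].
exists N0; intros n Hn; specialize (HN0 n Hn).
set (y := ln (INR n)) in *.
assert (Hn0 : 0 < INR n) by (apply lt_0_INR; lia).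
assert (Hy1 : Y1 <= y) by (eapply Rle_trans; [|exact HN0]; eapply Rle_trans; [apply Rmax_l|apply Rmax_l]).
assert (Hy2 : Y2 <= y) by (eapply Rle_trans; [|exact HN0]; eapply Rle_trans; [apply Rmax_r|apply Rmax_l]).
assert (Hy3 : 1 <= y).
{ eapply Rle_trans; [|exact HN0]; eapply Rle_trans; [|apply Rmax_r].
  eapply Rle_trans; [apply Rmax_l|apply Rmax_l]. }
assert (Hy4 : (Rmax K 0 + 1) / kap <= y).
{ eapply Rle_trans; [|exact HN0]; eapply Rle_trans; [|apply Rmax_r].
  eapply Rle_trans; [apply Rmax_r|apply Rmax_l]. }
assert (Hy5 : (rho + L) / (L * kap) <= y).
{ eapply Rle_trans; [|exact HN0]; eapply Rle_trans; [|apply Rmax_r]; apply Rmax_r. }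
assert (Hy4' : Rmax K 0 + 1 <= kap * y).
{ apply (Rmult_le_compat_l kap) in Hy4; [|lra].
  replace (kap * ((Rmax K 0 + 1) / kap)) with (Rmax K 0 + 1) in Hy4 by (field; lra); exact Hy4. }
assert (Hy5' : rho + L <= L * kap * y).
{ apply (Rmult_le_compat_l (L * kap)) in Hy5; [|nra].
  replace (L * kap * ((rho + L) / (L * kap))) with (rho + L) in Hy5 by (field; split; lra); exact Hy5. }
assert (Hnl : nu_log q n = Int_part (kap * y ^ 2)).
{ unfold nu_log; fold L y; f_equal; unfold kap; field; lra. }
destruct (base_Int_part (kap * y ^ 2)) as [Hi1 Hi2]; rewrite <- Hnl in Hi1, Hi2.
assert (Hyy : y <= y ^ 2) by nra.
assert (Hky : kap * y <= kap * y ^ 2) by (apply Rmult_le_compat_l; lra).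
assert (HK : K <= Rmax K 0) by apply Rmax_l.
assert (HK0 : 0 <= Rmax K 0) by apply Rmax_r.
assert (Hpos : (0 <= nu_log q n)%Z).
{ apply le_IZR; lra. }
exists (Z.to_nat (nu_log q n)).
assert (Hnu : INR (Z.to_nat (nu_log q n)) = IZR (nu_log q n))
  by (rewrite INR_IZR_INZ, Z2Nat.id by exact Hpos; reflexivity).
assert (Hexp : exp y = INR n) by (apply exp_ln; exact Hn0).
assert (HRn : Rpower (INR n) rho = exp (rho * y)) by reflexivity.
assert (HRp : 0 < Rpower (INR n) rho) by apply Rpower_pos.
specialize (HY1 y Hy1); specialize (HY2 y Hy2).
rewrite Rmult_1_l, Hexp in HY1; rewrite <- HRn in HY2.
assert (Hk1 : kap <= 1) by nra.
assert (Hyr : 0 <= y ^ 2 / Rpower (INR n) rho).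
{ apply Rmult_le_pos; [apply pow2_ge_0|left; apply Rinv_0_lt_compat; exact HRp]. }
rewrite Hnu; repeat split.
- rewrite Z2Nat.id by exact Hpos; reflexivity.
- lra.
- nra.
- apply Rle_trans with (kap * y ^ 2 * (1 + L)); [apply Rmult_le_compat_r; lra|].
  right; rewrite <- Hkap1; ring.
- exact Hyr.
- rewrite <- Rpower_pow, Hnu by lra; unfold Rdiv; rewrite <- Rpower_Ropp.
  apply Rle_trans with (1 * Rpower (INR n) (- rho)).
  + rewrite Rmult_1_l; unfold Rpower; fold y.
    assert (Hm : forall s t, s <= t -> exp s <= exp t).
    { intros s t [H|H]; [left; apply exp_increasing; exact H|subst; lra]. }
    apply Hm.
    assert (L * (kap * y ^ 2 - 1) <= L * IZR (nu_log q n)) by (apply Rmult_le_compat_l; lra).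
    assert (rho * y + L <= L * kap * y * y) by nra.
    replace (IZR (nu_log q n) * ln q) with (- (L * IZR (nu_log q n))) by (rewrite HL; ring).
    nra.
  + apply Rmult_le_compat_r; [left; apply Rpower_pos|nra].
- assert (y ^ 2 / Rpower (INR n) rho <= / 2).
  { apply Rmult_le_reg_r with (Rpower (INR n) rho); [exact HRp|].
    unfold Rdiv; rewrite Rmult_assoc, Rinv_l by lra; lra. }
  nra.
Qed.

(** * Error bounds *)

Lemma Re_Theta_nonneg (q x : R) : 0 < q < 1 -> 0 < x -> 0 <= Re (Theta q (RtoC x)).
Proof.
intros Hq Hx; rewrite Re_Theta by exact Hx.
assert (Hi : 0 < / x) by (apply Rinv_0_lt_compat; exact Hx).
apply Rplus_le_le_0_compat; apply Series_nonneg.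
- intro k; apply Rmult_le_pos; apply pow_le; lra.
- apply ex_series_gauss; assumption.
- intro k; apply Rmult_le_pos; apply pow_le; lra.
- apply (ex_series_offset (fun k => q ^ (k * k) * (/ x) ^ k) 1), ex_series_gauss; assumption.
Qed.

Lemma Re_Bq_nonneg (q x : R) : 0 < q < 1 -> 0 < x -> 0 <= Re (Bq q (RtoC x)).
Proof.
intros Hq Hx; rewrite Re_Bq; apply Series_nonneg.
- intro k; left; apply Bq_term_pos; assumption.
- apply ex_series_Bq; assumption.
Qed.

(** The stated constant must dominate three different factors: [1 / (1 - q)] from the coefficients,
    [1 / (q;q)_oo] from the tail, and 1 from the Diophantine error. *)
Lemma Aq_const_ge (q : R) : 0 < q < 1 ->
  / (1 - q) <= qpoch_inf (- q ^ 3) q / ((1 - q) * qpoch_inf q q) /\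
  / qpoch_inf q q <= qpoch_inf (- q ^ 3) q / ((1 - q) * qpoch_inf q q) /\
  1 <= qpoch_inf (- q ^ 3) q / ((1 - q) * qpoch_inf q q).
Proof.
intro Hq; pose proof (qpoch_neg_ge1 q Hq) as HP.
pose proof (qpoch_inf_qq_pos q Hq) as H0; pose proof (qpoch_inf_qq_le q 0 Hq) as H1.
cbn [qpoch] in H1; unfold Rdiv; rewrite Rinv_mult.
assert (Ha : 1 <= / (1 - q)) by (rewrite <- Rinv_1; apply Rinv_le_contravar; lra).
assert (Hb : 1 <= / qpoch_inf q q) by (rewrite <- Rinv_1; apply Rinv_le_contravar; lra).
set (x := / (1 - q)) in *; set (y := / qpoch_inf q q) in *.
assert (Hxy : x <= x * y /\ y <= x * y) by (split; nra).
assert (x * y <= qpoch_inf (- q ^ 3) q * (x * y)).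
{ rewrite <- (Rmult_1_l (x * y)) at 1; apply Rmult_le_compat_r; lra. }
repeat split; lra.
Qed.

Lemma theta_const_ge (q : R) : 0 < q < 1 ->
  / (1 - q) <= qpoch_inf (- q ^ 3) q ^ 2 / ((1 - q) ^ 2 * qpoch_inf q q) /\
  1 <= qpoch_inf (- q ^ 3) q ^ 2 / ((1 - q) ^ 2 * qpoch_inf q q).
Proof.
intro Hq; destruct (Aq_const_ge q Hq) as [H1 [_ H2]].
pose proof (qpoch_neg_ge1 q Hq) as HP; pose proof (qpoch_inf_qq_pos q Hq) as H0.
assert (Ha : 1 <= / (1 - q)) by (rewrite <- Rinv_1; apply Rinv_le_contravar; lra).
replace (qpoch_inf (- q ^ 3) q ^ 2 / ((1 - q) ^ 2 * qpoch_inf q q))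
  with (qpoch_inf (- q ^ 3) q / ((1 - q) * qpoch_inf q q)
        * (qpoch_inf (- q ^ 3) q * / (1 - q))) by (field; lra).
set (K := qpoch_inf (- q ^ 3) q / ((1 - q) * qpoch_inf q q)) in *.
assert (1 <= qpoch_inf (- q ^ 3) q * / (1 - q)) by nra.
split; nra.
Qed.

Lemma powerRZ_double (x : R) (nu : nat) : powerRZ x (2 * Z.of_nat nu) = (x ^ 2) ^ nu.
Proof.
replace (2 * Z.of_nat nu)%Z with (Z.of_nat (2 * nu)) by lia.
rewrite <- pow_powerRZ; apply pow_mult.
Qed.

Lemma powerRZ_square (x : R) (nu : nat) :
  powerRZ x (Z.of_nat nu * Z.of_nat nu) = x ^ (nu * nu).
Proof. rewrite <- Nat2Z.inj_mul, <- pow_powerRZ; reflexivity. Qed.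

Lemma Rpower_half_square (q : R) (nu : nat) :
  Rpower q (IZR (Z.of_nat nu * Z.of_nat nu) / 2) = Rpower q (INR nu ^ 2 / 2).
Proof. f_equal; rewrite mult_IZR, <- INR_IZR_INZ; field. Qed.

Lemma half_index (m : Z) : (0 <= m)%Z ->
  exists M : nat, (m / 2)%Z = Z.of_nat M /\ IZR m - 1 <= 2 * INR M <= IZR m.
Proof.
intro Hm; exists (Z.to_nat (m / 2)).
pose proof (Z.div_mod m 2); pose proof (Z.mod_pos_bound m 2).
rewrite INR_IZR_INZ, Z2Nat.id by lia; split; [reflexivity|].
rewrite <- mult_IZR, <- minus_IZR; split; apply IZR_le; lia.
Qed.

(** Here the budget [k] is [q^4 log^2 n / n^rho], and the same threshold serves every admissible
    pair of shifts. *)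
Lemma theta_case_log (q : R) (z : C) (tau theta rho : R) :
  0 < q < 1 -> z <> 0 -> -1 < tau < 0 -> 0 < rho ->
  exists N0 : nat, forall (n : nat) (m m1 : Z) (beta1 beta2 a b phi : R),
    (N0 < n)%nat ->
    - INR n * tau = IZR m + beta1 + a -> INR n * theta = IZR m1 + beta2 + b ->
    0 <= beta1 < 1 ->
    Rabs a <= Rpower (INR n) (- rho) -> Rabs b <= Rpower (INR n) (- rho) ->
    Cexp (RtoC (2 * PI * phi) * Ci) = Cexp (RtoC (2 * PI * (INR n * theta)) * Ci) ->
    Cmod (h_at q z tau theta n / theta_prefactor q z tau theta n m phi
          - Theta q (theta_arg q z (IZR (chi m) + beta1) beta2))
    <= bound62 q z rho n.
Proof.
intros Hq Hz Htau Hrho.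
(* The peak [M] is about [- tau n / 2]. The divisor 8 makes [nu] small enough for the margins [2 nu]
   around [M], with room for the shift, the floor and [a]. *)
set (delta := Rmin (- tau) (1 + tau) / 8).
assert (Hd : 0 < delta /\ 8 * delta <= - tau /\ 8 * delta <= 1 + tau).
{ unfold delta; pose proof (Rmin_l (- tau) (1 + tau)); pose proof (Rmin_r (- tau) (1 + tau)).
  assert (0 < Rmin (- tau) (1 + tau)) by (apply Rmin_glb_lt; lra); lra. }
destruct Hd as [Hd0 [Hd1 Hd2]].
destruct (nu_log_eventually q rho delta 5 Hq Hrho Hd0) as [N0 HN].
exists N0; intros n m m1 beta1 beta2 a b phi Hn Ht Hth Hb1 Ha Hb Hphi.
destruct (HN n Hn) as [nu [Hnu [H5 [Hdn [Hlog [HL0 [Hqnu Hk]]]]]]].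
set (Lg := ln (INR n) ^ 2 / Rpower (INR n) rho) in *.
pose proof (ln_q_neg q Hq) as Hlq.
assert (HR : ln (/ q) = - ln q) by (apply ln_Rinv; lra).
set (e := Rpower (INR n) (- rho)) in *.
assert (He0 : 0 < e) by apply Rpower_pos.
(* The definition of [nu_log] is used here: the factor [1 + log (1/q)] exceeds both [log (1/q)],
   needed for [a], and 1, needed for [b]. *)
assert (Hke : INR nu * (1 + ln (/ q)) * e <= q ^ 4 * Lg).
{ replace (q ^ 4 * Lg) with (q ^ 4 * ln (INR n) ^ 2 * e)
    by (unfold Lg, e; rewrite Rpower_Ropp; unfold Rdiv; ring).
  apply Rmult_le_compat_r; lra. }
assert (Hnu5 : (5 <= nu)%nat) by (apply INR_le; simpl; lra).
assert (Hen : 5 * e <= INR nu * (1 + ln (/ q)) * e).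
{ apply Rmult_le_compat_r; [lra|]; nra. }
assert (Ha2 : Rabs a <= / 2) by lra.
assert (Ha' : - / 2 <= a <= / 2).
{ pose proof (Rle_abs a); pose proof (Rle_abs (- a)) as H'; rewrite Rabs_Ropp in H'; lra. }
assert (Hnt : 8 * (delta * INR n) <= - INR n * tau /\ 8 * (delta * INR n) <= INR n * (1 + tau)).
{ pose proof (pos_INR n); split; nra. }
assert (Hm0 : (0 <= m)%Z) by (apply le_IZR; lra).
destruct (half_index m Hm0) as [M [HM [HM1 HM2]]].
assert (HMnu : (2 * nu <= M)%nat).
{ apply INR_le; rewrite mult_INR; simpl (INR 2); lra. }
assert (HMn : (M + 2 * nu < n)%nat).
{ apply INR_lt; rewrite plus_INR, mult_INR; simpl (INR 2); lra. }
assert (Hkk : 0 <= q ^ 4 * Lg <= / 2).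
{ split; [|exact Hk]; apply Rmult_le_pos; [apply pow_le; lra|exact HL0]. }
assert (Hn0 : 0 <= INR nu) by apply pos_INR.
assert (Hka : INR nu * (Rabs a * ln (/ q)) <= q ^ 4 * Lg).
{ eapply Rle_trans; [|exact Hke]; rewrite Rmult_assoc.
  apply Rmult_le_compat_l; [exact Hn0|]; nra. }
assert (Hkb : INR nu * Rabs b <= q ^ 4 * Lg).
{ eapply Rle_trans; [|exact Hke]; rewrite Rmult_assoc.
  apply Rmult_le_compat_l; [exact Hn0|]; nra. }
eapply Rle_trans; [apply (theta_case q z tau theta n M nu m m1 beta1 beta2 a b phi
  (q ^ 4 * Lg)); assumption|].
unfold bound62; cbv zeta; fold Lg.
rewrite Hnu, powerRZ_double, powerRZ_square, Rpower_half_square.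
destruct (theta_const_ge q Hq) as [HK1 HK2].
apply Cmod_gt_0 in Hz.
set (r := Cmod z ^ 2); assert (Hr : 0 < r) by (apply pow_lt; exact Hz).
pose proof (Re_Theta_nonneg (sqrt q) r (sqrt_q_bounds q Hq) Hr) as HT.
set (Th := Re (Theta (sqrt q) (RtoC r))) in *.
set (K := qpoch_inf (- q ^ 3) q ^ 2 / ((1 - q) ^ 2 * qpoch_inf q q)) in *.
replace (62 * qpoch_inf (- q ^ 3) q ^ 2 * Th / ((1 - q) ^ 2 * qpoch_inf q q))
  with (62 * K * Th) by (unfold K, Rdiv; ring).
assert (Hrn : 0 < r ^ nu) by (apply pow_lt; exact Hr).
assert (HA : 0 <= q ^ (nu * nu) * r ^ nu)
  by (apply Rmult_le_pos; [apply pow_le; lra|lra]).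
assert (HB : 0 <= Rpower q (INR nu ^ 2 / 2) / r ^ nu).
{ apply Rmult_le_pos; [left; apply Rpower_pos|left; apply Rinv_0_lt_compat; exact Hrn]. }
rewrite (Rmult_comm (r ^ nu)).
set (U := q ^ (nu * nu) * r ^ nu) in *.
set (V := Rpower q (INR nu ^ 2 / 2) / r ^ nu) in *.
replace (62 * K * Th * (U + V + Lg)) with (62 * K * (U + V + Lg) * Th) by ring.
apply Rmult_le_compat_r; [exact HT|].
(* The [q^4] of the cut-off absorbs the [q^(-2)] lost in completing the square. *)
assert (Hq2 : 10 * (q ^ 4 * Lg) / q ^ 2 <= 10 * Lg).
{ replace (10 * (q ^ 4 * Lg) / q ^ 2) with (q ^ 2 * (10 * Lg)) by (field; lra).
  pose proof (pow_q_le1 q 2 Hq); nra. }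
assert (Hqn : 2 * q ^ nu / (1 - q) <= 2 * (Lg * K)).
{ unfold Rdiv; rewrite Rmult_assoc; apply Rmult_le_compat_l; [lra|].
  apply Rmult_le_compat; [apply pow_le; lra|left; apply Rinv_0_lt_compat; lra|exact Hqnu|exact HK1]. }
nra.
Qed.

Lemma theta_case_min (q : R) (z : C) (tau theta : R) :
  0 < q < 1 -> z <> 0 -> -1 < tau < 0 ->
  exists N0 : nat, forall (n : nat) (m m1 : Z) (lambda lambda1 : R),
    (N0 < n)%nat ->
    - INR n * tau = IZR m + lambda -> INR n * theta = IZR m1 + lambda1 ->
    0 <= lambda < 1 ->
    Cmod (h_at q z tau theta n / theta_prefactor q z tau theta n m lambda1
          - Theta q (theta_arg q z (IZR (chi m) + lambda) lambda1))
    <= 14 * qpoch_inf (- q ^ 3) q ^ 2 * Re (Theta (sqrt q) (RtoC (Cmod z ^ 2)))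
       / ((1 - q) ^ 2 * qpoch_inf q q)
       * (powerRZ q (nu_min tau n)
          + powerRZ q (nu_min tau n * nu_min tau n) * powerRZ (Cmod z) (2 * nu_min tau n)
          + Rpower q (IZR (nu_min tau n * nu_min tau n) / 2)
            / powerRZ (Cmod z) (2 * nu_min tau n)).
Proof.
intros Hq Hz Htau.
set (delta := Rmin (- tau) (1 + tau)).
assert (Hd : 0 < delta /\ delta <= - tau /\ delta <= 1 + tau).
{ unfold delta; pose proof (Rmin_l (- tau) (1 + tau)); pose proof (Rmin_r (- tau) (1 + tau)).
  assert (0 < Rmin (- tau) (1 + tau)) by (apply Rmin_glb_lt; lra); lra. }
destruct Hd as [Hd0 [Hd1 Hd2]].
(* [delta n >= 24] makes both quarters at least 6, so that [nu >= 5] after taking floors. *)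
exists (Z.to_nat (up (24 / delta))); intros n m m1 lambda lambda1 Hn Ht Hth Hl.
assert (Hn24 : 24 <= delta * INR n).
{ destruct (archimed (24 / delta)) as [H _].
  assert (Hup : IZR (up (24 / delta)) <= INR n) by (rewrite INR_IZR_INZ; apply IZR_le; lia).
  assert (H24 : 24 / delta <= INR n) by lra.
  apply (Rmult_le_compat_l delta) in H24; [|lra].
  replace (delta * (24 / delta)) with 24 in H24 by (field; lra); exact H24. }
pose proof (pos_INR n) as Hn0.
assert (Hnt : delta * INR n <= - tau * INR n /\ delta * INR n <= (1 + tau) * INR n)
  by (split; apply Rmult_le_compat_r; lra).
set (i1 := Int_part ((1 + tau) * INR n / 4)); set (i2 := Int_part (- tau * INR n / 4)).
destruct (base_Int_part ((1 + tau) * INR n / 4)) as [H11 H12].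
destruct (base_Int_part (- tau * INR n / 4)) as [H21 H22].
fold i1 in H11, H12; fold i2 in H21, H22.
assert (Hi1 : (5 <= i1)%Z) by (apply le_IZR; lra).
assert (Hi2 : (5 <= i2)%Z) by (apply le_IZR; lra).
set (nu := Z.to_nat (nu_min tau n)).
assert (Hnu : nu_min tau n = Z.of_nat nu)
  by (unfold nu, nu_min; fold i1 i2; rewrite Z2Nat.id; lia).
assert (Hnu5 : (5 <= nu)%nat) by (unfold nu, nu_min; fold i1 i2; lia).
assert (Hnu1 : INR nu <= IZR i1).
{ rewrite INR_IZR_INZ, <- Hnu; apply IZR_le; unfold nu_min; fold i1 i2; lia. }
assert (Hnu2 : INR nu <= IZR i2).
{ rewrite INR_IZR_INZ, <- Hnu; apply IZR_le; unfold nu_min; fold i1 i2; lia. }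
assert (Hm0 : (0 <= m)%Z) by (apply le_IZR; lra).
destruct (half_index m Hm0) as [M [HM [HM1 HM2]]].
(* The fractional part and the halving together cost less than 1, so only [2 nu < M + 1] comes out
   over the reals; integrality does the rest. *)
assert (HMnu : (2 * nu <= M)%nat).
{ apply Nat.lt_succ_r, INR_lt; rewrite S_INR, mult_INR; simpl (INR 2); lra. }
assert (HMn : (M + 2 * nu < n)%nat).
{ apply INR_lt; rewrite plus_INR, mult_INR; simpl (INR 2); lra. }
assert (Hphi : Cexp (RtoC (2 * PI * lambda1) * Ci)
  = Cexp (RtoC (2 * PI * (INR n * theta)) * Ci)) by (rewrite Hth, Cexp_period; reflexivity).
(* Both splittings are exact, so both errors and the budget are 0. *)
eapply Rle_trans; [apply (theta_case q z tau theta n M nu m m1 lambda lambda1 0 0 lambda1 0);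
  try assumption; try rewrite Rabs_R0; lra|].
rewrite Hnu, powerRZ_double, powerRZ_square, Rpower_half_square, <- pow_powerRZ.
destruct (theta_const_ge q Hq) as [HK1 HK2].
apply Cmod_gt_0 in Hz.
set (r := Cmod z ^ 2); assert (Hr : 0 < r) by (apply pow_lt; exact Hz).
pose proof (Re_Theta_nonneg (sqrt q) r (sqrt_q_bounds q Hq) Hr) as HT.
set (Th := Re (Theta (sqrt q) (RtoC r))) in *.
set (K := qpoch_inf (- q ^ 3) q ^ 2 / ((1 - q) ^ 2 * qpoch_inf q q)) in *.
replace (14 * qpoch_inf (- q ^ 3) q ^ 2 * Th / ((1 - q) ^ 2 * qpoch_inf q q))
  with (14 * K * Th) by (unfold K, Rdiv; ring).
assert (Hrn : 0 < r ^ nu) by (apply pow_lt; exact Hr).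
assert (HA : 0 <= q ^ (nu * nu) * r ^ nu)
  by (apply Rmult_le_pos; [apply pow_le; lra|lra]).
assert (HB : 0 <= Rpower q (INR nu ^ 2 / 2) / r ^ nu).
{ apply Rmult_le_pos; [left; apply Rpower_pos|left; apply Rinv_0_lt_compat; exact Hrn]. }
set (U := q ^ (nu * nu) * r ^ nu) in *.
set (V := Rpower q (INR nu ^ 2 / 2) / r ^ nu) in *.
assert (Hp : 0 <= q ^ nu) by (apply pow_le; lra).
replace (14 * K * Th * (q ^ nu + U + V)) with (14 * K * (q ^ nu + U + V) * Th) by ring.
apply Rmult_le_compat_r; [exact HT|].
assert (Hqn : 2 * q ^ nu / (1 - q) <= 2 * (q ^ nu * K)).
{ unfold Rdiv; rewrite Rmult_assoc; apply Rmult_le_compat_l; [lra|].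
  apply Rmult_le_compat_l; [exact Hp|exact HK1]. }
replace (10 * 0 / q ^ 2) with 0 by (unfold Rdiv; ring).
nra.
Qed.

Lemma qpow_norm0 (q : R) (z : C) (theta : R) (n : nat) : 0 < q < 1 ->
  (Cpow z n * qpow q (- (RtoC (INR n ^ 2) * im_s q 0 theta)))%C = norm0 q z theta n.
Proof.
intro Hq; unfold norm0; rewrite <- Cmult_assoc; f_equal.
unfold qpow, Rpower; rewrite <- Cexp_RtoC, <- Cexp_plus; f_equal.
pose proof (ln_q_neg q Hq); unfold im_s; apply C_eq; simpl; field; lra.
Qed.

Lemma norm0_neq_0 (q : R) (z : C) (theta : R) (n : nat) : z <> 0 -> norm0 q z theta n <> 0.
Proof.
intro Hz; apply Cmult_neq_0; [|apply Cexp_neq_0].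
apply Cmult_neq_0; [apply Cpow_nz; exact Hz|apply RtoC_neq_0, Rgt_not_eq, Rpower_pos].
Qed.

Lemma Cmult_div_cancel (a b : C) : a <> 0 -> (a * b / a)%C = b.
Proof. intro H; field; exact H. Qed.

(** At [tau = 0] the summation variable [X] lies on the circle of radius [|z|^(-2)] and differs from
    its limit [-w] by the phase [2 pi b] alone. *)
Lemma Aq_case (q : R) (z : C) (theta beta b k : R) (n nu : nat) (m : Z) :
  0 < q < 1 -> z <> 0 -> (nu <= n)%nat -> INR n * theta = IZR m + beta + b ->
  0 <= k <= / 2 -> INR nu * Rabs b <= k ->
  Cmod (h_at q z 0 theta n / norm0 q z theta n
        - Aq q (Cexp (RtoC (2 * PI * beta) * Ci) / Cpow z 2))
  <= (q ^ (n - nu) / (1 - q) + 10 * k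
      + 2 * (q ^ (S nu * S nu) * (/ Cmod z ^ 2) ^ S nu) / qpoch_inf q q)
     * Re (Bq q (RtoC (/ Cmod z ^ 2))).
Proof.
intros Hq Hz Hnu Hth Hk Hkb.
pose proof (norm0_neq_0 q z theta n Hz) as Hn0.
rewrite (h_at_expand q z 0 theta n Hq Hz), (qpow_norm0 q z theta n Hq).
set (X := im_arg q z 0 theta n).
rewrite (Cmult_div_cancel _ _ Hn0).
set (w := (Cexp (RtoC (2 * PI * beta) * Ci) / Cpow z 2)%C).
assert (Hzp : 0 < Cmod z ^ 2) by (apply pow_lt, Cmod_gt_0, Hz).
assert (HX : Cmod X = / Cmod z ^ 2).
{ unfold X; rewrite Cmod_im_arg, Rmult_0_r, Rpower_O by first [exact Hz|lra].
  unfold Rdiv; ring. }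
assert (Hw : Cmod w = / Cmod z ^ 2).
{ unfold w; rewrite Cmod_div, Cmod_Cexp, Cmod_pow by (apply Cpow_nz; exact Hz).
  replace (Re (RtoC (2 * PI * beta) * Ci)%C) with 0 by (simpl; ring).
  rewrite exp_0; unfold Rdiv; ring. }
assert (HXw : X = (- w * Cexp (0, (2 * PI * b)%R))%C).
{ unfold X, w, im_arg; rewrite Hth, Rmult_0_r, Rpower_O by lra.
  replace (IZR m + beta + b) with (IZR m + (beta + b)) by ring.
  rewrite Cexp_period.
  assert (E : Cexp (RtoC (2 * PI * (beta + b)) * Ci)
    = (Cexp (RtoC (2 * PI * beta) * Ci) * Cexp (0, (2 * PI * b)%R))%C).
  { rewrite <- Cexp_plus; f_equal; apply C_eq; simpl; ring. }
  rewrite E; field; exact Hz. }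
apply Aq_approx; try assumption; try lra.
- apply Rinv_0_lt_compat; exact Hzp.
- rewrite HXw, <- Hw, <- (Cmod_opp w); apply pow_perturb; [lra| |].
  + simpl; rewrite Rabs_R0; lra.
  + simpl; rewrite !Rabs_mult, (Rabs_pos_eq 2), (Rabs_pos_eq PI)
      by (pose proof PI_RGT_0; lra).
    pose proof PI_4; pose proof PI_RGT_0.
    assert (0 <= INR nu * Rabs b) by (apply Rmult_le_pos; [apply pos_INR|apply Rabs_pos]).
    nra.
Qed.

Lemma pow_eventually_le (q x : R) : 0 < q < 1 -> 0 < x ->
  exists N : nat, forall n, (N <= n)%nat -> q ^ n <= x.
Proof.
intros Hq Hx; destruct (pow_lt_1_zero q ltac:(rewrite Rabs_pos_eq; lra) x Hx) as [N HN].
exists N; intros n Hn; specialize (HN n Hn).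
rewrite Rabs_pos_eq in HN by (apply pow_le; lra); lra.
Qed.

Lemma Aq_case_half (q : R) (z : C) (theta : R) : 0 < q < 1 -> z <> 0 ->
  exists N0 : nat, forall (n : nat) (m : Z) (lambda : R), (N0 < n)%nat ->
    INR n * theta = IZR m + lambda ->
    Cmod (h_at q z 0 theta n / norm0 q z theta n
          - Aq q (Cexp (RtoC (2 * PI * lambda) * Ci) / Cpow z 2))
    <= 3 * qpoch_inf (- q ^ 3) q * Re (Bq q (RtoC (/ Cmod z ^ 2)))
       / ((1 - q) * qpoch_inf q q)
       * (Rpower q (INR n / 2) + Rpower q (INR n ^ 2 / 4) / Cmod z ^ (2 * (n / 2))).
Proof.
intros Hq Hz.
assert (Hr : 0 < Cmod z ^ 2) by (apply pow_lt, Cmod_gt_0, Hz).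
(* The tail starts at [nu + 1], while the claim has [|z|^(-2 nu)]. The surplus factor [|z|^(-2)] is
   absorbed by [q^nu <= |z|^2]. *)
destruct (pow_eventually_le q (Cmod z ^ 2) Hq Hr) as [N HN].
exists (2 * N)%nat; intros n m lambda Hn Hth.
set (nu := (n / 2)%nat).
pose proof (Nat.div_mod_eq n 2) as Hdiv; pose proof (Nat.mod_upper_bound n 2 ltac:(lia)) as Hmod.
fold nu in Hdiv.
eapply Rle_trans; [apply (Aq_case q z theta lambda 0 0 n nu m); try assumption;
  try rewrite Rabs_R0; try lra; lia|].
pose proof (Re_Bq_nonneg q (/ Cmod z ^ 2) Hq (Rinv_0_lt_compat _ Hr)) as HB.
set (B := Re (Bq q (RtoC (/ Cmod z ^ 2)))) in *.
destruct (Aq_const_ge q Hq) as [HK1 [HK2 HK3]].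
set (K := qpoch_inf (- q ^ 3) q / ((1 - q) * qpoch_inf q q)) in *.
replace (3 * qpoch_inf (- q ^ 3) q * B / ((1 - q) * qpoch_inf q q))
  with (3 * K * B) by (unfold K, Rdiv; ring).
rewrite (pow_mult (Cmod z)); set (r := Cmod z ^ 2) in *.
assert (Hrn : 0 < r ^ nu) by (apply pow_lt; exact Hr).
assert (H2 : 2 * INR nu <= INR n <= 2 * INR nu + 1).
{ split.
  - replace (2 * INR nu) with (INR (2 * nu)) by (rewrite mult_INR; simpl; ring).
    apply le_INR; lia.
  - replace (2 * INR nu + 1) with (INR (2 * nu + 1)) by (rewrite plus_INR, mult_INR; simpl; ring).
    apply le_INR; lia. }
assert (Hu : q ^ (n - nu) <= Rpower q (INR n / 2)).
{ rewrite <- Rpower_pow, minus_INR by (lra || lia).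
  apply Rpower_antitone; [exact Hq|lra]. }
assert (Hv : q ^ (S nu * S nu) * (/ r) ^ S nu <= Rpower q (INR n ^ 2 / 4) / r ^ nu).
{ assert (Hqr : q ^ nu <= r) by (apply HN; lia).
  (* From [n <= 2 nu + 1] one has [n^2 / 4 <= nu^2 + nu + 1/4], which leaves a spare [nu] in
     [(nu + 1)^2]. *)
  assert (Hs : q ^ (S nu * S nu) <= Rpower q (INR n ^ 2 / 4) * q ^ nu).
  { rewrite <- (Rpower_pow (S nu * S nu)), <- (Rpower_pow nu), <- Rpower_plus by lra.
    apply Rpower_antitone; [exact Hq|].
    rewrite mult_INR, S_INR; pose proof (pos_INR nu); pose proof (pos_INR n); nra. }
  pose proof (Rpower_pos q (INR n ^ 2 / 4)) as Hp.
  rewrite pow_inv; simpl pow at 2; rewrite Rinv_mult.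
  apply Rle_trans with (Rpower q (INR n ^ 2 / 4) * r * (/ r * / r ^ nu)).
  - apply Rmult_le_compat_r.
    + left; apply Rmult_lt_0_compat; apply Rinv_0_lt_compat; assumption.
    + eapply Rle_trans; [exact Hs|]; apply Rmult_le_compat_l; lra.
  - right; field; lra. }
set (u := Rpower q (INR n / 2)) in *; set (v := Rpower q (INR n ^ 2 / 4) / r ^ nu) in *.
set (v' := q ^ (S nu * S nu) * (/ r) ^ S nu) in *.
assert (Hv0 : 0 <= v').
{ apply Rmult_le_pos; apply pow_le; [lra|left; apply Rinv_0_lt_compat; exact Hr]. }
replace (3 * K * B * (u + v)) with (3 * K * (u + v) * B) by ring.
apply Rmult_le_compat_r; [exact HB|].
assert (Hc1 : q ^ (n - nu) / (1 - q) <= u * K).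
{ apply Rmult_le_compat; [apply pow_le; lra|left; apply Rinv_0_lt_compat; lra|exact Hu|exact HK1]. }
assert (Hc2 : 2 * v' / qpoch_inf q q <= 2 * (v * K)).
{ unfold Rdiv; rewrite Rmult_assoc; apply Rmult_le_compat_l; [lra|].
  apply Rmult_le_compat; [exact Hv0| |exact Hv|exact HK2].
  left; apply Rinv_0_lt_compat, qpoch_inf_qq_pos, Hq. }
assert (0 <= u) by (left; apply Rpower_pos).
assert (0 <= v) by lra.
nra.
Qed.

Lemma Aq_case_log (q : R) (z : C) (theta rho : R) : 0 < q < 1 -> z <> 0 -> 0 < rho ->
  exists N0 : nat, forall (n : nat) (m : Z) (beta b : R), (N0 < n)%nat ->
    INR n * theta = IZR m + beta + b -> Rabs b <= Rpower (INR n) (- rho) ->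
    Cmod (h_at q z 0 theta n / norm0 q z theta n
          - Aq q (Cexp (RtoC (2 * PI * beta) * Ci) / Cpow z 2))
    <= 48 * qpoch_inf (- q ^ 3) q * Re (Bq q (RtoC (/ Cmod z ^ 2)))
       / ((1 - q) * qpoch_inf q q)
       * (ln (INR n) ^ 2 / Rpower (INR n) rho
          + powerRZ q (nu_log q n * nu_log q n) / powerRZ (Cmod z) (2 * nu_log q n)).
Proof.
intros Hq Hz Hrho.
assert (Hr : 0 < Cmod z ^ 2) by (apply pow_lt, Cmod_gt_0, Hz).
destruct (pow_eventually_le q (Cmod z ^ 2) Hq Hr) as [N HN].
(* [nu >= N] makes [q^nu <= |z|^2], which absorbs the extra [|z|^(-2)] of the tail; [nu <= n / 2]
   gives [q^(n - nu) <= q^nu]. *)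
destruct (nu_log_eventually q rho (/ 2) (INR N) Hq Hrho ltac:(lra)) as [N0 HN0].
exists N0; intros n m beta b Hn Hth Hb.
destruct (HN0 n Hn) as [nu [Hnu [HNn [Hdn [Hlog [HL0 [Hqnu Hk]]]]]]].
apply INR_le in HNn.
assert (H2 : (2 * nu <= n)%nat) by (apply INR_le; rewrite mult_INR; simpl (INR 2); lra).
set (Lg := ln (INR n) ^ 2 / Rpower (INR n) rho) in *.
assert (HR : 0 < ln (/ q)) by (rewrite ln_Rinv by lra; pose proof (ln_q_neg q Hq); lra).
pose proof (pos_INR nu) as Hnu0.
assert (Hkb : INR nu * Rabs b <= q ^ 4 * Lg).
{ apply Rle_trans with (q ^ 4 * ln (INR n) ^ 2 * Rpower (INR n) (- rho)).
  - apply Rmult_le_compat; [exact Hnu0|apply Rabs_pos|nra|exact Hb].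
  - right; unfold Lg; rewrite Rpower_Ropp; unfold Rdiv; ring. }
assert (Hkk : 0 <= q ^ 4 * Lg <= / 2).
{ split; [|exact Hk]; apply Rmult_le_pos; [apply pow_le; lra|exact HL0]. }
eapply Rle_trans; [apply (Aq_case q z theta beta b (q ^ 4 * Lg) n nu m); try assumption; lia|].
rewrite Hnu, powerRZ_double, powerRZ_square.
pose proof (Re_Bq_nonneg q (/ Cmod z ^ 2) Hq (Rinv_0_lt_compat _ Hr)) as HB.
set (B := Re (Bq q (RtoC (/ Cmod z ^ 2)))) in *.
destruct (Aq_const_ge q Hq) as [HK1 [HK2 HK3]].
set (K := qpoch_inf (- q ^ 3) q / ((1 - q) * qpoch_inf q q)) in *.
replace (48 * qpoch_inf (- q ^ 3) q * B / ((1 - q) * qpoch_inf q q))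
  with (48 * K * B) by (unfold K, Rdiv; ring).
set (r := Cmod z ^ 2) in *.
assert (Hrn : 0 < r ^ nu) by (apply pow_lt; exact Hr).
assert (Hu : q ^ (n - nu) <= Lg).
{ eapply Rle_trans; [|exact Hqnu]; apply pow_q_antitone; [exact Hq|lia]. }
assert (Hv : q ^ (S nu * S nu) * (/ r) ^ S nu <= q ^ (nu * nu) / r ^ nu).
{ assert (Hqr : q ^ nu <= r) by (apply HN; lia).
  assert (Hs : q ^ (S nu * S nu) <= q ^ (nu * nu) * q ^ nu).
  { rewrite <- pow_add; apply pow_q_antitone; [exact Hq|lia]. }
  assert (Hp : 0 < q ^ (nu * nu)) by (apply pow_lt; lra).
  rewrite pow_inv; simpl pow at 2; rewrite Rinv_mult.
  apply Rle_trans with (q ^ (nu * nu) * r * (/ r * / r ^ nu)).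
  - apply Rmult_le_compat_r.
    + left; apply Rmult_lt_0_compat; apply Rinv_0_lt_compat; assumption.
    + eapply Rle_trans; [exact Hs|]; apply Rmult_le_compat_l; lra.
  - right; field; lra. }
set (v := q ^ (nu * nu) / r ^ nu) in *.
set (v' := q ^ (S nu * S nu) * (/ r) ^ S nu) in *.
assert (Hv0 : 0 <= v').
{ apply Rmult_le_pos; apply pow_le; [lra|left; apply Rinv_0_lt_compat; exact Hr]. }
replace (48 * K * B * (Lg + v)) with (48 * K * (Lg + v) * B) by ring.
apply Rmult_le_compat_r; [exact HB|].
assert (Hc1 : q ^ (n - nu) / (1 - q) <= Lg * K).
{ apply Rmult_le_compat; [apply pow_le; lra|left; apply Rinv_0_lt_compat; lra|exact Hu|exact HK1]. }
assert (Hc2 : 2 * v' / qpoch_inf q q <= 2 * (v * K)).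
{ unfold Rdiv; rewrite Rmult_assoc; apply Rmult_le_compat_l; [lra|].
  apply Rmult_le_compat; [exact Hv0| |exact Hv|exact HK2].
  left; apply Rinv_0_lt_compat, qpoch_inf_qq_pos, Hq. }
assert (Hc3 : q ^ 4 * Lg <= Lg * K).
{ pose proof (pow_q_le1 q 4 Hq); nra. }
assert (0 <= v) by lra.
nra.
Qed.

(** * Diophantine approximation *)

(** The working form of infinitude: unlike avoidance of finite lists, it controls the size of [n]
    directly and so combines with residue classes. *)
Definition unbounded (P : nat -> Prop) : Prop :=
  forall N : nat, exists n, (N < n)%nat /\ P n.

Lemma in_le_list_max (l : list nat) (x : nat) : In x l -> (x <= list_max l)%nat.
Proof.
intro H; pose proof (proj1 (list_max_le l _) (Nat.le_refl _)) as Hf.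
rewrite Forall_forall in Hf; apply Hf; exact H.
Qed.

Lemma unbounded_infinitely_many (P : nat -> Prop) : unbounded P -> infinitely_many P.
Proof.
intros H l; destruct (H (list_max l)) as [n [Hn HP]]; exists n; split; [|exact HP].
intro Hi; apply in_le_list_max in Hi; lia.
Qed.

Lemma unbounded_infinitely_many_pairs (T : Type) (P : nat * T -> Prop) :
  unbounded (fun n => exists m, P (n, m)) -> infinitely_many P.
Proof.
intros H l; destruct (H (list_max (map fst l))) as [n [Hn [m HP]]].
exists (n, m); split; [|exact HP].
intro Hi; apply (in_map fst) in Hi; apply in_le_list_max in Hi; simpl in Hi; lia.
Qed.

Lemma frac_part_add_Z (x : R) (k : Z) : frac_part (x + IZR k) = frac_part x.
Proof.
symmetry; apply (Int_part_frac_part_spec (x + IZR k) (Int_part x + k) (frac_part x)).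
- destruct (base_fp x); lra.
- rewrite plus_IZR; pose proof (Rplus_Int_part_frac_part x); lra.
Qed.

(** The period is the denominator of [x]: adding a multiple of it to [k] changes [k x] by an
    integer. *)
Lemma rational_period (x : R) : rational x ->
  exists d : nat, (0 < d)%nat /\
    forall k j : nat, frac_part (INR (k + d * j) * x) = frac_part (INR k * x).
Proof.
intros [r ->]; exists (Pos.to_nat (Qden r)); split; [lia|].
intros k j.
replace (INR (k + Pos.to_nat (Qden r) * j) * Q2R r)
  with (INR k * Q2R r + IZR (Z.of_nat j * Qnum r)).
- apply frac_part_add_Z.
- rewrite plus_INR, mult_INR, mult_IZR, <- INR_IZR_INZ; unfold Q2R.
  rewrite (INR_IZR_INZ (Pos.to_nat _)), positive_nat_Z.
  field; apply not_0_IZR; lia.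
Qed.

Lemma Sfrac_unbounded (x lambda : R) : rational x -> Sfrac x lambda ->
  unbounded (fun n => lambda = frac_part (INR n * x)).
Proof.
intros Hx [k Hk] N; destruct (rational_period x Hx) as [d [Hd Hp]].
exists (k + d * S N)%nat; split; [nia|]; rewrite Hp; exact Hk.
Qed.

(** Classical: if [P] were bounded on each fibre of [f], the maximum of the finitely many bounds,
    built by induction on the number of fibres, would bound [P]. *)
Lemma unbounded_pigeonhole (P : nat -> Prop) (f : nat -> nat) (d : nat) :
  (forall n, (f n < d)%nat) -> unbounded P ->
  exists i, unbounded (fun n => P n /\ f n = i).
Proof.
intros Hf HP; apply NNPP; intro Hno.
assert (H : forall e, exists N, forall n, (N < n)%nat -> (f n < e)%nat -> ~ P n).
{ induction e as [|e [N HN]]; [exists O; intros; lia|].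
  assert (He : exists N', forall n, (N' < n)%nat -> ~ (P n /\ f n = e)).
  { apply NNPP; intro Hc; apply Hno; exists e; intro N'.
    apply NNPP; intro Hc'; apply Hc; exists N'; intros n Hn Hpn.
    apply Hc'; exists n; split; assumption. }
  destruct He as [N' HN']; exists (Nat.max N N'); intros n Hn Hfn Hpn.
  destruct (Nat.eq_dec (f n) e) as [E|E].
  - apply (HN' n); [lia|split; assumption].
  - apply (HN n); [lia|lia|exact Hpn]. }
destruct (H d) as [N HN]; destruct (HP N) as [n [Hn Hpn]].
exact (HN n Hn (Hf n) Hpn).
Qed.

(** The residue of [n] modulo the denominator of [x] fixes the fractional part of [n x]. This is how
    the mixed rational and irrational cases obtain their [lambda]. *)
Lemma frac_part_pigeonhole (x : R) (P : nat -> Prop) : rational x -> unbounded P ->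
  exists lambda, Sfrac x lambda /\
    unbounded (fun n => P n /\ lambda = frac_part (INR n * x)).
Proof.
intros Hx HP; destruct (rational_period x Hx) as [d [Hd Hp]].
destruct (unbounded_pigeonhole P (fun n => n mod d)%nat d) as [i Hi].
- intro n; apply Nat.mod_upper_bound; lia.
- exact HP.
- exists (frac_part (INR i * x)); split; [exists i; reflexivity|].
  intro N; destruct (Hi N) as [n [Hn [Hpn Hm]]]; exists n; split; [exact Hn|].
  split; [exact Hpn|].
  rewrite (Nat.div_mod_eq n d), Nat.add_comm, Hp, Hm; reflexivity.
Qed.

(** To exploit [infinitely_many], a finite box of integer vectors must be written as an explicit
    list to be avoided. *)
Fixpoint tuples (d : nat) (L : list Z) : list (list Z) :=
  match d with
  | O => nil :: nil
  | S e => flat_map (fun x => map (cons x) (tuples e L)) L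
  end.

Lemma in_tuples (L l : list Z) : (forall x, In x l -> In x L) -> In l (tuples (length l) L).
Proof.
induction l as [|x l IH]; intro H; [left; reflexivity|].
simpl; apply in_flat_map; exists x; split; [apply H; left; reflexivity|].
apply in_map, IH; intros y Hy; apply H; right; exact Hy.
Qed.

Definition Z_range (B : nat) : list Z :=
  map (fun i => (Z.of_nat i - Z.of_nat B)%Z) (seq 0 (2 * B + 1)).

Lemma in_Z_range (B : nat) (x : Z) : (Z.abs x <= Z.of_nat B)%Z -> In x (Z_range B).
Proof.
intro H; unfold Z_range; apply in_map_iff; exists (Z.to_nat (x + Z.of_nat B)).
split; [lia|apply in_seq; lia].
Qed.

Lemma bounded_below_index (f : nat -> R) (d : nat) :
  exists B : R, forall j, (j < d)%nat -> f j <= B.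
Proof.
induction d as [|d [B HB]]; [exists 0; intros; lia|].
exists (Rmax B (f d)); intros j Hj; destruct (Nat.eq_dec j d) as [->|Hn]; [apply Rmax_r|].
eapply Rle_trans; [apply HB; lia|apply Rmax_l].
Qed.

(* Bounded [n] leaves only finitely many admissible [m_1, ..., m_N]. *)
Lemma omega_admissible_unbounded (theta beta : list R) (r : R) : 1 <= r ->
  omega_admissible theta beta r ->
  unbounded (fun n => exists m : list Z, forall j, (j < length theta)%nat ->
    Rabs (INR n * nth j theta 0 - nth j beta 0 - IZR (nth j m 0%Z))
    < 1 / Rpower (INR n) (r - 1)).
Proof.
intros Hr H N.
(* For [n <= N] and an error below 1, [|m_j| <= N |theta_j| + |beta_j| + 1]; [B] bounds this over
   all [j]. *)
destruct (bounded_below_index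
  (fun j => INR N * Rabs (nth j theta 0) + Rabs (nth j beta 0) + 1) (length theta)) as [B HB].
destruct (H (list_prod (seq 0 (S N))
  (tuples (length theta) (Z_range (Z.to_nat (up B)))))) as [[n m] [Hni [Hn [Hl Hm]]]].
exists n; split; [|exists m; exact Hm].
apply Nat.nle_gt; intro HnN; apply Hni, in_prod; [apply in_seq; lia|].
rewrite <- Hl; apply in_tuples; intros x Hx; apply in_Z_range.
destruct (In_nth m x 0%Z Hx) as [j [Hj <-]]; rewrite Hl in Hj.
specialize (Hm j Hj); specialize (HB j Hj); simpl in HB.
assert (Hn1 : 1 <= INR n) by (apply (le_INR 1); lia).
assert (H1 : 1 / Rpower (INR n) (r - 1) <= 1).
{ unfold Rdiv; rewrite Rmult_1_l, <- Rpower_Ropp.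
  apply Rle_trans with (Rpower (INR n) 0); [apply Rle_Rpower; lra|].
  rewrite Rpower_O; lra. }
assert (HNn : INR n * Rabs (nth j theta 0) <= INR N * Rabs (nth j theta 0)).
{ apply Rmult_le_compat_r; [apply Rabs_pos|apply le_INR; exact HnN]. }
set (t := nth j theta 0) in *; set (b := nth j beta 0) in *; set (k := nth j m 0%Z) in *.
assert (Hk : Rabs (IZR k) <= B).
{ replace (IZR k) with (INR n * t + - b + - (INR n * t - b - IZR k)) by ring.
  eapply Rle_trans; [apply Rabs_triang|]; rewrite Rabs_Ropp.
  pose proof (Rabs_triang (INR n * t) (- b)) as Ht; rewrite Rabs_Ropp, Rabs_mult in Ht.
  rewrite (Rabs_pos_eq (INR n)) in Ht by lra; lra. }
destruct (archimed B) as [Hu _].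
rewrite <- abs_IZR in Hk.
assert (Hlt : (Z.abs k < up B)%Z) by (apply lt_IZR; lra).
lia.
Qed.

(** The supremum need not be attained, but [rho + 1] lies strictly below it, so some admissible [r]
    exceeds [rho + 1]. Then [n^(1 - r) <= n^(-rho)] for [n >= 1]. *)
Lemma omega_unbounded (theta beta : list R) (rho : R) : 0 < rho ->
  Rbar_lt (Finite rho) (Rbar_minus (omega theta beta) (Finite 1)) ->
  unbounded (fun n => exists m : list Z, forall j, (j < length theta)%nat ->
    Rabs (INR n * nth j theta 0 - nth j beta 0 - IZR (nth j m 0%Z))
    < Rpower (INR n) (- rho)).
Proof.
intros Hrho Hom.
assert (Hr : exists r, omega_admissible theta beta r /\ rho + 1 < r).
{ apply NNPP; intro Hno.
  assert (Hub : Rbar_le (omega theta beta) (Finite (rho + 1))).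
  { apply (proj2 (Lub_Rbar_correct (omega_admissible theta beta))).
    intros r Hr; simpl; apply Rnot_lt_le; intro Hlt; apply Hno; exists r; split; assumption. }
  (* The value plus infinity contradicts the upper bound just derived; minus infinity contradicts
     the lower bound by [rho]. *)
  destruct (omega theta beta) as [w| |]; simpl in Hom, Hub; [lra|exact Hub|exact Hom]. }
destruct Hr as [r [Ha Hr]].
intro N; destruct (omega_admissible_unbounded theta beta r ltac:(lra) Ha N) as [n [Hn [m Hm]]].
exists n; split; [exact Hn|]; exists m; intros j Hj.
eapply Rlt_le_trans; [apply (Hm j Hj)|].
unfold Rdiv; rewrite Rmult_1_l, <- Rpower_Ropp; apply Rle_Rpower; [|lra].
apply (le_INR 1); lia.
Qed.

Lemma omega1_unbounded (theta beta rho : R) : 0 < rho ->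
  Rbar_lt (Finite rho) (Rbar_minus (omega (theta :: nil) (beta :: nil)) (Finite 1)) ->
  unbounded (fun n => exists m, approx_le (INR n * theta) beta (Rpower (INR n) (- rho)) m).
Proof.
intros Hrho Hom N; destruct (omega_unbounded _ _ rho Hrho Hom N) as [n [Hn [m Hm]]].
exists n; split; [exact Hn|]; exists (nth 0 m 0%Z).
exists (INR n * theta - beta - IZR (nth 0 m 0%Z)); split; [ring|].
left; apply (Hm 0%nat); simpl; lia.
Qed.

Lemma omega2_unbounded (theta1 theta2 beta1 beta2 rho : R) : 0 < rho ->
  Rbar_lt (Finite rho) (Rbar_minus
    (omega (theta1 :: theta2 :: nil) (beta1 :: beta2 :: nil)) (Finite 1)) ->
  unbounded (fun n => exists m m1,
    approx_lt (INR n * theta1) beta1 (Rpower (INR n) (- rho)) m /\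
    approx_lt (INR n * theta2) beta2 (Rpower (INR n) (- rho)) m1).
Proof.
intros Hrho Hom N; destruct (omega_unbounded _ _ rho Hrho Hom N) as [n [Hn [m Hm]]].
exists n; split; [exact Hn|]; exists (nth 0 m 0%Z), (nth 1 m 0%Z); split.
- exists (INR n * theta1 - beta1 - IZR (nth 0 m 0%Z)); split; [ring|].
  apply (Hm 0%nat); simpl; lia.
- exists (INR n * theta2 - beta2 - IZR (nth 1 m 0%Z)); split; [ring|].
  apply (Hm 1%nat); simpl; lia.
Qed.

Lemma rational_opp (x : R) : rational x -> rational (- x).
Proof. intros [r ->]; exists (- r)%Q; symmetry; apply Q2R_opp. Qed.

Lemma Sfrac_bounds (x lambda : R) : Sfrac x lambda -> 0 <= lambda < 1.
Proof. intros [n ->]; destruct (base_fp (INR n * x)); lra. Qed.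

(** * Assembly of the seven cases *)

Lemma Cplus_minus_cancel (a b : C) : a = (b + (a - b))%C.
Proof. ring. Qed.

(** The remainder is taken to be the difference itself, so the identity holds for every [n] and only
    its estimate needs [n] large. *)
Lemma remainder_of_quotient (h p t : C) : p <> 0 -> h = (p * (t + (h / p - t)))%C.
Proof. intro H; field; exact H. Qed.

Theorem theorem3p1 (q : R) (z : C) (tau theta : R)
    (hq : 0 < q < 1) (hz : z <> RtoC 0) :
  (* (1) *)
  (0 < tau ->
    forall n : nat, (0 < n)%nat ->
      exists r : C,
        (h_at q z tau theta n
         / (Cpow z n * qpow q (- (RtoC (INR n ^ 2) * im_s q tau theta)))
         = 1 + r)%C /\
        Cmod r <= q * Re (Bq q (RtoC (q ^ 2 / Cmod z ^ 2)))
                  / ((1 - q) * Cmod z ^ 2) * Rpower q (INR n * tau))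
  /\
  (* (2) *)
  (tau = 0 -> rational theta ->
    forall lambda : R, Sfrac theta lambda ->
      infinitely_many (fun p : nat * Z => let (n, m) := p in
        (0 < n)%nat /\ INR n * theta = IZR m + lambda
        /\ lambda = frac_part (INR n * theta)) /\
      exists N0 : nat, forall (n : nat) (m : Z),
        (0 < n)%nat -> INR n * theta = IZR m + lambda ->
        lambda = frac_part (INR n * theta) ->
        exists r : C,
          (h_at q z tau theta n / norm0 q z theta n
           = Aq q (Cexp (RtoC (2 * lambda * PI) * Ci) / Cpow z 2) + r)%C /\
          ((N0 < n)%nat ->
           Cmod r <= 3 * qpoch_inf (- q ^ 3) q * Re (Bq q (RtoC (/ Cmod z ^ 2)))
                     / ((1 - q) * qpoch_inf q q)
                     * (Rpower q (INR n / 2)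
                        + Rpower q (INR n ^ 2 / 4) / Cmod z ^ (2 * (n / 2)))))
  /\
  (* (3) *)
  (tau = 0 -> irrational theta ->
    forall beta rho : R, 0 < rho ->
      Rbar_lt (Finite rho) (Rbar_minus (omega (theta :: nil) (beta :: nil)) (Finite 1)) ->
      infinitely_many (fun p : nat * Z => let (n, m) := p in
        (0 < n)%nat /\
        approx_le (INR n * theta) beta (Rpower (INR n) (- rho)) m) /\
      exists N0 : nat, forall (n : nat) (m : Z),
        (0 < n)%nat ->
        approx_le (INR n * theta) beta (Rpower (INR n) (- rho)) m ->
        exists r : C,
          (h_at q z tau theta n / norm0 q z theta n
           = Aq q (Cexp (RtoC (2 * PI * beta) * Ci) / Cpow z 2) + r)%C /\
          ((N0 < n)%nat ->
           Cmod r <= 48 * qpoch_inf (- q ^ 3) q * Re (Bq q (RtoC (/ Cmod z ^ 2)))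
                     / ((1 - q) * qpoch_inf q q)
                     * (ln (INR n) ^ 2 / Rpower (INR n) rho
                        + powerRZ q (nu_log q n * nu_log q n)
                          / powerRZ (Cmod z) (2 * nu_log q n))))
  /\
  (* (4) *)
  (-1 < tau < 0 -> rational tau -> rational theta ->
    forall lambda lambda1 : R, Sfrac (- tau) lambda -> Sfrac theta lambda1 ->
      infinitely_many (fun n : nat =>
        exists m m1 : Z, cond_rr tau theta lambda lambda1 n m m1) ->
      exists N0 : nat, forall (n : nat) (m m1 : Z),
        cond_rr tau theta lambda lambda1 n m m1 ->
          exists r : C,
            h_at q z tau theta n
            = (theta_prefactor q z tau theta n m (lambda1)
               * (Theta q (theta_arg q z (IZR (chi m) + lambda) lambda1) + r))%C /\
            ((N0 < n)%nat ->
             Cmod r <= 14 * qpoch_inf (- q ^ 3) q ^ 2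
                       * Re (Theta (sqrt q) (RtoC (Cmod z ^ 2)))
                       / ((1 - q) ^ 2 * qpoch_inf q q)
                       * (powerRZ q (nu_min tau n)
                          + powerRZ q (nu_min tau n * nu_min tau n)
                            * powerRZ (Cmod z) (2 * nu_min tau n)
                          + Rpower q (IZR (nu_min tau n * nu_min tau n) / 2)
                            / powerRZ (Cmod z) (2 * nu_min tau n))))
  /\
  (* (5) *)
  (-1 < tau < 0 -> rational tau -> irrational theta ->
    forall beta rho : R, 0 <= beta < 1 -> 0 < rho ->
      Rbar_lt (Finite rho) (Rbar_minus (omega (theta :: nil) (beta :: nil)) (Finite 1)) ->
      (exists lambda : R, Sfrac (- tau) lambda /\
        infinitely_many (fun n : nat =>
          exists m m1 : Z, cond_ri tau theta lambda beta rho n m m1)) /\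
      forall lambda : R, Sfrac (- tau) lambda ->
        exists N0 : nat, forall (n : nat) (m m1 : Z),
          cond_ri tau theta lambda beta rho n m m1 ->
          exists r : C,
            h_at q z tau theta n
            = (theta_prefactor q z tau theta n m (INR n * theta)
               * (Theta q (theta_arg q z (IZR (chi m) + lambda) beta) + r))%C /\
            ((N0 < n)%nat ->
             Cmod r <= bound62 q z rho n))
  /\
  (* (6) *)
  (-1 < tau < 0 -> irrational tau -> rational theta ->
    forall beta rho : R, 0 <= beta < 1 -> 0 < rho ->
      Rbar_lt (Finite rho) (Rbar_minus (omega (- tau :: nil) (beta :: nil)) (Finite 1)) ->
      (exists lambda : R, Sfrac theta lambda /\
        infinitely_many (fun n : nat =>
          exists m m1 : Z, cond_ir tau theta beta lambda rho n m m1)) /\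
      forall lambda : R, Sfrac theta lambda ->
        exists N0 : nat, forall (n : nat) (m m1 : Z),
          cond_ir tau theta beta lambda rho n m m1 ->
          exists r : C,
            h_at q z tau theta n
            = (theta_prefactor q z tau theta n m (INR n * theta)
               * (Theta q (theta_arg q z (IZR (chi m) + beta) lambda) + r))%C /\
            ((N0 < n)%nat ->
             Cmod r <= bound62 q z rho n))
  /\
  (* (7) *)
  (-1 < tau < 0 -> irrational tau -> irrational theta ->
    forall beta1 beta2 : R, 0 <= beta1 < 1 -> 0 <= beta2 < 1 ->
      Rbar_lt (Finite 1) (omega (- tau :: theta :: nil) (beta1 :: beta2 :: nil)) ->
      forall rho : R, 0 < rho ->
        Rbar_lt (Finite rho)
          (Rbar_minus (omega (- tau :: theta :: nil) (beta1 :: beta2 :: nil)) (Finite 1)) ->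
        infinitely_many (fun n : nat =>
          exists m m1 : Z, cond_ii tau theta beta1 beta2 rho n m m1) /\
        exists N0 : nat, forall (n : nat) (m m1 : Z),
          cond_ii tau theta beta1 beta2 rho n m m1 ->
          exists r : C,
            h_at q z tau theta n
            = (theta_prefactor q z tau theta n m (INR n * theta)
               * (Theta q (theta_arg q z (IZR (chi m) + beta1) beta2) + r))%C /\
            ((N0 < n)%nat ->
             Cmod r <= bound62 q z rho n)).
Proof.
repeat apply conj.
- intros Htau n Hn.
  set (P := (Cpow z n * qpow q (- (RtoC (INR n ^ 2) * im_s q tau theta)))%C).
  assert (HP : P <> 0) by (apply Cmult_neq_0; [apply Cpow_nz; exact hz|apply Cexp_neq_0]).
  exists (h_at q z tau theta n / P - 1)%C; split; [apply Cplus_minus_cancel|].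
  rewrite (h_at_expand q z tau theta n hq hz); fold P; rewrite (Cmult_div_cancel _ _ HP).
  assert (Hz2 : 0 < Cmod z ^ 2) by (apply pow_lt, Cmod_gt_0, hz).
  assert (Hi : 0 < / Cmod z ^ 2) by (apply Rinv_0_lt_compat; exact Hz2).
  pose proof (Cmod_im_arg q z tau theta n hz) as HX.
  assert (HX1 : Cmod (im_arg q z tau theta n) <= / Cmod z ^ 2).
  { rewrite HX, <- (Rmult_1_l (/ Cmod z ^ 2)); apply Rmult_le_compat_r; [lra|].
    apply Rle_trans with (Rpower q 0); [|rewrite Rpower_O; lra].
    (* Positivity of [tau] puts [|X|] below [|z|^(-2)], the value at which the [B_q] majorant is
       taken. *)
    apply Rpower_antitone; [exact hq|apply Rmult_le_pos; [apply pos_INR|lra]]. }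
  eapply Rle_trans; [apply (im_sum_tail q (/ Cmod z ^ 2) n _ hq Hi HX1)|].
  rewrite HX, Re_Bq; fold (q ^ 2 / Cmod z ^ 2); right; field; split; [|lra].
  apply Rgt_not_eq, Cmod_gt_0, hz.
- intros -> Hrat lambda Hl; split.
  + apply unbounded_infinitely_many_pairs.
    intro N; destruct (Sfrac_unbounded theta lambda Hrat Hl N) as [n [Hn Hf]].
    exists n; split; [exact Hn|]; exists (Int_part (INR n * theta)).
    split; [lia|split; [|exact Hf]].
    rewrite Hf; apply Rplus_Int_part_frac_part.
  + destruct (Aq_case_half q z theta hq hz) as [N0 HN]; exists N0.
    intros n m Hn Hth _.
    replace (2 * lambda * PI) with (2 * PI * lambda) by ring.
    eexists; split; [apply Cplus_minus_cancel|].
    intro HN0; exact (HN n m lambda HN0 Hth).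
- intros -> _ beta rho Hrho Hom; split.
  + apply unbounded_infinitely_many_pairs.
    intro N; destruct (omega1_unbounded theta beta rho Hrho Hom N) as [n [Hn [m Hm]]].
    exists n; split; [exact Hn|]; exists m; split; [lia|exact Hm].
  + destruct (Aq_case_log q z theta rho hq hz Hrho) as [N0 HN]; exists N0.
    intros n m Hn [g [Hth Hg]].
    eexists; split; [apply Cplus_minus_cancel|].
    intro HN0; exact (HN n m beta g HN0 Hth Hg).
- intros Htau _ _ lambda lambda1 Hl _ _.
  destruct (theta_case_min q z tau theta hq hz Htau) as [N0 HN]; exists N0.
  intros n m m1 [Hn [[Ht _] [Hth _]]].
  eexists; split; [apply remainder_of_quotient, theta_prefactor_neq_0; assumption|].
  intro HN0; exact (HN n m m1 lambda lambda1 HN0 Ht Hth (Sfrac_bounds _ _ Hl)).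
- intros Htau Hrat _ beta rho Hb Hrho Hom; split.
  (* Among the [n] good for [theta], some residue class modulo the denominator of [tau] is still
     infinite; it determines [lambda]. *)
  + destruct (frac_part_pigeonhole (- tau) _ (rational_opp tau Hrat)
      (omega1_unbounded theta beta rho Hrho Hom)) as [lambda [Hl Hu]].
    exists lambda; split; [exact Hl|]; apply unbounded_infinitely_many.
    intro N; destruct (Hu N) as [n [Hn [[m1 Hm1] Hf]]]; exists n; split; [exact Hn|].
    exists (Int_part (- INR n * tau)), m1; split; [lia|split; [exact Hm1|split; [|reflexivity]]].
    replace (INR n * - tau) with (- INR n * tau) in Hf by ring.
    rewrite Hf; apply Rplus_Int_part_frac_part.
  + intros lambda Hl.
    destruct (theta_case_log q z tau theta rho hq hz Htau Hrho) as [N0 HN]; exists N0.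
    intros n m m1 [Hn [[g [Hth Hg]] [Ht _]]].
    eexists; split; [apply remainder_of_quotient, theta_prefactor_neq_0; assumption|].
    (* The splitting of [- n tau] is exact, so the modulus is unperturbed and only the phase error
       [g] remains. *)
    intro HN0; apply (HN n m m1 lambda beta 0 g); try assumption; try reflexivity.
    * lra.
    * exact (Sfrac_bounds _ _ Hl).
    * rewrite Rabs_R0; left; apply Rpower_pos.
- intros Htau _ Hrat beta rho Hb Hrho Hom; split.
  + destruct (frac_part_pigeonhole theta _ Hrat
      (omega1_unbounded (- tau) beta rho Hrho Hom)) as [lambda [Hl Hu]].
    exists lambda; split; [exact Hl|]; apply unbounded_infinitely_many.
    intro N; destruct (Hu N) as [n [Hn [[m Hm] Hf]]]; exists n; split; [exact Hn|].
    exists m, (Int_part (INR n * theta)).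
    replace (INR n * - tau) with (- INR n * tau) in Hm by ring.
    split; [lia|split; [exact Hm|split; [|exact Hf]]].
    rewrite Hf; apply Rplus_Int_part_frac_part.
  + intros lambda Hl.
    destruct (theta_case_log q z tau theta rho hq hz Htau Hrho) as [N0 HN]; exists N0.
    intros n m m1 [Hn [[g [Ht Hg]] [Hth _]]].
    eexists; split; [apply remainder_of_quotient, theta_prefactor_neq_0; assumption|].
    (* The roles are exchanged: [g] perturbs the modulus through [q^g], and the phase is exact. *)
    intro HN0; apply (HN n m m1 beta lambda g 0); try assumption; try reflexivity.
    * lra.
    * rewrite Rabs_R0; left; apply Rpower_pos.
- intros Htau _ _ beta1 beta2 Hb1 Hb2 _ rho Hrho Hom; split.
  + apply unbounded_infinitely_many.
    intro N; destruct (omega2_unbounded (- tau) theta beta1 beta2 rho Hrho Hom N)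
      as [n [Hn [m [m1 [Hm Hm1]]]]].
    exists n; split; [exact Hn|]; exists m, m1.
    replace (INR n * - tau) with (- tau * INR n) in Hm by ring.
    split; [lia|split; assumption].
  + destruct (theta_case_log q z tau theta rho hq hz Htau Hrho) as [N0 HN]; exists N0.
    intros n m m1 [Hn [[g [Ht Hg]] [g' [Hth Hg']]]].
    eexists; split; [apply remainder_of_quotient, theta_prefactor_neq_0; assumption|].
    intro HN0; apply (HN n m m1 beta1 beta2 g g'); try assumption; try reflexivity.
    * lra.
    * left; exact Hg.
    * left; exact Hg'.
Qed.
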